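(* Let $G$ be a finitely generated group and $\mathcal{m}$ a probability measure on $G$ such that (A1) the support of $\mathcal{m}$ generates $G$, and (A2${}^+$) there exists $\delta>0$ with $\int (\mathrm{length}(g))^{1+\delta}\,d\mathcal{m}(g)<\infty$. Let $\rho: G\to \mathrm{SL}(2,\mathbb{M})$ be any group homomorphism. Then $$\frac{1}{\log|t|^{-1}}\,\chi(t)\longrightarrow \chi_{\mathsf{na}} \quad\text{as } t\to 0.$$
   Context: $\mathrm{length}(g)$ is the word length of $g$ with respect to a fixed finite symmetric generating set of $G$. $\mathbb{M}$ denotes the ring of holomorphic functions on the punctured unit disk $\mathbb{D}^*$ which extend meromorphically through $0$; a homomorphism $\rho:G\to\mathrm{SL}(2,\mathbb{M})$ is the same as a family of representations $\rho_t:G\to\mathrm{SL}(2,\mathbb{C})$, $t\in\mathbb{D}^*$, with $t\mapsto\rho_t(g)$ holomorphic on $\mathbb{D}^*$ and meromorphic at $0$ for each $g$. Let $\mathcal{m}^n$ be the image of $\mathcal{m}^{\otimes n}$ under $(g_1,\dots,g_n)\mapsto g_n\cdots g_1$. For $t\in\mathbb{D}^*$, $\chi(t)=\lim_{n\to\infty}\frac1n\int\log\|\rho_t(g)\|\,d\mathcal{m}^n(g)$, where $\|\cdot\|$ is any matrix norm on $\mathrm{SL}(2,\mathbb{C})$ (e.g. the operator norm for the max norm on $\mathbb{C}^2$). Let $\mathbb{L}=\mathbb{C}((t))$ with the $t$-adic absolute value $|f|_{\mathsf{na}}=\exp(-\mathrm{ord}_{t=0}f)$; viewing $\mathbb{M}\subset\mathbb{L}$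 (Laurent expansion at $0$), $\rho$ induces $\rho_{\mathsf{na}}:G\to\mathrm{SL}(2,\mathbb{L})$. For $A\in\mathrm{SL}(2,\mathbb{L})$ let $\|A\|_{\mathsf{na}}$ be the maximum of the $t$-adic absolute values of its entries, and $\chi_{\mathsf{na}}=\lim_{n\to\infty}\frac1n\int\log\|\rho_{\mathsf{na}}(g)\|_{\mathsf{na}}\,d\mathcal{m}^n(g)$. *)

(* Defs.v *)
From HB Require Import structures.
From mathcomp Require Import all_boot all_order all_algebra.
From mathcomp Require Import all_classical all_reals all_analysis.
From mathcomp Require Import complex.
Set Implicit Arguments. Unset Strict Implicit. Unset Printing Implicit Defensive.
Import Order.TTheory GRing.Theory Num.Theory.
Export numFieldTopology.Exports.
Local Open Scope classical_set_scope.
Local Open Scope ring_scope.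

HB.instance Definition _ (R : realType) := PseudoPointedMetric.copy R[i] R[i]^o.

Definition cabs (R : realType) (z : R[i]) : R := ComplexField.Normc.normc z.

Definition gprod (G : groupType) (s : seq G) : G :=
  foldr (@monoid.mul G) (@monoid.one G) s.

Definition sym_gen_set (G : groupType) (S : seq G) : Prop :=
  (forall x, x \in S -> monoid.inv x \in S) /\
  (forall g : G, exists s : seq G, all (fun x => x \in S) s /\ g = gprod s).

Definition word_of_len (G : groupType) (S : seq G) (g : G) (n : nat) : Prop :=
  exists s : seq G, [/\ all (fun x => x \in S) s, size s = n & g = gprod s].

Definition word_length (G : groupType) (S : seq G) (g : G) : nat :=
  xget 0%N [set n | word_of_len S g n /\ forall k, word_of_len S g k -> (n <= k)%N].

Definition prob_on (R : realType) (G : groupType) (m : G -> R) : Prop :=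
  (forall g, 0 <= m g) /\ (\esum_(g in [set: G]) (m g)%:E = 1)%E.

Definition supp_generates (R : realType) (G : groupType) (m : G -> R) : Prop :=
  forall g : G, exists s : seq G,
    all (fun x => (0 < m x) || (0 < m (monoid.inv x))) s /\ g = gprod s.

(* integral of a nonnegative function f against m^n, the image of m^{(x)n}
   under (g_1,...,g_n) |-> g_n ... g_1 *)
Definition int_conv (R : realType) (G : groupType) (m : G -> R) (n : nat)
    (f : G -> R) : \bar R :=
  (\esum_(s in [set: n.-tuple G])
     ((\prod_(i < n) m (tnth s i)) * f (gprod (rev s)))%:E)%E.

Definition cdisk (R : realType) : set R[i] := [set z | cabs z < 1].
Definition cpdisk (R : realType) : set R[i] := [set z | cabs z < 1 /\ z != 0].

Definition holo_on (R : realType) (U : set R[i]) (f : R[i] -> R[i]) : Prop :=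
  forall z, U z -> exists l : R[i], (fun h => (f (z + h) - f z) / h) @ dnbhs 0 --> l.

(* f (a function on D^*, values outside D^* irrelevant) belongs to M *)
Definition in_M (R : realType) (f : R[i] -> R[i]) : Prop :=
  holo_on (@cpdisk R) f /\
  exists (k : nat) (g : R[i] -> R[i]),
    holo_on (@cdisk R) g /\ forall z, cpdisk z -> f z = g z / z ^+ k.

Definition ord_ge (R : realType) (f : R[i] -> R[i]) (n : int) : Prop :=
  exists g : R[i] -> R[i],
    holo_on (@cdisk R) g /\ forall z, cpdisk z -> f z = z ^ n * g z.

Definition eval_rep (R : realType) (G : groupType)
    (rho : G -> 'I_2 -> 'I_2 -> R[i] -> R[i]) (t : R[i]) (g : G) : 'M[R[i]]_2 :=
  \matrix_(i, j) rho g i j t.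

Definition is_SL2M_hom (R : realType) (G : groupType)
    (rho : G -> 'I_2 -> 'I_2 -> R[i] -> R[i]) : Prop :=
  [/\ forall g i j, in_M (rho g i j),
      forall g t, cpdisk t -> \det (eval_rep rho t g) = 1 &
      forall g h t, cpdisk t ->
        eval_rep rho t (monoid.mul g h) = eval_rep rho t g *m eval_rep rho t h].

(* operator norm for the max norm on C^2 : max row sum *)
Definition opnorm (R : realType) (A : 'M[R[i]]_2) : R :=
  \big[Num.max/0]_(i < 2) \sum_(j < 2) cabs (A i j).

Definition chi (R : realType) (G : groupType) (m : G -> R)
    (rho : G -> 'I_2 -> 'I_2 -> R[i] -> R[i]) (t : R[i]) : R :=
  lim ((fun n : nat => n%:R^-1 * fine (int_conv m n
          (fun g => ln (opnorm (eval_rep rho t g))))) @ \oo).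

(* log of the non-archimedean norm of rho_na(g):
   log max_{i,j} exp(-ord a_ij) = - min_{i,j} ord a_ij
   = least integer k with ord a_ij >= -k for all i j *)
Definition nalog (R : realType) (G : groupType)
    (rho : G -> 'I_2 -> 'I_2 -> R[i] -> R[i]) (g : G) : R :=
  inf [set x : R | exists k : int, x = k%:~R /\ forall i j, ord_ge (rho g i j) (- k)].

Definition chi_na (R : realType) (G : groupType) (m : G -> R)
    (rho : G -> 'I_2 -> 'I_2 -> R[i] -> R[i]) : R :=
  lim ((fun n : nat => n%:R^-1 * fine (int_conv m n (nalog rho))) @ \oo).

(* Main.v *)
Require Import Defs.
From HB Require Import structures.
From mathcomp Require Import all_boot all_order all_algebra.
From mathcomp Require Import all_classical all_reals all_analysis.
From mathcomp Require Import complex zify ring lra.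
Set Implicit Arguments.
Unset Strict Implicit.
Unset Printing Implicit Defensive.
Import Order.TTheory GRing.Theory Num.Theory.
Import numFieldNormedType.Exports.
Local Open Scope classical_set_scope.
Local Open Scope ring_scope.

(** Divide logarithms of norms by [ln |t|^-1]. The resulting lengths [N_t] on [G]
    converge pointwise to the non-archimedean length [N] (the order of the pole of
    the matrix entries), and all of them are dominated by the word length. The upper
    bound [limsup chi(t) / ln |t|^-1 <= chi_na] then follows from subadditivity.

    For the lower bound suppose [chi_na > 0], and look at the functions
    [det (rho_t(g) rho_t(h) - rho_t(h) rho_t(g))] of [t], which detect common
    eigenlines.
    - If all of them vanish near [0], then [rho_t] has an invariant line. Up to
      [o(1)], [N_t(gh) <= max (N_t(g) + phi_t(h), N_t(h) - phi_t(g))], where the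
      homomorphism [phi_t] comes from the eigenvalue on this line. Hence [chi_na] is
      at most the absolute value of the mean of [phi_t], which bounds
      [chi(t) / ln |t|^-1] from below, up to [o(1)].
    - Otherwise use that [N] satisfies the four-point inequality of a tree, by the
      Pluecker relation. The Gromov products of two independent walks are [o(n)]
      with high probability: if not, the walk would concentrate in one direction,
      which all of [G] would almost fix, so that the determinants above would vanish.
      Therefore for some [n] and every vector [v] the mean of [ln (|g v| / |v|)]
      after [n] steps is at least [n (chi_na - eps)], uniformly in [v]. This
      inequality persists for small [t], and iterating it bounds [chi(t)] from below. *)

(** * Complex modulus, continuity and differentiability *)

Section ComplexModulus.
Variable R : realType.
Local Notation C := R[i].
Local Notation Re := (@complex.Re R).
Local Notation Im := (@complex.Im R).
Implicit Types (z w : C) (a x y : R) (n : nat).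

Lemma normr_cabs z : `|z| = (cabs z)%:C%C. Proof. by []. Qed.

Lemma cabs0 : cabs (0 : C) = 0. Proof. exact: ComplexField.Normc.normc0. Qed.

Lemma cabs1 : cabs (1 : C) = 1. Proof. exact: ComplexField.Normc.normc1. Qed.

Lemma cabsM z w : cabs (z * w) = cabs z * cabs w.
Proof. exact: ComplexField.Normc.normcM. Qed.

Lemma cabsV z : cabs z^-1 = (cabs z)^-1.
Proof. exact: ComplexField.Normc.normcV. Qed.

Lemma cabsN z : cabs (- z) = cabs z.
Proof. by have := normrN z; rewrite !normr_cabs => -[]. Qed.

Lemma cabs_distC z w : cabs (z - w) = cabs (w - z).
Proof. by rewrite -cabsN opprB. Qed.

Lemma cabsD z w : cabs (z + w) <= cabs z + cabs w.
Proof. by have := ler_normD z w; rewrite !normr_cabs -rmorphD lecR. Qed.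

Lemma cabsB z w : cabs (z - w) <= cabs z + cabs w.
Proof. by rewrite -(cabsN w) cabsD. Qed.

Lemma cabs_ge0 z : 0 <= cabs z.
Proof. by have := normr_ge0 z; rewrite normr_cabs -(rmorph0 (real_complex R)) lecR. Qed.

Lemma cabs_eq0 z : (cabs z == 0) = (z == 0).
Proof.
apply/eqP/eqP => [|->]; last exact: cabs0.
exact: ComplexField.Normc.eq0_normc.
Qed.

Lemma cabs_gt0 z : (0 < cabs z) = (z != 0).
Proof. by rewrite lt_def cabs_ge0 andbT cabs_eq0. Qed.

Lemma cabsX z n : cabs (z ^+ n) = cabs z ^+ n.
Proof. by elim: n => [|n IH]; rewrite ?expr0 ?cabs1// !exprS cabsM IH. Qed.

Lemma cabs_real a : cabs a%:C%C = `|a|.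
Proof. by rewrite /cabs /ComplexField.Normc.normc /= expr0n /= addr0 sqrtr_sqr. Qed.

Lemma cabs_i : cabs ('i%C : C) = 1.
Proof.
by rewrite /cabs /ComplexField.Normc.normc /= expr0n /= add0r expr1n sqrtr1.
Qed.

Lemma sqr_cabs z : cabs z ^+ 2 = Re z ^+ 2 + Im z ^+ 2.
Proof. by case: z => a b; rewrite /cabs /= sqr_sqrtr// addr_ge0// sqr_ge0. Qed.

Lemma cabs_Re z : `|Re z| <= cabs z.
Proof. by have := normc_ge_Re z; rewrite normr_cabs lecR. Qed.

Lemma cabs_Im z : `|Im z| <= cabs z.
Proof. by rewrite -normrN -ReiNIm (le_trans (cabs_Re _))// cabsM cabs_i mulr1. Qed.

Lemma complex_split x y : (x +i* y)%C = x%:C%C + 'i%C * y%:C%C.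
Proof. exact: complexE. Qed.

Lemma cabs_complex x y : cabs (x +i* y)%C <= `|x| + `|y|.
Proof.
rewrite complex_split; apply: le_trans (cabsD _ _) _.
by rewrite cabsM cabs_i mul1r !cabs_real.
Qed.

Lemma ler_distB_cabs z w : `|cabs z - cabs w| <= cabs (z - w).
Proof.
rewrite ler_norml; have := cabsD (z - w) w; have := cabsD (w - z) z.
by rewrite !subrK (cabs_distC w z); lra.
Qed.

Lemma dist_Re_le z w : `|Re z - Re w| <= cabs (z - w).
Proof. by have := cabs_Re (z - w); case: z w => a b [c d]. Qed.

Lemma dist_Im_le z w : `|Im z - Im w| <= cabs (z - w).
Proof. by have := cabs_Im (z - w); case: z w => a b [c d]. Qed.

End ComplexModulus.

Section ComplexTopology.
Variable R : realType.
Local Notation C := R[i].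
Local Notation Re := (@complex.Re R).
Local Notation Im := (@complex.Im R).
Implicit Types (z w : C) (f g q : C -> C) (P : set C).

Lemma nbhs_cabsP z P : nbhs z P <->
  exists2 d : R, 0 < d & forall w, cabs (w - z) < d -> P w.
Proof.
split=> [/nbhs_ballP[e /= e0 ball_sub]|[d d0 dist_lt_P]].
  have eE : e = (Re e)%:C%C by rewrite RRe_real// gtr0_real.
  exists (Re e); first by move: e0; rewrite {1}eE -(rmorph0 (real_complex R)) ltcR.
  by move=> w wd; apply: ball_sub; rewrite /ball /= normr_cabs eE ltcR /= cabs_distC.
apply/nbhs_ballP; exists d%:C%C => /=; first by rewrite -(rmorph0 (real_complex R)) ltcR.
by move=> w; rewrite /ball /= normr_cabs ltcR cabs_distC => /dist_lt_P.
Qed.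

Lemma near_cabs_lt z (d : R) : 0 < d -> \forall w \near z, cabs (w - z) < d.
Proof. by move=> d0; apply/nbhs_cabsP; exists d. Qed.

Lemma dnbhs_cabsP z P : dnbhs z P <->
  exists2 d : R, 0 < d & forall w, w != z -> cabs (w - z) < d -> P w.
Proof.
rewrite -[dnbhs z P]/(nbhs z [set w | w != z -> P w]) nbhs_cabsP.
by split=> -[d d0 distP]; exists d => // w ? ?; exact: distP.
Qed.

Lemma continuous_cabsP f z : {for z, continuous f} <->
  forall e : R, 0 < e -> \forall w \near z, cabs (f w - f z) < e.
Proof.
split=> [fz e e0|fz P /nbhs_cabsP[e e0 ball_sub]].
  by apply: (fz [set y | cabs (y - f z) < e]); exact: near_cabs_lt.
by apply: filterS (fz e e0) => w; exact: ball_sub.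
Qed.

Lemma continuous_cabs_lipschitz (k : C -> R) :
  (forall z w, `|k z - k w| <= cabs (z - w)) -> continuous k.
Proof.
move=> kl z; apply/(@cvgrPdist_lt R R^o C (nbhs z) (nbhs_filter z) k (k z)) => e e0.
apply: filterS (near_cabs_lt z e0) => w; rewrite cabs_distC.
exact: le_lt_trans (kl _ _).
Qed.

Lemma cabs_continuous : continuous (@cabs R).
Proof. exact: continuous_cabs_lipschitz (@ler_distB_cabs R). Qed.

Lemma Re_continuous : continuous Re.
Proof. exact: continuous_cabs_lipschitz (@dist_Re_le R). Qed.

Lemma Im_continuous : continuous Im.
Proof. exact: continuous_cabs_lipschitz (@dist_Im_le R). Qed.

Lemma continuous_atD (T : topologicalType) (f g : T -> C) (x : T) :
  {for x, continuous f} -> {for x, continuous g} ->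
  {for x, continuous (fun y => f y + g y)}.
Proof. by move=> cf cg; exact: (@cvgD C C^o _ _ _ f g _ _ cf cg). Qed.

Lemma continuous_atB (T : topologicalType) (f g : T -> C) (x : T) :
  {for x, continuous f} -> {for x, continuous g} ->
  {for x, continuous (fun y => f y - g y)}.
Proof. by move=> cf cg; exact: (@cvgB C C^o _ _ _ f g _ _ cf cg). Qed.

Lemma continuous_atM (T : topologicalType) (f g : T -> C) (x : T) :
  {for x, continuous f} -> {for x, continuous g} ->
  {for x, continuous (fun y => f y * g y)}.
Proof. by move=> cf cg; exact: (@cvgM C _ _ _ f g _ _ cf cg). Qed.

Lemma continuous_atV (T : topologicalType) (f : T -> C) (x : T) :
  f x != 0 -> {for x, continuous f} -> {for x, continuous (fun y => (f y)^-1)}.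
Proof. by move=> fx cf; exact: (@cvgV C _ _ _ f _ fx cf). Qed.

Lemma continuous_at_cst (T : topologicalType) (c : C) (x : T) :
  {for x, continuous (fun=> c)}.
Proof. exact: (@cst_continuous T C c x). Qed.

Lemma continuous_at_id z : {for z, continuous (id : C -> C)}.
Proof. exact: cvg_id. Qed.

Lemma near_neq0 f z : {for z, continuous f} -> f z != 0 -> \forall w \near z, f w != 0.
Proof. by move=> cf; exact: (@cvgr_neq0 C C^o _ _ _ f _ cf). Qed.

Lemma continuous_eq_dnbhs f g z : {for z, continuous f} -> {for z, continuous g} ->
  (\forall w \near z^', f w = g w) -> f z = g z.
Proof.
move=> cf cg fg; apply/eqP; rewrite -subr_eq0; apply: contraT => fgz.
have fg_neq := near_neq0 (continuous_atB cf cg) fgz.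
suff [w [-> /eqP]] : exists w, f w = g w /\ f w - g w != 0 by rewrite subrr.
apply: (@filter_ex _ z^' (@Proper_dnbhs_numFieldType C z)).
near=> w; split; first by near: w.
by near: w; exact: nbhs_dnbhs.
Unshelve. all: by end_near. Qed.

Definition cderivable f z := derivable (f : C^o -> C^o) z 1.

Lemma cderivableE f z : cderivable f z <->
  exists l : C, (fun h => (f (z + h) - f z) / h) @ dnbhs 0 --> l.
Proof.
rewrite /cderivable /derivable.
have -> : (fun h => h^-1 *: (((f : C^o -> C^o) \o shift z) (h *: (1 : C^o)) - f z)) =
    (fun h => (f (z + h) - f z) / h).
  by apply/funext => h; rewrite /= [h *: _]mulr1 [h + z]addrC [RHS]mulrC.
by split=> [/cvg_ex|[l] cvg_l]; [|apply/cvg_ex; exists l].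
Qed.

Lemma holo_onP (U : set C) f : holo_on U f <-> forall z, U z -> cderivable f z.
Proof. by split=> df z /df /cderivableE. Qed.

Lemma cderivable_continuous f z : cderivable f z -> {for z, continuous f}.
Proof. by move=> /derivable1_diffP; exact: (@differentiable_continuous C C^o C^o). Qed.

Lemma cderivable_cst (c : C) z : cderivable (fun=> c) z.
Proof. exact: (@derivable_cst C C^o C^o). Qed.

Lemma cderivable_id z : cderivable id z.
Proof. exact: (@derivable_id C C^o). Qed.

Lemma cderivableD f g z : cderivable f z -> cderivable g z ->
  cderivable (fun w => f w + g w) z.
Proof. by move=> df dg; exact: (@derivableD C C^o C^o f g _ _ df dg). Qed.

Lemma cderivableB f g z : cderivable f z -> cderivable g z ->
  cderivable (fun w => f w - g w) z.
Proof. by move=> df dg; exact: (@derivableB C C^o C^o f g _ _ df dg). Qed.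

Lemma cderivableM f g z : cderivable f z -> cderivable g z ->
  cderivable (fun w => f w * g w) z.
Proof. by move=> df dg; exact: (@derivableM C C^o f g _ _ df dg). Qed.

Lemma cderivableV f z : f z != 0 -> cderivable f z -> cderivable (fun w => (f w)^-1) z.
Proof. by move=> fz df; exact: (@derivableV C C^o f _ _ fz df). Qed.

Lemma cderivableX n z : cderivable (fun w => w ^+ n) z.
Proof. exact: (@exprn_derivable C n z 1). Qed.

Lemma near_eq_cderivable f g z : (\forall w \near z, f w = g w) ->
  cderivable f z -> cderivable g z.
Proof.
move=> fg; apply: (@near_eq_derivable C C^o C^o) => //; exact: oner_neq0.
Qed.

Lemma cderivable_slopeP f z : cderivable f z <->
  exists2 q, {for z, continuous q} & forall w, f w - f z = (w - z) * q w.
Proof.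
rewrite cderivableE; split=> [[l slope_cvg]|[q cq slopeE]]; last first.
  exists (q z); have /continuous_cabsP qz := cq.
  apply: (@cvg_trans _ (q (z + h) @[h --> 0^'])).
    apply: near_eq_cvg; apply/dnbhs_cabsP; exists 1 => // h h0 _.
    by rewrite slopeE [z + h]addrC addrK mulrC mulKf.
  move=> P /nbhs_cabsP[e e0 ball_sub]; have /nbhs_cabsP[d d0 q_near] := qz e e0.
  apply/dnbhs_cabsP; exists d => // h _; rewrite subr0 => hd; apply/ball_sub/q_near.
  by rewrite [z + h]addrC addrK.
pose q w := if w == z then l else (f w - f z) / (w - z).
have qE w : w != z -> q w = (f w - f z) / (w - z) by rewrite /q => /negPf ->.
have qz : q z = l by rewrite /q eqxx.
exists q => [|w]; last first.
  have [->|wz] := eqVneq w z; first by rewrite !subrr mul0r.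
  by rewrite qE// mulrC divfK// subr_eq0.
apply/continuous_cabsP => e e0; rewrite qz.
have /dnbhs_cabsP[d d0 slope_near] := slope_cvg _ (near_cabs_lt l e0).
apply/nbhs_cabsP; exists d => // w wd.
have [->|wz] := eqVneq w z; first by rewrite qz subrr cabs0.
have := slope_near (w - z); rewrite subr0 subr_eq0 => /(_ wz wd) /=.
by rewrite addrCA subrr addr0 qE.
Qed.

End ComplexTopology.

(** * Integration along segments and rectangles *)

HB.lock Definition cintegral (R : realType) (u : R -> R[i]) (a b : R) : R[i] :=
  ((\int[@lebesgue_measure R]_(x in `[a, b]) complex.Re (u x)) +i*
   (\int[@lebesgue_measure R]_(x in `[a, b]) complex.Im (u x)))%C.

Section SegmentIntegral.
Variable R : realType.
Local Notation C := R[i].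
Local Notation Re := (@complex.Re R).
Local Notation Im := (@complex.Im R).
Local Notation mu := (@lebesgue_measure R).
Implicit Types (u v : R -> C) (k : C -> R) (a b c : R).

Lemma integrable_continuous_comp k u a b : continuous k ->
  {within `[a, b], continuous u} -> mu.-integrable `[a, b] (EFin \o (k \o u)).
Proof.
move=> ck cu; apply: continuous_compact_integrable; first exact: segment_compact.
by move=> x; apply: (continuous_comp (cu x)); exact: ck.
Qed.

Let integrableRe u a b : {within `[a, b], continuous u} ->
  mu.-integrable `[a, b] (EFin \o (Re \o u)).
Proof. exact: integrable_continuous_comp (@Re_continuous R). Qed.

Let integrableIm u a b : {within `[a, b], continuous u} ->
  mu.-integrable `[a, b] (EFin \o (Im \o u)).
Proof. exact: integrable_continuous_comp (@Im_continuous R). Qed.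

Lemma eq_cintegral u v a b : (forall x, a <= x <= b -> u x = v x) ->
  cintegral u a b = cintegral v a b.
Proof.
move=> uv; rewrite cintegral.unlock; congr Complex; apply: eq_Rintegral => x;
  by rewrite inE /= in_itv /= => xab; rewrite uv.
Qed.

Lemma cintegralD u v a b :
  {within `[a, b], continuous u} -> {within `[a, b], continuous v} ->
  cintegral (fun x => u x + v x) a b = cintegral u a b + cintegral v a b.
Proof.
move=> cu cv; rewrite cintegral.unlock; congr Complex.
  rewrite -RintegralD//; [|exact: integrableRe|exact: integrableRe].
  by apply: eq_Rintegral => x _ /=; case: (u x) (v x) => ? ? [].
rewrite -RintegralD//; [|exact: integrableIm|exact: integrableIm].
by apply: eq_Rintegral => x _ /=; case: (u x) (v x) => ? ? [].
Qed.

Lemma cintegralZl (k : C) u a b : {within `[a, b], continuous u} ->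
  cintegral (fun x => k * u x) a b = k * cintegral u a b.
Proof.
move=> cu; have iR := integrableRe cu; have iI := integrableIm cu.
have iRZ (r : R) : mu.-integrable `[a, b] (EFin \o (fun x => r * Re (u x))).
  by apply: eq_integrable (integrableZl _ r iR).
have iIZ (r : R) : mu.-integrable `[a, b] (EFin \o (fun x => r * Im (u x))).
  by apply: eq_integrable (integrableZl _ r iI).
rewrite cintegral.unlock; case: k => k1 k2; congr Complex.
  rewrite -(RintegralZl k1 _ iR)// -(RintegralZl k2 _ iI)// -(RintegralB _ (iRZ _) (iIZ _))//.
  by apply: eq_Rintegral => x _ /=; case: (u x).
rewrite -(RintegralZl k2 _ iR)// -(RintegralZl k1 _ iI)// -(RintegralD _ (iIZ _) (iRZ _))//.
  by apply: eq_Rintegral => x _ /=; case: (u x) => ? ? /=; rewrite addrC.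
Qed.

Lemma Rintegral_cat (k : R -> R) a b c : a <= c -> c <= b ->
  mu.-integrable `[a, b] (EFin \o k) ->
  \int[mu]_(x in `[a, b]) k x =
  \int[mu]_(x in `[a, c]) k x + \int[mu]_(x in `[c, b]) k x.
Proof.
move=> ac cb ik; have := @Rintegral_itvB R k (BLeft a) (BRight b) c ik.
rewrite !bnd_simp => /(_ ac cb) catE.
rewrite -(@Rintegral_itv_obnd_cbnd R c (BRight b)).
  by rewrite -catE addrC subrK.
apply: integrableS ik => // x /=; rewrite !in_itv /= => /andP[cx ->].
by rewrite (le_trans ac (ltW cx)).
Qed.

Lemma cintegral_cat u a b c : a <= c -> c <= b -> {within `[a, b], continuous u} ->
  cintegral u a b = cintegral u a c + cintegral u c b.
Proof.
move=> ac cb cu; rewrite cintegral.unlock; congr Complex; apply: (Rintegral_cat ac cb).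
  exact: integrableRe.
exact: integrableIm.
Qed.

Lemma Rintegral_itv_cst (r : R) a b : a <= b -> \int[mu]_(x in `[a, b]) r = r * (b - a).
Proof.
move=> ab; rewrite Rintegral_cst//= lebesgue_measure_itv /= lte_fin.
by case: ltP => //= ba; rewrite (@le_anti _ _ a b) ?ab ?ba// subrr.
Qed.

Lemma cintegral_cst (k : C) a b : a <= b -> cintegral (fun=> k) a b = k * (b - a)%:C%C.
Proof.
move=> ab; rewrite cintegral.unlock !Rintegral_itv_cst//.
by apply/eqP; rewrite eq_complex; case: k => k1 k2 /=; apply/andP; split; apply/eqP; ring.
Qed.

Lemma cintegral_real (k : R -> R) a b : a <= b ->
  cintegral (fun x => (k x)%:C%C) a b = (\int[mu]_(x in `[a, b]) k x)%:C%C.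
Proof. by move=> ab; rewrite cintegral.unlock /= Rintegral_itv_cst// mul0r. Qed.

Lemma cabs_cintegral_le u a b (B : R) : a <= b -> {within `[a, b], continuous u} ->
  (forall x, a <= x <= b -> cabs (u x) <= B) -> cabs (cintegral u a b) <= 2 * B * (b - a).
Proof.
move=> ab cu uB.
have bnd k : continuous k -> (forall z, `|k z| <= cabs z) ->
    `|\int[mu]_(x in `[a, b]) k (u x)| <= B * (b - a).
  move=> ck kc; have ik := integrable_continuous_comp ck cu.
  apply: le_trans (le_normr_Rintegral _ ik) _ => //.
  rewrite -Rintegral_itv_cst//; apply: le_Rintegral => //.
  - exact: (integrable_norm ik).
  - apply: continuous_compact_integrable; first exact: segment_compact.
    by move=> ?; exact: cvg_cst.
  - by move=> x; rewrite /= in_itv /= => xab; apply: le_trans (kc _) (uB _ _).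
rewrite cintegral.unlock; apply: le_trans (cabs_complex _ _) _.
rewrite -mulrA mulr_natl mulr2n.
by apply: lerD; apply: bnd; [exact: Re_continuous|exact: cabs_Re
                            |exact: Im_continuous|exact: cabs_Im].
Qed.

End SegmentIntegral.

Section RectangleIntegral.
Variable R : realType.
Local Notation C := R[i].
Local Notation Re := (@complex.Re R).
Local Notation Im := (@complex.Im R).
Implicit Types (f g : C -> C) (z w : C) (a b c d x y : R).

Definition rect a b c d : set C := [set z | a <= Re z <= b /\ c <= Im z <= d].

Definition frame a b c d : set C :=
  [set z | rect a b c d z /\ [\/ Re z = a, Re z = b, Im z = c | Im z = d]].

Lemma subset_frame a b c d : frame a b c d `<=` rect a b c d.
Proof. by move=> z []. Qed.

Lemma subset_rect a b c d a' b' c' d' : a' <= a -> b <= b' -> c' <= c -> d <= d' ->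
  rect a b c d `<=` rect a' b' c' d'.
Proof. by move=> ? ? ? ? z [/andP[? ?] /andP[? ?]]; split; lra. Qed.

Lemma rect_dist a b c d z w : rect a b c d z -> rect a b c d w ->
  cabs (z - w) <= (b - a) + (d - c).
Proof.
case: z w => [x y] [x' y'] [/= /andP[? ?] /andP[? ?]] [/= /andP[? ?] /andP[? ?]].
by apply: le_trans (cabs_complex _ _) _; apply: lerD; rewrite ler_norml; lra.
Qed.

Lemma frame_sides a b c d : a <= b -> c <= d ->
  (forall x, a <= x <= b -> frame a b c d (x +i* c)%C /\ frame a b c d (x +i* d)%C) /\
  (forall y, c <= y <= d -> frame a b c d (a +i* y)%C /\ frame a b c d (b +i* y)%C).
Proof.
move=> ab cd; split=> [x xab|y ycd]; split; split=> /=;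
  by [split=> //=; rewrite ?lexx ?ab ?cd|constructor].
Qed.

Definition rectint f a b c d : C :=
  cintegral (fun x => f (x +i* c)%C - f (x +i* d)%C) a b +
  'i%C * cintegral (fun y => f (b +i* y)%C - f (a +i* y)%C) c d.

Lemma continuous_at_hline f x y : {for (x +i* y)%C, continuous f} ->
  {for x, continuous (fun x => f (x +i* y)%C)}.
Proof.
move=> cf; have cx : {for x, continuous (fun x => x +i* y : C)%C}.
  move=> P /nbhs_cabsP[e e0 ball_sub]; apply/nbhs_ballP; exists e => //= u ue; apply: ball_sub.
  by apply: le_lt_trans (cabs_complex _ _) _; rewrite subrr normr0 addr0 distrC.
exact: (continuous_comp cx cf).
Qed.

Lemma continuous_at_vline f x y : {for (x +i* y)%C, continuous f} ->
  {for y, continuous (fun y => f (x +i* y)%C)}.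
Proof.
move=> cf; have cy : {for y, continuous (fun y => x +i* y : C)%C}.
  move=> P /nbhs_cabsP[e e0 ball_sub]; apply/nbhs_ballP; exists e => //= u ue; apply: ball_sub.
  by apply: le_lt_trans (cabs_complex _ _) _; rewrite subrr normr0 add0r distrC.
exact: (continuous_comp cy cf).
Qed.

Lemma within_sides_continuous f a b c d : a <= b -> c <= d ->
  (forall z, frame a b c d z -> {for z, continuous f}) ->
  {within `[a, b], continuous (fun x => f (x +i* c)%C - f (x +i* d)%C)} /\
  {within `[c, d], continuous (fun y => f (b +i* y)%C - f (a +i* y)%C)}.
Proof.
move=> ab cd cf; have [hside vside] := frame_sides ab cd.
split; apply: continuous_in_subspaceT => x; rewrite inE /= in_itv /= => hx.
  by have [? ?] := hside x hx; apply: continuous_atB; apply/continuous_at_hline/cf.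
by have [? ?] := vside x hx; apply: continuous_atB; apply/continuous_at_vline/cf.
Qed.

Lemma eq_rectint f g a b c d : a <= b -> c <= d ->
  (forall z, frame a b c d z -> f z = g z) -> rectint f a b c d = rectint g a b c d.
Proof.
move=> ab cd fg; have [hside vside] := frame_sides ab cd.
congr (_ + _ * _); apply: eq_cintegral => x hx.
  by have [? ?] := hside x hx; rewrite !fg.
by have [? ?] := vside x hx; rewrite !fg.
Qed.

Lemma rectintD f g a b c d : a <= b -> c <= d ->
  (forall z, frame a b c d z -> {for z, continuous f}) ->
  (forall z, frame a b c d z -> {for z, continuous g}) ->
  rectint (fun z => f z + g z) a b c d = rectint f a b c d + rectint g a b c d.
Proof.
move=> ab cd /(within_sides_continuous ab cd)[hf vf] /(within_sides_continuous ab cd)[hg vg].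
rewrite /rectint [RHS]addrACA -mulrDr.
rewrite -(cintegralD hf hg) -(cintegralD vf vg).
by congr (_ + _ * _); apply: eq_cintegral => x _; rewrite opprD addrACA.
Qed.

Lemma rectintZl (k : C) f a b c d : a <= b -> c <= d ->
  (forall z, frame a b c d z -> {for z, continuous f}) ->
  rectint (fun z => k * f z) a b c d = k * rectint f a b c d.
Proof.
move=> ab cd /(within_sides_continuous ab cd)[hf vf].
rewrite /rectint [RHS]mulrDr [X in _ = _ + X]mulrCA -(cintegralZl _ hf) -(cintegralZl _ vf).
by congr (_ + _ * _); apply: eq_cintegral => x _; rewrite mulrBr.
Qed.

Lemma rectint_affine (k l : C) a b c d : a <= b -> c <= d ->
  rectint (fun z => k + l * z) a b c d = 0.
Proof.
move=> ab cd; rewrite /rectint.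
rewrite (eq_cintegral (v := fun=> l * ('i%C * (c - d)%:C%C))); last first.
  by move=> x _; rewrite (complex_split x c) (complex_split x d) rmorphB; ring.
rewrite [X in _ + _ * X](eq_cintegral (v := fun=> l * (b - a)%:C%C)); last first.
  by move=> y _; rewrite (complex_split a y) (complex_split b y) rmorphB; ring.
by rewrite !cintegral_cst// !rmorphB; ring.
Qed.

Lemma cabs_rectint_le f a b c d (B : R) : a <= b -> c <= d ->
  (forall z, frame a b c d z -> {for z, continuous f}) ->
  (forall z, frame a b c d z -> cabs (f z) <= B) ->
  cabs (rectint f a b c d) <= 4 * B * ((b - a) + (d - c)).
Proof.
move=> ab cd /(within_sides_continuous ab cd)[hf vf] fB.
have [hside vside] := frame_sides ab cd.
have diff_le z w : frame a b c d z -> frame a b c d w -> cabs (f z - f w) <= 2 * B.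
  by move=> /fB fz /fB fw; apply: le_trans (cabsB _ _) _; lra.
have h_le := cabs_cintegral_le (B := 2 * B) ab hf
  (fun x hx => diff_le _ _ (hside x hx).1 (hside x hx).2).
have v_le := cabs_cintegral_le (B := 2 * B) cd vf
  (fun y hy => diff_le _ _ (vside y hy).2 (vside y hy).1).
apply: le_trans (cabsD _ _) _; rewrite cabsM cabs_i mul1r.
by apply: le_trans (lerD h_le v_le) _; rewrite !mulrA -mulrDr -natrM.
Qed.

Lemma rectint_hcat f a b c d x : a <= x -> x <= b -> c <= d ->
  (forall z, rect a b c d z -> {for z, continuous f}) ->
  rectint f a b c d = rectint f a x c d + rectint f x b c d.
Proof.
move=> ax xb cd cf; have ab := le_trans ax xb.
have [hf _] := within_sides_continuous ab cd (fun z Fz => cf z (subset_frame Fz)).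
have cl z : rect a x c d z -> {for z, continuous f}.
  by move=> /(subset_rect (lexx a) xb (lexx c) (lexx d)) /cf.
have cr z : rect x b c d z -> {for z, continuous f}.
  by move=> /(subset_rect ax (lexx b) (lexx c) (lexx d)) /cf.
have [_ vl] := within_sides_continuous ax cd (fun z Fz => cl z (subset_frame Fz)).
have [_ vr] := within_sides_continuous xb cd (fun z Fz => cr z (subset_frame Fz)).
rewrite /rectint (cintegral_cat ax xb hf) [RHS]addrACA -mulrDr -(cintegralD vl vr).
by congr (_ + _ * _); apply: eq_cintegral => y _; rewrite [RHS]addrC addrA subrK.
Qed.

Lemma rectint_vcat f a b c d y : a <= b -> c <= y -> y <= d ->
  (forall z, rect a b c d z -> {for z, continuous f}) ->
  rectint f a b c d = rectint f a b c y + rectint f a b y d.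
Proof.
move=> ab cy yd cf; have cd := le_trans cy yd.
have [_ vf] := within_sides_continuous ab cd (fun z Fz => cf z (subset_frame Fz)).
have cl z : rect a b c y z -> {for z, continuous f}.
  by move=> /(subset_rect (lexx a) (lexx b) (lexx c) yd) /cf.
have cr z : rect a b y d z -> {for z, continuous f}.
  by move=> /(subset_rect (lexx a) (lexx b) cy (lexx d)) /cf.
have [hl _] := within_sides_continuous ab cy (fun z Fz => cl z (subset_frame Fz)).
have [hr _] := within_sides_continuous ab yd (fun z Fz => cr z (subset_frame Fz)).
rewrite /rectint (cintegral_cat cy yd vf) mulrDr [RHS]addrACA -(cintegralD hl hr).
by congr (_ + _); apply: eq_cintegral => x _; rewrite addrA subrK.
Qed.

End RectangleIntegral.

(** * Goursat's theorem *)

Section NestedQuadrants.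
Variable R : realType.
Implicit Types (x y w h : R) (a : nat -> R) (n : nat).

Lemma nested_dyadic_point a w : 0 < w ->
  (forall n, a n.+1 = a n \/ a n.+1 = a n + w / 2 ^+ n.+1) ->
  exists x, forall n, a n <= x <= a n + w / 2 ^+ n.
Proof.
move=> w0 aS; have w2 n : 0 < w / 2 ^+ n by rewrite divr_gt0// exprn_gt0.
have wS n : w / 2 ^+ n = w / 2 ^+ n.+1 + w / 2 ^+ n.+1.
  by rewrite exprS; field; rewrite gt_eqF// exprn_gt0.
have a_nd : {homo a : n k / (n <= k)%N >-> n <= k}.
  apply: homo_leq => [//|? ? ?|n]; first exact: le_trans.
  by have := w2 n.+1; case: (aS n) => ->; lra.
have b_ni : {homo (fun n => a n + w / 2 ^+ n) : n k / (n <= k)%N >-> k <= n}.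
  apply: homo_leq => [//|? ? ? /[swap]|n]; first exact: le_trans.
  by have := w2 n.+1; have := wS n; case: (aS n) => ->; lra.
have a_le_b k n : a k <= a n + w / 2 ^+ n.
  apply: le_trans (a_nd _ _ (leq_maxl k n)) (le_trans _ (b_ni _ _ (leq_maxr k n))).
  by rewrite lerDl ltW.
exists (sup (range a)) => n; apply/andP; split.
  by apply: ub_le_sup; [exists (a 0 + w / 2 ^+ 0) => _ [k _ <-]|exists n].
by apply: ge_sup; [exists (a 0), 0%N|move=> _ [k _ <-]].
Qed.

Lemma nested_quadrants (Q : R -> R -> R -> R -> Prop) x y w h : 0 < w -> 0 < h ->
  (forall x y w h, 0 < w -> 0 < h -> Q x y w h -> exists x' y',
     [/\ x' = x \/ x' = x + w / 2, y' = y \/ y' = y + h / 2 &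
         Q x' y' (w / 2) (h / 2)]) ->
  Q x y w h -> exists px py, forall n, exists x' y',
    [/\ x' <= px <= x' + w / 2 ^+ n, y' <= py <= y' + h / 2 ^+ n &
        Q x' y' (w / 2 ^+ n) (h / 2 ^+ n)].
Proof.
move=> w0 h0 halve Q0.
have half_pow (v : R) n : v / 2 ^+ n / 2 = v / 2 ^+ n.+1.
  by rewrite exprSr invfM mulrA.
pose bad n (p : R * R) := Q p.1 p.2 (w / 2 ^+ n) (h / 2 ^+ n).
have refine_bad n (p : {p | bad n p}) : {p' : {p' | bad n.+1 p'} |
    ((sval p').1 = (sval p).1 \/ (sval p').1 = (sval p).1 + w / 2 ^+ n.+1) /\
    ((sval p').2 = (sval p).2 \/ (sval p').2 = (sval p).2 + h / 2 ^+ n.+1)}.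
  case: p => -[a b] Qab; apply: cid.
  have [||a' [b' [a_half b_half Q']]] := halve _ _ _ _ _ _ Qab; rewrite ?divr_gt0 ?exprn_gt0//.
  rewrite !half_pow in a_half b_half Q'.
  by exists (exist _ (a', b') Q').
have bad0 : bad 0%N (x, y) by rewrite /bad !expr0 !divr1.
pose s := fix s n : {p | bad n p} :=
  if n is k.+1 then sval (refine_bad k (s k)) else exist _ (x, y) bad0.
have [px px_in] := nested_dyadic_point w0 (fun n => (svalP (refine_bad n (s n))).1).
have [py py_in] := nested_dyadic_point h0 (fun n => (svalP (refine_bad n (s n))).2).
exists px, py => n; exists (sval (s n)).1, (sval (s n)).2; split.
- exact: px_in.
- exact: py_in.
- exact: svalP (s n).
Qed.

End NestedQuadrants.

Section Goursat.
Variable R : realType.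
Local Notation C := R[i].
Local Notation Re := (@complex.Re R).
Local Notation Im := (@complex.Im R).
Implicit Types (f q : C -> C) (z p : C) (a b c d e x y w h : R).

Lemma cabs_rectint_slope_le f q p e a b c d : a <= b -> c <= d -> 0 <= e ->
  (forall z, frame a b c d z -> {for z, continuous f}) ->
  (forall z, f z - f p = (z - p) * q z) -> rect a b c d p ->
  (forall z, frame a b c d z -> cabs (q z - q p) <= e) ->
  cabs (rectint f a b c d) <= 4 * e * ((b - a) + (d - c)) ^+ 2.
Proof.
move=> ab cd e0 cf fq pR qe; pose l z := f p - q p * p + q p * z.
have cl z : {for z, continuous l}.
  apply: continuous_atD; first exact: continuous_at_cst.
  by apply: continuous_atM; [exact: continuous_at_cst|exact: continuous_at_id].
have cg z : frame a b c d z -> {for z, continuous (fun z => f z - l z)}.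
  by move=> Fz; apply: continuous_atB; [exact: cf|exact: cl].
have -> : rectint f a b c d = rectint (fun z => f z - l z) a b c d.
  rewrite -[RHS]addr0 -(rectint_affine (f p - q p * p) (q p) ab cd).
  rewrite -(rectintD ab cd cg (fun z _ => cl z)).
  by apply: (eq_rectint ab cd) => z _; rewrite subrK.
rewrite expr2 mulrA -[4 * e * _]mulrA; apply: (cabs_rectint_le ab cd cg) => z Fz.
have -> : f z - l z = (z - p) * (q z - q p) by rewrite mulrBr -fq /l; ring.
rewrite cabsM mulrC; apply: ler_pM; rewrite ?cabs_ge0// ?qe//.
exact: rect_dist (subset_frame Fz) pR.
Qed.

Lemma rectint_quarter f x y w h : 0 < w -> 0 < h ->
  (forall z, rect x (x + w) y (y + h) z -> {for z, continuous f}) ->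
  rectint f x (x + w) y (y + h) =
  rectint f x (x + w / 2) y (y + h / 2) +
  rectint f x (x + w / 2) (y + h / 2) (y + h / 2 + h / 2) +
  (rectint f (x + w / 2) (x + w / 2 + w / 2) y (y + h / 2) +
   rectint f (x + w / 2) (x + w / 2 + w / 2) (y + h / 2) (y + h / 2 + h / 2)).
Proof.
move=> w0 h0; have -> : x + w / 2 + w / 2 = x + w by field.
have -> : y + h / 2 + h / 2 = y + h by field.
move=> cf; have sub a b : x <= a -> b <= x + w -> forall z,
    rect a b y (y + h) z -> {for z, continuous f}.
  by move=> xa bx z /(subset_rect xa bx (lexx y) (lexx (y + h))) /cf.
rewrite (@rectint_hcat _ f x (x + w) y (y + h) (x + w / 2)) //; [|lra..].
rewrite (@rectint_vcat _ f x (x + w / 2) y (y + h) (y + h / 2)); [|lra..|]; last first.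
  by apply: sub; lra.
rewrite (@rectint_vcat _ f (x + w / 2) (x + w) y (y + h) (y + h / 2)); [|lra..|]; last first.
  by apply: sub; lra.
by [].
Qed.

Lemma rectint_large_quarter f e x y w h : 0 < w -> 0 < h ->
  (forall z, rect x (x + w) y (y + h) z -> {for z, continuous f}) ->
  e * (w + h) ^+ 2 <= cabs (rectint f x (x + w) y (y + h)) ->
  exists x' y', [/\ x' = x \/ x' = x + w / 2, y' = y \/ y' = y + h / 2 &
    e * (w / 2 + h / 2) ^+ 2 <= cabs (rectint f x' (x' + w / 2) y' (y' + h / 2))].
Proof.
move=> w0 h0 cf; apply: contraPP => none.
have small x' y' : x' = x \/ x' = x + w / 2 -> y' = y \/ y' = y + h / 2 ->
    cabs (rectint f x' (x' + w / 2) y' (y' + h / 2)) < e * (w / 2 + h / 2) ^+ 2.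
  by move=> x_half y_half; rewrite ltNge; apply/negP => big; apply: none; exists x', y'.
rewrite rectint_quarter//; apply/negP; rewrite -ltNge.
apply: le_lt_trans (cabsD _ _) _; apply: le_lt_trans (lerD (cabsD _ _) (cabsD _ _)) _.
have -> : e * (w + h) ^+ 2 = 4 * (e * (w / 2 + h / 2) ^+ 2) by field.
have := small x y (or_introl erefl) (or_introl erefl).
have := small x _ (or_introl erefl) (or_intror erefl).
have := small _ y (or_intror erefl) (or_introl erefl).
have := small _ _ (or_intror erefl) (or_intror erefl).
lra.
Qed.

Lemma exists_div_pow2_lt (w r : R) : 0 < w -> 0 < r -> exists n, w / 2 ^+ n < r.
Proof.
move=> w0 r0; have [n _ small] := near_infty_natSinv_expn_lt (PosNum (divr_gt0 r0 w0)).
by exists n; have /= := small n (leqnn n); rewrite div1r ltr_pdivlMr// mulrC.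
Qed.

Lemma goursat f a b c d : a < b -> c < d ->
  (forall z, rect a b c d z -> cderivable f z) -> rectint f a b c d = 0.
Proof.
move=> ab cd df; have cf z : rect a b c d z -> {for z, continuous f}.
  by move=> /df /cderivable_continuous.
have [w0 h0] : 0 < b - a /\ 0 < d - c by rewrite !subr_gt0.
apply/eqP; rewrite -cabs_eq0; apply: contraT => I_neq0.
pose e := cabs (rectint f a b c d) / (b - a + (d - c)) ^+ 2.
have s0 : 0 < (b - a + (d - c)) ^+ 2 by rewrite exprn_gt0// addr_gt0.
have e0 : 0 < e by rewrite divr_gt0// lt_def I_neq0 cabs_ge0.
pose large x y w h := rect x (x + w) y (y + h) `<=` rect a b c d /\
  e * (w + h) ^+ 2 <= cabs (rectint f x (x + w) y (y + h)).
have large0 : large a c (b - a) (d - c).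
  by rewrite /large (addrC a) (addrC c) !subrK; split=> //; rewrite /e divfK// gt_eqF.
have halve x y w h : 0 < w -> 0 < h -> large x y w h -> exists x' y',
     [/\ x' = x \/ x' = x + w / 2, y' = y \/ y' = y + h / 2 &
         large x' y' (w / 2) (h / 2)].
  move=> w1 h1 [sub large_I].
  have [x' [y' [x_half y_half large_quarter]]] :=
    rectint_large_quarter w1 h1 (fun z Rz => cf z (sub z Rz)) large_I.
  exists x', y'; split=> //; split=> // z Rz; apply: sub.
  by apply: subset_rect Rz; case: x_half => ?; case: y_half => ?; lra.
have [px [py p_in]] := nested_quadrants w0 h0 halve large0.
pose p : C := (px +i* py)%C.
have pR : rect a b c d p.
  by have [x [y [px_in py_in [sub _]]]] := p_in 0%N; apply: sub; split.
have /cderivable_slopeP[q /continuous_cabsP cq fq] := df p pR.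
have /nbhs_cabsP[r r0 qr] := cq (e / 8) ltac:(by rewrite divr_gt0).
have [n diam_lt] : exists n, (b - a + (d - c)) / 2 ^+ n < r.
  by apply: exists_div_pow2_lt => //; exact: addr_gt0.
have [x [y [px_in py_in [sub large_I]]]] := p_in n.
have wn0 : 0 < (b - a) / 2 ^+ n by rewrite divr_gt0// exprn_gt0.
have hn0 : 0 < (d - c) / 2 ^+ n by rewrite divr_gt0// exprn_gt0.
move: large_I; rewrite leNgt => /negP[].
have e80 : 0 <= e / 8 by rewrite divr_ge0 ?ltW.
have pRn : rect x (x + (b - a) / 2 ^+ n) y (y + (d - c) / 2 ^+ n) p by split.
apply: le_lt_trans (cabs_rectint_slope_le _ _ e80 _ fq pRn _) _.
- by rewrite lerDl ltW.
- by rewrite lerDl ltW.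
- by move=> z /subset_frame /sub /cf.
- move=> z Fz; apply/ltW/qr; apply: le_lt_trans diam_lt.
  by apply: le_trans (rect_dist (subset_frame Fz) pRn) _; rewrite mulrDl; lra.
- rewrite ![_ + _ - _]addrAC !subrr !add0r ltr_pM2r ?exprn_gt0 ?addr_gt0//.
  by lra.
Qed.

Lemma rectint_punctured_shrink f a b c d p r : 0 < r ->
  a < Re p - r -> Re p + r < b -> c < Im p - r -> Im p + r < d ->
  (forall z, rect a b c d z -> {for z, continuous f}) ->
  (forall z, rect a b c d z -> z != p -> cderivable f z) ->
  rectint f a b c d = rectint f (Re p - r) (Re p + r) (Im p - r) (Im p + r).
Proof.
move=> r0 ar br cr dr cf df.
have rect0 a' b' c' d' : a <= a' -> a' < b' -> b' <= b -> c <= c' -> c' < d' -> d' <= d ->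
    ~ rect a' b' c' d' p -> rectint f a' b' c' d' = 0.
  move=> aa' ab' bb' cc' cd' dd' np; apply: goursat => // z Rz.
  by apply: df; [exact: subset_rect Rz|apply: contra_notN np => /eqP <-].
have cont a' b' c' d' : a <= a' -> b' <= b -> c <= c' -> d' <= d ->
    forall z, rect a' b' c' d' z -> {for z, continuous f}.
  by move=> ? ? ? ? z Rz; apply: cf; exact: subset_rect Rz.
rewrite (@rectint_hcat _ f a b c d (Re p - r)); [|lra..|exact: cont].
rewrite (@rectint_hcat _ f (Re p - r) b c d (Re p + r)); [|lra..|by apply: cont; lra].
rewrite rect0; [|lra..|by move=> [/andP[_ ?] _]; lra].
rewrite [X in _ + (_ + X)]rect0; [|lra..|by move=> [/andP[? _] _]; lra].
rewrite (@rectint_vcat _ f _ _ c d (Im p - r)); [|lra..|by apply: cont; lra].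
rewrite (@rectint_vcat _ f _ _ (Im p - r) d (Im p + r)); [|lra..|by apply: cont; lra].
rewrite rect0; [|lra..|by move=> [_ /andP[_ ?]]; lra].
rewrite [X in _ + (_ + (_ + X) + _)]rect0; [|lra..|by move=> [_ /andP[? _]]; lra].
by rewrite !add0r !addr0.
Qed.

Lemma goursat_punctured f a b c d p : a < Re p < b -> c < Im p < d ->
  (forall z, rect a b c d z -> {for z, continuous f}) ->
  (forall z, rect a b c d z -> z != p -> cderivable f z) -> rectint f a b c d = 0.
Proof.
move=> /andP[ap pb] /andP[cp pd] cf df.
have pR : rect a b c d p by split; apply/andP; split; exact: ltW.
have /continuous_cabsP/(_ 1 ltr01)/nbhs_cabsP[d1 d10 fd1] := cf p pR.
pose B := cabs (f p) + 1; have B0 : 0 < B by rewrite ltr_pwDr// cabs_ge0.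
apply/eqP; rewrite -cabs_eq0 eq_le cabs_ge0 andbT; apply/ler_addgt0Pr => e e0.
have [r r0 [ra rb rc [rd rd1 re]]] : exists2 r, 0 < r & [/\ a < Re p - r, Re p + r < b,
    c < Im p - r & [/\ Im p + r < d, r < d1 / 4 & r < e / (16 * B)]].
  pose m := Num.min (Num.min (Re p - a) (b - Re p)) (Num.min (Num.min (Im p - c) (d - Im p))
              (Num.min (d1 / 4) (e / (16 * B)))).
  have m0 : 0 < m by rewrite !lt_min !subr_gt0 ap pb cp pd !divr_gt0// mulr_gt0.
  exists (m / 2); first by rewrite divr_gt0.
  have : m / 2 < m by lra.
  rewrite {2}/m !lt_min => /andP[/andP[? ?] /andP[/andP[? ?] /andP[? ?]]].
  by split; [lra|lra|lra|split=> //; lra].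
rewrite (rectint_punctured_shrink r0 ra rb rc rd cf df).
have sub : rect (Re p - r) (Re p + r) (Im p - r) (Im p + r) `<=` rect a b c d.
  by apply: subset_rect; exact: ltW.
have pRr : rect (Re p - r) (Re p + r) (Im p - r) (Im p + r) p.
  by split; apply/andP; split; lra.
apply: le_trans (cabs_rectint_le (B := B) _ _ _ _) _; [lra|lra| | |].
- by move=> z /subset_frame /sub /cf.
- move=> z /subset_frame Rz; rewrite -[f z](subrK (f p)) addrC.
  apply: le_trans (cabsD _ _) _; rewrite lerD2l; apply/ltW/fd1.
  by apply: le_lt_trans (rect_dist Rz pRr) _; lra.
- have := ltW re; rewrite ler_pdivlMr ?mulr_gt0//.
  by nra.
Qed.

End Goursat.

(** * Cauchy transforms and orders of vanishing *)

Section CauchyTransform.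
Variable R : realType.
Local Notation C := R[i].
Local Notation mu := (@lebesgue_measure R).
Implicit Types (f g phi : C -> C) (x y : R) (z w : C).

Lemma frame_bounded f a b c d : a <= b -> c <= d ->
  (forall z, frame a b c d z -> {for z, continuous f}) ->
  exists2 B : R, 0 <= B & forall z, frame a b c d z -> cabs (f z) <= B.
Proof.
move=> ab cd cf; have [hside vside] := frame_sides ab cd.
have side_bounded (u : R -> C) a' b' : a' <= b' ->
    (forall x, a' <= x <= b' -> {for x, continuous u}) ->
    exists2 B : R, 0 <= B & forall x, a' <= x <= b' -> cabs (u x) <= B.
  move=> ab' cu; have cabs_u : {within `[a', b'], continuous (@cabs R \o u)}.
    apply: continuous_in_subspaceT => x; rewrite inE /= in_itv /= => /cu ux.
    by apply: (continuous_comp ux); exact: cabs_continuous.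
  have [x0 _ u_max] := EVT_max ab' cabs_u.
  by exists (cabs (u x0)); [exact: cabs_ge0|move=> x hx; apply: u_max; rewrite in_itv].
have [B1 B10 bot_le] :=
  side_bounded _ _ _ ab (fun x hx => continuous_at_hline (cf _ (hside x hx).1)).
have [B2 B20 top_le] :=
  side_bounded _ _ _ ab (fun x hx => continuous_at_hline (cf _ (hside x hx).2)).
have [B3 B30 left_le] :=
  side_bounded _ _ _ cd (fun y hy => continuous_at_vline (cf _ (vside y hy).1)).
have [B4 B40 right_le] :=
  side_bounded _ _ _ cd (fun y hy => continuous_at_vline (cf _ (vside y hy).2)).
exists (B1 + B2 + B3 + B4); first by rewrite !addr_ge0.
case=> x y [[/= xab ycd]] [] xy; rewrite xy.
- by have := left_le _ ycd; lra.
- by have := right_le _ ycd; lra.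
- by have := bot_le _ xab; lra.
- by have := top_le _ xab; lra.
Qed.

Local Notation h := (2^-1 : R).

Definition square : set C := frame (- h) h (- h) h.

Let h_itv : - h <= h. Proof. by rewrite ge0_cp// invr_ge0. Qed.

Let hE : h = 1 / 2. Proof. by rewrite div1r. Qed.

Lemma rect_cdisk : rect (- h) h (- h) h `<=` @cdisk R.
Proof.
case=> x y [/= hx hy]; suff : cabs (x +i* y)%C ^+ 2 < 1 ^+ 2.
  by rewrite ltr_pXn2r// nnegrE ?cabs_ge0.
rewrite sqr_cabs expr1n /=; have h2 : h ^+ 2 = 1 / 4 by field.
have [? ?] : x ^+ 2 <= h ^+ 2 /\ y ^+ 2 <= h ^+ 2 by split; nra.
lra.
Qed.

Lemma square_cabs_ge w : square w -> h <= cabs w.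
Proof.
move=> [_ side]; have := cabs_Re w; have := cabs_Im w.
by rewrite !ler_norml; case: side => ->; lra.
Qed.

Lemma square_dist_ge w z : square w -> cabs z < 1 / 4 -> 1 / 4 <= cabs (w - z).
Proof.
by move=> /square_cabs_ge hw hz; have := cabsD (w - z) z; rewrite subrK; lra.
Qed.

Lemma square_sub_neq0 w z : square w -> cabs z < 1 / 4 -> w - z != 0.
Proof.
by move=> hw hz; rewrite -cabs_gt0; apply: lt_le_trans (square_dist_ge hw hz); lra.
Qed.

Lemma square_neq0 w : square w -> w != 0.
Proof. by move=> /square_cabs_ge; rewrite -cabs_gt0; apply: lt_le_trans; lra. Qed.

Definition cauchy_transform phi z : C :=
  rectint (fun w => phi w / (w - z)) (- h) h (- h) h.

Definition continuous_on_square phi := forall w, square w -> {for w, continuous phi}.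

Lemma continuous_cauchy_kernel phi z : continuous_on_square phi -> cabs z < 1 / 4 ->
  continuous_on_square (fun w => phi w / (w - z)).
Proof.
move=> cphi hz w hw; apply: continuous_atM; first exact: cphi.
apply: continuous_atV; first exact: square_sub_neq0.
by apply: continuous_atB; [exact: continuous_at_id|exact: continuous_at_cst].
Qed.

Lemma continuous_square_div_id phi : continuous_on_square phi ->
  continuous_on_square (fun w => phi w / w).
Proof.
move=> cphi w hw; apply: continuous_atM; first exact: cphi.
by apply: continuous_atV; [exact: square_neq0|exact: continuous_at_id].
Qed.

Lemma continuous_square_cst (c : C) : continuous_on_square (fun=> c).
Proof. by move=> w _; exact: continuous_at_cst. Qed.

Let cabs0_lt : cabs (0 : C) < 1 / 4. Proof. by rewrite cabs0; lra. Qed.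

Lemma cauchy_transform_rec phi z : continuous_on_square phi -> cabs z < 1 / 4 ->
  cauchy_transform phi z =
  cauchy_transform phi 0 + z * cauchy_transform (fun w => phi w / w) z.
Proof.
move=> cphi hz; have cphi1 := continuous_cauchy_kernel (continuous_square_div_id cphi) hz.
rewrite /cauchy_transform -(rectintZl _ h_itv h_itv cphi1).
rewrite -(rectintD h_itv h_itv (continuous_cauchy_kernel cphi cabs0_lt)); last first.
  by move=> w hw; apply: continuous_atM; [exact: continuous_at_cst|exact: cphi1].
apply: (eq_rectint h_itv h_itv) => w hw; rewrite subr0.
by field; rewrite (square_neq0 hw) (square_sub_neq0 hw hz).
Qed.

Lemma cauchy_transform_le phi z (B : R) : continuous_on_square phi -> cabs z < 1 / 4 ->
  (forall w, square w -> cabs (phi w) <= B) -> cabs (cauchy_transform phi z) <= 32 * B.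
Proof.
move=> cphi hz phiB.
apply: le_trans (cabs_rectint_le (B := 4 * B) h_itv h_itv (continuous_cauchy_kernel cphi hz) _) _.
  move=> w hw; have dist_w := square_dist_ge hw hz.
  rewrite cabsM cabsV ler_pdivrMr; last by lra.
  by have := phiB w hw; have := cabs_ge0 (phi w); nra.
by rewrite hE; lra.
Qed.

Lemma cauchy_transform_continuous0 phi : continuous_on_square phi ->
  {for 0, continuous (cauchy_transform phi)}.
Proof.
move=> cphi; have cphi1 := continuous_square_div_id cphi.
have [B B0 phiB] := frame_bounded h_itv h_itv cphi1.
apply/continuous_cabsP => e e0; apply/nbhs_cabsP.
exists (Num.min (1 / 4) (e / (32 * B + 1))); first by rewrite lt_min !divr_gt0//; lra.
move=> z; rewrite subr0 lt_min => /andP[z4 ze].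
rewrite (cauchy_transform_rec cphi z4) addrAC subrr add0r cabsM.
have := cauchy_transform_le cphi1 z4 phiB; move: ze; rewrite ltr_pdivlMr; last lra.
by move=> ze le32; apply: le_lt_trans ze; apply: ler_wpM2l; [exact: cabs_ge0|lra].
Qed.

Lemma cauchy_transform_cderivable0 phi : continuous_on_square phi ->
  cderivable (cauchy_transform phi) 0.
Proof.
move=> cphi; pose psi := cauchy_transform (fun w => phi w / w).
have dK : cderivable (fun z => cauchy_transform phi 0 + z * psi z) 0.
  apply/cderivable_slopeP; exists psi => [|z]; last by ring.
  exact: cauchy_transform_continuous0 (continuous_square_div_id cphi).
apply: near_eq_cderivable dK; apply/nbhs_cabsP; exists (1 / 4); first by lra.
by move=> z; rewrite subr0 => z4; rewrite [RHS](cauchy_transform_rec cphi z4).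
Qed.

Lemma cauchy_transform1_neq0 : cauchy_transform (fun=> 1) 0 != 0.
Proof.
pose k x : R := (x ^+ 2 + h ^+ 2)^-1; pose J := \int[mu]_(x in `[- h, h]) k x.
have k_pos x : 0 < x ^+ 2 + h ^+ 2 by rewrite ltr_wpDl ?sqr_ge0// exprn_gt0// invr_gt0.
have J_ge2 : 2 <= J.
  have -> : 2 = 2 * (h - - h) by rewrite hE; field.
  rewrite -Rintegral_itv_cst//; apply: le_Rintegral => //.
  - apply: continuous_compact_integrable; first exact: segment_compact.
    by move=> ?; exact: cvg_cst.
  - apply: continuous_compact_integrable; first exact: segment_compact.
    apply: continuous_subspaceT => x; apply: cvgV; first by rewrite gt_eqF.
    by apply: cvgD; [exact: exprn_continuous|exact: cvg_cst].
  - move=> x; rewrite /= in_itv /= => hx.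
    rewrite -[leLHS]invrK lef_pV2 ?posrE ?invr_gt0// hE.
    by move: hx; rewrite hE => hx; nra.
have h_itg x : 1 / ((x +i* - h)%C - 0) - 1 / ((x +i* h)%C - 0) = 'i%C * (k x)%:C%C :> C.
  rewrite !subr0 !div1r; apply/eqP; rewrite eq_complex /= sqrrN -/(k x).
  by apply/andP; split; apply/eqP; lra.
have v_itg y : 1 / ((h +i* y)%C - 0) - 1 / ((- h +i* y)%C - 0) = (k y)%:C%C :> C.
  rewrite !subr0 !div1r; apply/eqP; rewrite eq_complex /= sqrrN [_ + y ^+ 2]addrC -/(k y).
  by apply/andP; split; apply/eqP; lra.
have [_ vcont] := within_sides_continuous h_itv h_itv
  (continuous_cauchy_kernel (@continuous_square_cst 1) cabs0_lt).
have -> : cauchy_transform (fun=> 1) 0 = 'i%C * (J + J)%:C%C.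
  have -> : (J + J)%:C%C = J%:C%C + J%:C%C :> C by exact: rmorphD.
  rewrite mulrDr /J -(cintegral_real k h_itv); congr (_ + _ * _).
    rewrite -(eq_cintegral (fun y _ => v_itg y)) -(cintegralZl _ vcont).
    by apply: eq_cintegral => x _; rewrite h_itg v_itg.
  by apply: eq_cintegral => y _; exact: v_itg.
by rewrite mulf_neq0 -?cabs_gt0 ?cabs_i ?cabs_real ?normr_gt0 ?gt_eqF//; lra.
Qed.

End CauchyTransform.

Section Holomorphic.
Variable R : realType.
Local Notation C := R[i].
Local Notation disk := (@cdisk R).
Implicit Types (f g : C -> C) (z : C).

Lemma disk0 : disk 0. Proof. by suff : cabs (0 : C) < 1 by []; rewrite cabs0. Qed.

Lemma holo_continuous U f z : holo_on U f -> U z -> {for z, continuous f}.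
Proof. by move=> /holo_onP hf /hf /cderivable_continuous. Qed.

Lemma holo_on_square f : holo_on disk f -> continuous_on_square f.
Proof. by move=> hf w /subset_frame /rect_cdisk; exact: holo_continuous. Qed.

(* The disk of radius [1 / 4] keeps [z] away from the square of side [1]. *)
Lemma cauchy_formula f z : holo_on disk f -> cabs z < 1 / 4 ->
  f z * cauchy_transform (fun=> 1) z = cauchy_transform f z.
Proof.
move=> hf hz; have hD := (holo_onP _ _).1 hf.
have z1 : disk z by apply: lt_trans hz _; lra.
have [q cq fq] := (cderivable_slopeP _ _).1 (hD z z1).
have qE w : w != z -> q w = (f w - f z) / (w - z).
  by move=> wz; rewrite fq mulrC mulKf// subr_eq0.
have dq w : disk w -> w != z -> cderivable q w.
  move=> w1 wz; have dslope : cderivable (fun w => (f w - f z) / (w - z)) w.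
    apply: cderivableM; first by apply: cderivableB; [exact: hD|exact: cderivable_cst].
    apply: cderivableV; first by rewrite subr_eq0.
    by apply: cderivableB; [exact: cderivable_id|exact: cderivable_cst].
  apply: near_eq_cderivable dslope; apply/nbhs_cabsP.
  exists (cabs (w - z)) => [|u uw]; first by rewrite cabs_gt0 subr_eq0.
  by rewrite qE//; apply: contraTneq uw => ->; rewrite cabs_distC ltxx.
have [h_itv hE] : - 2^-1 <= 2^-1 :> R /\ 2^-1 = 1 / 2 :> R by split; lra.
have q0 : rectint q (- 2^-1) 2^-1 (- 2^-1) 2^-1 = 0.
  have := cabs_Re z; have := cabs_Im z; rewrite !ler_norml => ? ?.
  apply: (@goursat_punctured _ q _ _ _ _ z); [lra|lra| |].
    move=> w /rect_cdisk w1; have [->//|wz] := eqVneq w z.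
    exact/cderivable_continuous/dq.
  by move=> w /rect_cdisk; exact: dq.
have cf := continuous_cauchy_kernel (holo_on_square hf) hz.
have c1 := continuous_cauchy_kernel (@continuous_square_cst _ 1) hz.
have cfz1 : continuous_on_square (fun w => - f z * (1 / (w - z))).
  by move=> w hw; apply: continuous_atM; [exact: continuous_at_cst|exact: c1].
apply/eqP; rewrite -subr_eq0 -opprB oppr_eq0 -mulNr /cauchy_transform.
rewrite -(rectintZl _ h_itv h_itv c1) -(rectintD h_itv h_itv cf cfz1) -q0.
apply/eqP/(eq_rectint h_itv h_itv) => w hw; rewrite qE.
  by rewrite mulNr mulrA mulr1 mulrBl.
by rewrite -subr_eq0; exact: square_sub_neq0.
Qed.

Lemma holo_div_id f : holo_on disk f -> f 0 = 0 ->
  exists2 g, holo_on disk g & forall z, f z = z * g z.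
Proof.
move=> hf f0; have hD := (holo_onP _ _).1 hf.
have [q cq fq] := (cderivable_slopeP _ _).1 (hD 0 disk0).
have fE z : f z = z * q z by have := fq z; rewrite f0 !subr0.
exists q => //; apply/holo_onP => z z1.
have [->|z0] := eqVneq z 0; last first.
  have dfz : cderivable (fun w => f w / w) z.
    apply: cderivableM; first exact: hD.
    by apply: cderivableV; [exact: z0|exact: cderivable_id].
  apply: near_eq_cderivable dfz.
  apply: filterS (near_neq0 (@continuous_at_id _ z) z0) => w w0.
  by rewrite fE mulrC mulKf.
pose K := cauchy_transform (fun w => f w / w); pose c := cauchy_transform (fun=> 1 : C).
have cfs := holo_on_square hf.
have dK : cderivable K 0 := cauchy_transform_cderivable0 (continuous_square_div_id cfs).
have dc : cderivable c 0 := cauchy_transform_cderivable0 (@continuous_square_cst _ 1).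
have qc w : w != 0 -> cabs w < 1 / 4 -> q w * c w = K w.
  move=> w0 w4; apply: (mulfI w0); rewrite mulrA -fE cauchy_formula//.
  rewrite (cauchy_transform_rec cfs w4) -[cauchy_transform f 0]cauchy_formula//.
    by rewrite f0 mul0r add0r.
  by rewrite cabs0; lra.
have qc0 : q 0 * c 0 = K 0.
  apply: (@continuous_eq_dnbhs _ (fun w => q w * c w) K).
  - by apply: continuous_atM; [exact: cq|exact: cderivable_continuous].
  - exact: cderivable_continuous.
  - by apply/dnbhs_cabsP; exists (1 / 4) => [|w w0]; [lra|rewrite subr0; exact: qc].
have c0 : c 0 != 0 := cauchy_transform1_neq0 R.
have dKc : cderivable (fun w => K w / c w) 0 by apply: cderivableM; [exact: dK|exact: cderivableV].
apply: near_eq_cderivable dKc; near=> w.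
have <- : q w * c w = K w.
  have [->//|w0] := eqVneq w 0; apply: qc => //.
  by rewrite -[w]subr0; near: w; apply: near_cabs_lt; lra.
by rewrite mulfK//; near: w; apply: near_neq0 c0; exact: cderivable_continuous.
Unshelve. all: by end_near. Qed.

Definition divides_pow f n := exists2 g, holo_on disk g & forall z, f z = z ^+ n * g z.

(* Cauchy's formula for [f / z ^+ n] bounds [f z] by a multiple of [(2 * |z|) ^+ n]. *)
Lemma holo_flat_eq0 : exists2 r : R, 0 < r & forall f, holo_on disk f ->
  (forall n, divides_pow f n) -> forall z, cabs z < r -> f z = 0.
Proof.
pose c := cauchy_transform (fun=> 1 : C).
have cc : {for 0, continuous c} := cauchy_transform_continuous0 (@continuous_square_cst _ 1).
have /nbhs_cabsP[d d0 cd] := near_neq0 cc (cauchy_transform1_neq0 R).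
exists (Num.min d (1 / 4)) => [|f hf flat z]; first by rewrite lt_min d0; lra.
rewrite lt_min => /andP[zd z4]; have cz : c z != 0 by apply: cd; rewrite subr0.
have h_itv : - 2^-1 <= 2^-1 :> R by lra.
have [B B0 fB] := frame_bounded h_itv h_itv (holo_on_square hf).
have fz_le n : cabs (f z * c z) <= 32 * B * (2 * cabs z) ^+ n.
  have [g hg fE] := flat n.
  have gB w : square w -> cabs (g w) <= B * 2 ^+ n.
    move=> hw; have w2 : 2^-1 <= cabs w := square_cabs_ge hw.
    have := fB w hw; rewrite fE cabsM cabsX => gw.
    apply: le_trans (ler_wpM2r (exprn_ge0 _ (ler0n _ 2)) gw).
    rewrite mulrAC -exprMn ler_peMl ?cabs_ge0// exprn_ege1//.
    by rewrite -ler_pdivrMr// div1r.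
  rewrite fE -mulrA cauchy_formula// cabsM cabsX exprMn.
  have := cauchy_transform_le (holo_on_square hg) z4 gB.
  by have := exprn_ge0 n (cabs_ge0 z); nra.
have : cabs (f z * c z) <= 0.
  have z2 : `|2 * cabs z| < 1 by rewrite ger0_norm ?mulr_ge0 ?cabs_ge0//; lra.
  apply: (ler_cvg_to (cvg_cst _) (cvg_geometric (32 * B) z2)).
  by apply: nearW => n; exact: fz_le.
by rewrite le_eqVlt ltNge cabs_ge0 orbF cabs_eq0 mulf_eq0 (negPf cz) orbF => /eqP.
Qed.

Lemma holo_order : exists2 r : R, 0 < r & forall f, holo_on disk f ->
  (forall z, cabs z < r -> f z = 0) \/
  exists n g, [/\ holo_on disk g, g 0 != 0 & forall z, f z = z ^+ n * g z].
Proof.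
have [r r0 flat0] := holo_flat_eq0; exists r => // f hf.
have [/(flat0 f hf)|/existsNP[n ndiv]] := pselect (forall n, divides_pow f n); first by left.
right; elim: n ndiv => [|n IH] ndiv.
  by exfalso; apply: ndiv; exists f => // z; rewrite expr0 mul1r.
have [[g hg fg]|/IH//] := pselect (divides_pow f n).
exists n, g; split=> //; apply: contra_notN ndiv => /eqP g0.
by have [u hu gu] := holo_div_id hg g0; exists u => // z; rewrite fg gu exprSr mulrA.
Qed.

End Holomorphic.

(** * Real sums over discrete types *)

Section RealSums.
Variables (R : realType) (T : choiceType).
Implicit Types (f g : T -> R) (s : seq T) (c : R).

Lemma ge0_esumZl (D : set T) c (u : T -> \bar R) : 0 <= c -> (forall x, (0 <= u x)%E) ->
  (\esum_(x in D) (c%:E * u x) = c%:E * \esum_(x in D) u x)%E.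
Proof.
move=> c0 u0; rewrite /esum -ereal_supZl//.
  rewrite image_comp; congr ereal_sup; apply: eq_imagel => A _ /=.
  by rewrite ge0_mule_fsumr.
apply/set0P; exists (\sum_(x \in set0) u x)%E, set0 => //.
by split; [exact: finite_set0|exact: sub0set].
Qed.

Definition rsummable f := summable [set: T] (EFin \o f).

Definition rsum f : R :=
  fine (\esum_(x in [set: T]) (EFin \o f)^\+ x - \esum_(x in [set: T]) (EFin \o f)^\- x)%E.

Let ge0_rsumE f : (forall x, 0 <= f x) ->
  rsum f = fine (\esum_(x in [set: T]) (f x)%:E)%E.
Proof.
move=> f0; have f0E x : [set: T] x -> (0 <= (EFin \o f) x)%E by rewrite lee_fin.
rewrite /rsum [X in (_ - X)%E]esum1 ?sube0.
  by congr fine; apply: eq_esum => x _; rewrite (ge0_funeposE f0E) ?inE.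
by move=> x _; rewrite (ge0_funenegE f0E) ?inE.
Qed.

Lemma rsummable_ge0 f : (forall x, 0 <= f x) ->
  rsummable f <-> (\esum_(x in [set: T]) (f x)%:E < +oo)%E.
Proof.
by move=> f0; rewrite /rsummable /summable; under eq_esum do rewrite /= ger0_norm//.
Qed.

Lemma rsummable_le f g : (forall x, `|f x| <= g x) -> rsummable g -> rsummable f.
Proof.
move=> fg; apply: le_lt_trans; apply: le_esum => x _; rewrite lee_fin.
by apply: le_trans (fg x) _; exact: ler_norm.
Qed.

Lemma rsummableD f g : rsummable f -> rsummable g -> rsummable (fun x => f x + g x).
Proof. exact: summableD. Qed.

Lemma rsummableN f : rsummable f -> rsummable (fun x => - f x).
Proof. by move=> sf; rewrite /rsummable (summableN _ (EFin \o f)) in sf *. Qed.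

Lemma rsummable_norm f : rsummable f -> rsummable (fun x => `|f x|).
Proof. by rewrite /rsummable /summable; under eq_esum do rewrite /= -normr_id. Qed.

Lemma esum_EFin f : (forall x, 0 <= f x) -> rsummable f ->
  (\esum_(x in [set: T]) (f x)%:E)%E = (rsum f)%:E.
Proof.
move=> f0 sf; rewrite ge0_rsumE// fineK// ge0_fin_numE.
  exact/(rsummable_ge0 f0).
by apply: esum_ge0 => x _; rewrite lee_fin.
Qed.

Lemma rsum_ge0 f : (forall x, 0 <= f x) -> 0 <= rsum f.
Proof.
by move=> f0; rewrite ge0_rsumE//; apply/fine_ge0/esum_ge0 => x _; rewrite lee_fin.
Qed.

Let ge0_rsumD a b : (forall x, 0 <= a x) -> (forall x, 0 <= b x) ->
  rsummable a -> rsummable b -> rsum (fun x => a x + b x) = rsum a + rsum b.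
Proof.
move=> a0 b0 sa sb; apply: EFin_inj.
rewrite EFinD -!esum_EFin//; last 2 first.
- by move=> x; exact: addr_ge0.
- exact: rsummableD.
by under eq_esum do rewrite EFinD; rewrite esumD// => x _; rewrite lee_fin.
Qed.

Let ge0_rsumB a b : (forall x, 0 <= a x) -> (forall x, 0 <= b x) ->
  rsummable a -> rsummable b -> rsum (fun x => a x - b x) = rsum a - rsum b.
Proof.
move=> a0 b0 sa sb; rewrite {1}/rsum.
rewrite -[EFin \o _]/((EFin \o a) \- (EFin \o b))%E esumB//.
  by rewrite /= !esum_EFin.
by move=> x _; rewrite lee_fin.
by move=> x _; rewrite lee_fin.
Qed.

Let rsummable_funrpos f : rsummable f -> rsummable f^\+.
Proof.
move=> /rsummable_norm; apply: rsummable_le => x.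
by rewrite ger0_norm// /funrpos ge_max ler_norm normr_ge0.
Qed.

Let rsummable_funrneg f : rsummable f -> rsummable f^\-.
Proof. by move=> /rsummableN/rsummable_funrpos. Qed.

Let rsum_funrpos f : rsummable f -> rsum f = rsum f^\+ - rsum f^\-.
Proof.
move=> sf; rewrite -ge0_rsumB//; [|exact: rsummable_funrpos|exact: rsummable_funrneg].
by congr rsum; rewrite -[LHS]funrposBneg.
Qed.

Lemma rsumD f g : rsummable f -> rsummable g ->
  rsum (fun x => f x + g x) = rsum f + rsum g.
Proof.
move=> sf sg; have [pf pg] := (rsummable_funrpos sf, rsummable_funrpos sg).
have [nf ng] := (rsummable_funrneg sf, rsummable_funrneg sg).
rewrite (rsum_funrpos sf) (rsum_funrpos sg) addrACA -opprD -!ge0_rsumD//.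
rewrite -ge0_rsumB; [|by move=> x; exact: addr_ge0|by move=> x; exact: addr_ge0
                     |exact: rsummableD|exact: rsummableD].
congr rsum; apply/funext => x; rewrite opprD addrACA.
by rewrite -[f in LHS]funrposBneg -[g in LHS]funrposBneg.
Qed.

Lemma rsummableZl c f : rsummable f -> rsummable (fun x => c * f x).
Proof.
rewrite /rsummable /summable => sf.
under eq_esum do rewrite /= normrM EFinM.
by rewrite ge0_esumZl// lte_mul_pinfty.
Qed.

Lemma rsumZl c f : rsummable f -> rsum (fun x => c * f x) = c * rsum f.
Proof.
have ge0Zl c' a : 0 <= c' -> (forall x, 0 <= a x) -> rsummable a ->
    rsum (fun x => c' * a x) = c' * rsum a.
  move=> c0 a0 sa; apply: EFin_inj; rewrite EFinM -!esum_EFin//; last 2 first.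
  - by move=> x; exact: mulr_ge0.
  - exact: rsummableZl.
  by rewrite -ge0_esumZl// => x; rewrite lee_fin.
move=> sf; have [pf nf] := (rsummable_funrpos sf, rsummable_funrneg sf).
have fE x : f x = f^\+ x - f^\- x by rewrite -[LHS](congr1 (@^~ x) (funrposBneg f)).
have [c0|/ltW c0] := leP 0 c; rewrite (rsum_funrpos sf) mulrBr.
  rewrite -!ge0Zl// -ge0_rsumB; first last.
  - exact: rsummableZl.
  - exact: rsummableZl.
  - by move=> x; exact: mulr_ge0.
  - by move=> x; exact: mulr_ge0.
  by congr rsum; apply/funext => x; rewrite fE mulrBr.
have Nc0 : 0 <= - c by rewrite oppr_ge0.
transitivity (rsum (fun x => - c * f^\- x - - c * f^\+ x)).
  by congr rsum; apply/funext => x; rewrite fE; ring.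
rewrite ge0_rsumB; first by rewrite !ge0Zl//; ring.
- by move=> x; exact: mulr_ge0.
- by move=> x; exact: mulr_ge0.
- exact: rsummableZl.
- exact: rsummableZl.
Qed.

Lemma rsumB f g : rsummable f -> rsummable g ->
  rsum (fun x => f x - g x) = rsum f - rsum g.
Proof.
move=> sf sg; rewrite rsumD ?rsummableN//; congr (_ + _).
by rewrite -mulN1r -rsumZl//; congr rsum; apply/funext => x; rewrite mulN1r.
Qed.

Lemma le_rsum f g : rsummable f -> rsummable g -> (forall x, f x <= g x) ->
  rsum f <= rsum g.
Proof.
by move=> sf sg fg; rewrite -subr_ge0 -rsumB//; apply: rsum_ge0 => x; rewrite subr_ge0.
Qed.

Lemma sum_le_rsum f s : uniq s -> (forall x, 0 <= f x) -> rsummable f ->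
  \sum_(x <- s) f x <= rsum f.
Proof.
move=> us f0 sf; rewrite -lee_fin -esum_EFin// -sumEFin.
apply: ereal_sup_ubound; exists [set` s]; first by split=> //; exact: finite_seq.
by rewrite -fsbig_seq.
Qed.

Lemma rsum_approx f (e : R) : 0 < e -> (forall x, 0 <= f x) -> rsummable f ->
  exists2 s : seq T, uniq s & rsum f <= \sum_(x <- s) f x + e.
Proof.
move=> e0 f0 sf.
have fin : ereal_sup [set (\sum_(x \in A) (f x)%:E)%E | A in fsets [set: T]] \is a fin_num.
  by rewrite -/(esum _ _) esum_EFin.
have [_ [A [finA _] <-] sumA_lt] := ub_ereal_sup_adherent e0 fin.
exists (finmap.enum_fset (fset_set A)); first exact: finmap.fset_uniq.
move: sumA_lt; rewrite fsbig_finite// -/(esum _ _) esum_EFin//= sumEFin -EFinB lte_fin => sumA_lt.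
by rewrite -lerBlDr ltW.
Qed.

Lemma dominated_rsum_cvg0 (I : Type) (F : set_system I) (FF : Filter F)
    (u : I -> T -> R) g : rsummable g ->
  (\forall i \near F, forall x, `|u i x| <= g x) ->
  (forall x, u i x @[i --> F] --> (0 : R)) -> rsum (u i) @[i --> F] --> (0 : R).
Proof.
move=> sg ug u0; apply/cvgrPdist_le => /= e e0.
have e20 : 0 < e / 2 by rewrite divr_gt0.
have sgn := rsummable_norm sg.
have [s us Hs] := rsum_approx e20 (fun x => normr_ge0 (g x)) sgn.
have us_cvg : (\sum_(x <- s) `|u i x|) @[i --> F] --> (0 : R).
  suff : (\sum_(x <- s) `|u i x|) @[i --> F] --> \sum_(x <- s) `|0 : R|.
    by rewrite normr0 big1.
  apply: (@cvg_big R T +%R 0 xpredT (@add_continuous R^o)) => x _.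
  by apply: cvg_norm; exact: u0.
have /cvgrPdist_le/(_ _ e20) near_s := us_cvg.
near=> i.
have ui : forall x, `|u i x| <= g x by near: i.
have small : \sum_(x <- s) `|u i x| <= e / 2.
  by apply: le_trans (ler_norm _) _; rewrite -normrN -sub0r; near: i.
have sui : rsummable (u i) := rsummable_le ui sg.
have sun := rsummable_norm sui.
have norm_le : `|rsum (u i)| <= rsum (fun x => `|u i x|).
  rewrite ler_norml -mulN1r -rsumZl//; apply/andP; split; apply: le_rsum => //.
  - exact: rsummableZl.
  - by move=> x; rewrite mulN1r lerNl -normrN ler_norm.
  - by move=> x; exact: ler_norm.
have diff0 x : 0 <= `|g x| - `|u i x| by rewrite subr_ge0 (le_trans (ui x))// ler_norm.
have := sum_le_rsum us diff0 (rsummableD sgn (rsummableN sun)).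
rewrite rsumB// big_split /= sumrN sub0r normrN; lra.
Unshelve. all: by end_near. Qed.

End RealSums.

(** * Expectations along a random walk *)

(* [wt] is a submultiplicative weight dominating all functions that get integrated. *)
Record walk (R : realType) (G : groupType) := Walk {
  step : G -> R;
  wt : G -> R;
  step_ge0 : forall g, 0 <= step g;
  step_sum : (\esum_(g in [set: G]) (step g)%:E = 1)%E;
  wt_ge1 : forall g, 1 <= wt g;
  wtM : forall g h, wt (g * h)%g <= wt g * wt h;
  wt_summable : rsummable (fun g => step g * wt g) }.

Section WeightBounds.
Variables (R : realType) (G : groupType) (W : walk R G).
Local Notation w := (wt W).
Implicit Types (f k : G -> R) (F K : G -> G -> R) (g h : G) (c C : R).

Definition dominated C f := forall g, `|f g| <= C * w g.
Definition dominated2 C F := forall g h, `|F g h| <= C * (w g * w h).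
Definition wbounded f := exists C, dominated C f.
Definition wbounded2 F := exists C, dominated2 C F.

Lemma wt_gt0 g : 0 < w g. Proof. exact: lt_le_trans (wt_ge1 W g). Qed.

Lemma wt_ge0 g : 0 <= w g. Proof. exact/ltW/wt_gt0. Qed.

Lemma dominated_ge0 C f : dominated C f -> 0 <= C.
Proof. by move=> /(_ 1%g) /(le_trans (normr_ge0 _)); rewrite pmulr_lge0// wt_gt0. Qed.

Lemma dominated_wbounded C f : dominated C f -> wbounded f.
Proof. by exists C. Qed.

Lemma dominated_mulr C f h : dominated C f -> dominated (C * w h) (fun g => f (g * h)%g).
Proof.
move=> fC g; apply: le_trans (fC _) _; rewrite -mulrA ler_wpM2l ?(dominated_ge0 fC)//.
by rewrite [w h * _]mulrC wtM.
Qed.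

Lemma dominated2_mul C f : dominated C f -> dominated2 C (fun g h => f (g * h)%g).
Proof.
move=> fC g h; apply: le_trans (fC _) _.
by rewrite ler_wpM2l ?(dominated_ge0 fC)// wtM.
Qed.

Lemma dominated2_slice C F h : dominated2 C F -> dominated (C * w h) (F^~ h).
Proof. by move=> FC g; rewrite -mulrA [w h * _]mulrC. Qed.

Lemma wbounded_le f k : (forall g, `|f g| <= k g) -> wbounded k -> wbounded f.
Proof.
by move=> fk [C kC]; exists C => g; apply: le_trans (fk g) (le_trans (ler_norm _) (kC g)).
Qed.

Lemma wbounded_cst c : wbounded (fun=> c).
Proof. by exists `|c| => g; rewrite ler_peMr// wt_ge1. Qed.

Lemma wbounded_wt : wbounded w.
Proof. by exists 1 => g; rewrite mul1r ger0_norm// wt_ge0. Qed.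

Lemma wboundedD f k : wbounded f -> wbounded k -> wbounded (fun g => f g + k g).
Proof.
move=> [C fC] [D kD]; exists (C + D) => g.
by rewrite mulrDl; apply: le_trans (ler_normD _ _) (lerD _ _).
Qed.

Lemma wboundedN f : wbounded f -> wbounded (fun g => - f g).
Proof. by move=> [C fC]; exists C => g; rewrite normrN. Qed.

Lemma wboundedB f k : wbounded f -> wbounded k -> wbounded (fun g => f g - k g).
Proof. by move=> bf bk; apply: wboundedD => //; exact: wboundedN. Qed.

Lemma wboundedZ c f : wbounded f -> wbounded (fun g => c * f g).
Proof. by move=> [C fC]; exists (`|c| * C) => g; rewrite normrM -mulrA ler_wpM2l. Qed.

Lemma wbounded_norm f : wbounded f -> wbounded (fun g => `|f g|).
Proof. by move=> [C fC]; exists C => g; rewrite normr_id. Qed.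

Lemma wbounded_max f k : wbounded f -> wbounded k ->
  wbounded (fun g => Num.max (f g) (k g)).
Proof.
move=> bf bk; apply: (@wbounded_le _ (fun g => `|f g| + `|k g|)).
  by move=> g; case: (leP (f g) (k g)) => _; rewrite ?lerDl ?lerDr.
by apply: wboundedD; exact: wbounded_norm.
Qed.

Lemma wbounded_pred (b : G -> bool) : wbounded (fun g => (b g)%:R).
Proof.
apply: wbounded_le (wbounded_cst 1) => g.
by case: (b g); rewrite /= ?normr1 ?normr0.
Qed.

Lemma wbounded_mulr f h : wbounded f -> wbounded (fun g => f (g * h)%g).
Proof. by move=> [C /(dominated_mulr h) fC]; exists (C * w h). Qed.

Lemma wbounded_mull f h : wbounded f -> wbounded (fun g => f (h * g)%g).
Proof.
move=> [C fC]; exists (C * w h) => g; apply: le_trans (fC _) _.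
by rewrite -mulrA ler_wpM2l ?(dominated_ge0 fC)// wtM.
Qed.

Lemma wbounded2_le F K : (forall g h, `|F g h| <= K g h) -> wbounded2 K -> wbounded2 F.
Proof.
move=> FK [C KC]; exists C => g h.
exact: le_trans (FK g h) (le_trans (ler_norm _) (KC g h)).
Qed.

Lemma wbounded2_fst f : wbounded f -> wbounded2 (fun g _ => f g).
Proof.
move=> [C fC]; exists C => g h; apply: le_trans (fC _) _.
by rewrite ler_wpM2l ?(dominated_ge0 fC)// ler_peMr ?wt_ge0// wt_ge1.
Qed.

Lemma wbounded2_snd f : wbounded f -> wbounded2 (fun _ h => f h).
Proof.
move=> [C fC]; exists C => g h; apply: le_trans (fC _) _.
by rewrite ler_wpM2l ?(dominated_ge0 fC)// ler_peMl ?wt_ge0// wt_ge1.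
Qed.

Lemma wbounded2_mul f : wbounded f -> wbounded2 (fun g h => f (g * h)%g).
Proof. by move=> [C /dominated2_mul fC]; exists C. Qed.

Lemma wbounded2D F K : wbounded2 F -> wbounded2 K -> wbounded2 (fun g h => F g h + K g h).
Proof.
move=> [C FC] [D KD]; exists (C + D) => g h.
by rewrite mulrDl; apply: le_trans (ler_normD _ _) (lerD _ _).
Qed.

Lemma wbounded2Z c F : wbounded2 F -> wbounded2 (fun g h => c * F g h).
Proof. by move=> [C FC]; exists (`|c| * C) => g h; rewrite normrM -mulrA ler_wpM2l. Qed.

Lemma wbounded2_norm F : wbounded2 F -> wbounded2 (fun g h => `|F g h|).
Proof. by move=> [C FC]; exists C => g h; rewrite normr_id. Qed.

Lemma wbounded2_cst c : wbounded2 (fun _ _ => c).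
Proof. exact: wbounded2_fst (wbounded_cst c). Qed.

Lemma wbounded2_pred (b : G -> G -> bool) : wbounded2 (fun g h => (b g h)%:R).
Proof.
apply: wbounded2_le (wbounded2_cst 1) => g h.
by case: (b g h); rewrite /= ?normr1 ?normr0.
Qed.

Lemma wbounded2_slice F h : wbounded2 F -> wbounded (F^~ h).
Proof. by move=> [C /(dominated2_slice h) FC]; exists (C * w h). Qed.

End WeightBounds.

Create HintDb wbounded.
#[local] Hint Resolve wbounded_cst wbounded_wt wboundedD wboundedN wboundedB wboundedZ
  wbounded_norm wbounded_max wbounded_pred wbounded_mulr wbounded_mull
  wbounded2D wbounded2Z wbounded2_norm wbounded2_cst wbounded2_pred wbounded2_fst
  wbounded2_snd wbounded2_mul wbounded2_slice : wbounded.

Ltac wbound := solve [auto 10 with wbounded].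

Section Mean.
Variables (R : realType) (G : groupType) (W : walk R G).
Local Notation m := (step W).
Local Notation w := (wt W).
Local Notation wbounded := (wbounded W).
Local Notation dominated := (dominated W).
Implicit Types (f k : G -> R) (g h : G) (n j : nat) (c C : R).

Definition mean1 f := rsum (fun g => m g * f g).

Fixpoint mean n f : R :=
  if n is n'.+1 then mean1 (fun h => mean n' (fun g => f (g * h)%g)) else f 1%g.

Definition mean_wt := mean1 w.

Lemma wbounded_summable f : wbounded f -> rsummable (fun g => m g * f g).
Proof.
move=> [C fC]; apply: (@rsummable_le _ _ _ (fun g => C * (m g * w g))).
  by move=> g; rewrite normrM ger0_norm ?step_ge0// mulrCA ler_wpM2l ?step_ge0.
exact/rsummableZl/wt_summable.
Qed.

Lemma mean1D f k : wbounded f -> wbounded k -> mean1 (fun g => f g + k g) = mean1 f + mean1 k.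
Proof.
move=> bf bk; rewrite /mean1 -rsumD; [|exact: wbounded_summable..].
by congr rsum; apply/funext => g; rewrite mulrDr.
Qed.

Lemma mean1Z c f : wbounded f -> mean1 (fun g => c * f g) = c * mean1 f.
Proof.
move=> bf; rewrite /mean1 -rsumZl; last exact: wbounded_summable.
by congr rsum; apply/funext => g; rewrite mulrCA.
Qed.

Lemma le_mean1 f k : wbounded f -> wbounded k -> (forall g, f g <= k g) ->
  mean1 f <= mean1 k.
Proof.
move=> bf bk fk; apply: le_rsum; [exact: wbounded_summable..|].
by move=> g; rewrite ler_wpM2l ?step_ge0.
Qed.

Lemma mean1_cst c : mean1 (fun=> c) = c.
Proof.
have sm : rsummable m.
  by apply/rsummable_ge0; [exact: step_ge0|rewrite step_sum ltry].
have : (rsum m)%:E = 1%E by rewrite -esum_EFin ?step_sum//; exact: step_ge0.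
move=> [m1]; rewrite -[RHS]mulr1 -m1 -rsumZl//.
by congr rsum; apply/funext => g; rewrite mulrC.
Qed.

Lemma mean1_ge_point f s : wbounded f -> (forall g, 0 <= f g) -> m s * f s <= mean1 f.
Proof.
move=> bf f0; have := @sum_le_rsum _ _ (fun g => m g * f g) [:: s] isT.
rewrite big_seq1; apply; last exact: wbounded_summable.
by move=> g; rewrite mulr_ge0// step_ge0.
Qed.

Lemma norm_mean1_le C f : dominated C f -> `|mean1 f| <= C * mean_wt.
Proof.
move=> fC; have bf := dominated_wbounded fC; rewrite -mean1Z; last wbound.
have fwC g : - (C * w g) <= f g <= C * w g by rewrite -ler_norml.
rewrite ler_norml -mulN1r -mean1Z; last wbound.
by apply/andP; split; apply: le_mean1 => [|| g]; try wbound;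
  have /andP[] := fwC g; rewrite ?mulN1r.
Qed.

Lemma norm_mean_le n C f : dominated C f -> `|mean n f| <= C * w 1%g * mean_wt ^+ n.
Proof.
elim: n C f => [|n IH] C f fC; first by rewrite expr0 mulr1; exact: fC.
rewrite exprSr mulrA; apply: norm_mean1_le => h.
apply: le_trans (IH _ _ (dominated_mulr h fC)) _.
by rewrite -!mulrA [w h * _]mulrC !mulrA.
Qed.

Lemma dominated_mean n C (F : G -> G -> R) : dominated2 W C F ->
  dominated (C * w 1%g * mean_wt ^+ n) (fun h => mean n (F^~ h)).
Proof.
move=> FC h; apply: le_trans (norm_mean_le _ (dominated2_slice h FC)) _.
by rewrite -!mulrA [w h * _]mulrC !mulrA.
Qed.

Lemma wbounded_mean n (F : G -> G -> R) : wbounded2 W F ->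
  wbounded (fun h => mean n (F^~ h)).
Proof. by move=> [C /(dominated_mean n)]; exact: dominated_wbounded. Qed.

Lemma wbounded_mean_mulr n f : wbounded f -> wbounded (fun h => mean n (fun g => f (g * h)%g)).
Proof. by move=> bf; apply: wbounded_mean; wbound. Qed.

Hint Resolve wbounded_mean wbounded_mean_mulr : wbounded.

Lemma meanD n f k : wbounded f -> wbounded k ->
  mean n (fun g => f g + k g) = mean n f + mean n k.
Proof.
elim: n f k => [//|n IH] f k bf bk /=; rewrite -mean1D; [|wbound|wbound].
by congr mean1; apply/funext => h; rewrite IH; [|wbound|wbound].
Qed.

Lemma meanZ n c f : wbounded f -> mean n (fun g => c * f g) = c * mean n f.
Proof.
elim: n f => [//|n IH] f bf /=; rewrite -mean1Z; last wbound.
by congr mean1; apply/funext => h; rewrite IH//; wbound.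
Qed.

Lemma le_mean n f k : wbounded f -> wbounded k -> (forall g, f g <= k g) ->
  mean n f <= mean n k.
Proof.
elim: n f k => [|n IH] f k bf bk fk /=; first exact: fk.
by apply: le_mean1 => [||h]; [wbound|wbound|apply: IH; [wbound|wbound|]].
Qed.

Lemma mean_cst n c : mean n (fun=> c) = c.
Proof.
elim: n => [//|n IH] /=; rewrite -[RHS]mean1_cst.
by congr mean1; apply/funext => h; rewrite IH.
Qed.

Lemma meanN n f : wbounded f -> mean n (fun g => - f g) = - mean n f.
Proof.
move=> bf; rewrite -mulN1r -meanZ//; congr mean.
by apply/funext => g; rewrite mulN1r.
Qed.

Lemma meanB n f k : wbounded f -> wbounded k ->
  mean n (fun g => f g - k g) = mean n f - mean n k.
Proof. by move=> bf bk; rewrite meanD ?meanN//; wbound. Qed.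

Lemma mean_ge0 n f : wbounded f -> (forall g, 0 <= f g) -> 0 <= mean n f.
Proof. by move=> bf f0; rewrite -[leLHS](mean_cst n); apply: le_mean => //; wbound. Qed.

Lemma norm_mean_le_mean n f : wbounded f -> `|mean n f| <= mean n (fun g => `|f g|).
Proof.
move=> bf; rewrite ler_norml -meanN; last wbound.
by apply/andP; split; apply: le_mean => [||g]; try wbound;
  [rewrite lerNl -normrN ler_norm|exact: ler_norm].
Qed.

Lemma mean_add n j f : mean (n + j) f = mean j (fun h => mean n (fun g => f (g * h)%g)).
Proof.
elim: j f => [|j IH] f.
  by rewrite addn0 /=; congr mean; apply/funext => g; rewrite mulg1.
rewrite addnS /=; congr mean1; apply/funext => h; rewrite IH; congr mean.
by apply/funext => h'; congr mean; apply/funext => g; rewrite mulgA.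
Qed.

Lemma mean_1 f : mean 1 f = mean1 f.
Proof. by rewrite /=; congr mean1; apply/funext => g; rewrite mul1g. Qed.

Lemma mean_hom n f : wbounded f -> (forall g h, f (g * h)%g = f g + f h) ->
  mean n f = n%:R * mean 1 f.
Proof.
move=> bf hom; have f1 : f 1%g = 0 by have := hom 1%g 1%g; rewrite mulg1; lra.
elim: n => [|n IH]; first by rewrite mul0r /= f1.
rewrite -add1n mean_add natrD mulrDl mul1r -IH -[X in _ = X + _](mean_cst n).
rewrite -meanD; [|wbound|wbound]; congr mean; apply/funext => h.
by under eq_fun do rewrite hom; rewrite meanD ?mean_cst//; wbound.
Qed.

Lemma dominated_mean_cvg0 n (I : Type) (F : set_system I) (FF : Filter F) C
    (u : I -> G -> R) : (\forall i \near F, dominated C (u i)) ->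
  (forall g, u i g @[i --> F] --> (0 : R)) -> mean n (u i) @[i --> F] --> (0 : R).
Proof.
elim: n C u => [|n IH] C u uC u0; first exact: u0.
pose D := C * w 1%g * mean_wt ^+ n.
apply: (@dominated_rsum_cvg0 _ _ _ F FF _ (fun g => D * (m g * w g))).
- exact/rsummableZl/wt_summable.
- apply: filterS uC => i uiC h; rewrite normrM ger0_norm ?step_ge0// mulrCA.
  by rewrite ler_wpM2l ?step_ge0//; exact: dominated_mean (dominated2_mul uiC) h.
- move=> h; rewrite -[0](mulr0 (m h)); apply: cvgMr.
  apply: (IH (C * w h)); last by move=> g; exact: u0.
  by apply: filterS uC => i; exact: dominated_mulr.
Qed.

Lemma mean_wt_tail n c : 0 < c ->
  exists2 K, 0 < K & mean n (fun g => w g * (K < w g)%R%:R) <= c.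
Proof.
move=> c0; have : mean n (fun g => w g * (k.+1%:R < w g)%R%:R) @[k --> \oo] --> (0 : R).
  apply: (@dominated_mean_cvg0 n _ \oo _ 1).
    near=> k => g; rewrite mul1r normrM ger0_norm ?wt_ge0//.
    by rewrite ler_piMr ?wt_ge0//; case: (_ < _); rewrite ?normr1 ?normr0.
  move=> g; apply: cvg_near_cst; near=> k.
  suff -> : (k.+1%:R < w g) = false by rewrite mulr0.
  apply/negbTE; rewrite -leNgt; apply: le_trans (ltW (truncnS_gt _)) _.
  by rewrite ler_nat; near: k; exact: nbhs_infty_ge.
move=> /cvgrPdist_le/(_ c c0)[k _ /(_ k (leqnn k))]; rewrite sub0r normrN => mean_tail_le.
by exists k.+1%:R; rewrite ?ltr0n//; apply: le_trans (ler_norm _) mean_tail_le.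
Unshelve. all: by end_near. Qed.

End Mean.

#[local] Hint Resolve wbounded_mean wbounded_mean_mulr : wbounded.

Section IteratedMean.
Variables (R : realType) (G : groupType) (W : walk R G).
Local Notation mean := (mean W).
Local Notation wbounded := (wbounded W).
Local Notation wbounded2 := (wbounded2 W).
Implicit Types (f k : G -> R) (F K : G -> G -> R) (g h : G) (n : nat) (c C : R).

Definition mean2 n F := mean n (fun h => mean n (F^~ h)).

Lemma mean2_fst n f : mean2 n (fun g _ => f g) = mean n f.
Proof. exact: mean_cst. Qed.

Lemma mean2_snd n f : mean2 n (fun _ h => f h) = mean n f.
Proof. by congr mean; apply/funext => h; rewrite mean_cst. Qed.

Lemma mean2_mul n f : mean2 n (fun g h => f (g * h)%g) = mean (n + n) f.
Proof. by rewrite mean_add. Qed.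

Lemma mean2D n F K : wbounded2 F -> wbounded2 K ->
  mean2 n (fun g h => F g h + K g h) = mean2 n F + mean2 n K.
Proof.
move=> bF bK; rewrite /mean2 -meanD; [|wbound|wbound].
by congr mean; apply/funext => h; rewrite meanD//; wbound.
Qed.

Lemma mean2Z n c F : wbounded2 F -> mean2 n (fun g h => c * F g h) = c * mean2 n F.
Proof.
move=> bF; rewrite /mean2 -meanZ; last wbound.
by congr mean; apply/funext => h; rewrite meanZ//; wbound.
Qed.

Lemma le_mean2 n F K : wbounded2 F -> wbounded2 K -> (forall g h, F g h <= K g h) ->
  mean2 n F <= mean2 n K.
Proof.
by move=> bF bK FK; apply: le_mean => [||h]; [wbound|wbound|apply: le_mean; [wbound..|]].
Qed.

Lemma mean2_prod n f k : wbounded f -> wbounded k ->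
  mean2 n (fun g h => f g * k h) = mean n f * mean n k.
Proof.
move=> bf bk; rewrite -meanZ//; congr mean; apply/funext => h.
by rewrite mulrC -meanZ//; congr mean; apply/funext => g; rewrite mulrC.
Qed.

Lemma dominated_mean2_cvg0 n (I : Type) (F : set_system I) (FF : Filter F) C
    (U : I -> G -> G -> R) : (\forall i \near F, dominated2 W C (U i)) ->
  (forall g h, U i g h @[i --> F] --> (0 : R)) -> mean2 n (U i) @[i --> F] --> (0 : R).
Proof.
move=> UC U0; apply: (@dominated_mean_cvg0 _ _ W n I F FF (C * wt W 1%g * mean_wt W ^+ n)).
  by apply: filterS UC => i; exact: dominated_mean.
move=> h; apply: (@dominated_mean_cvg0 _ _ W n I F FF (C * wt W h)) => [|g]; last exact: U0.
by apply: filterS UC => i; exact: dominated2_slice.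
Qed.

End IteratedMean.

Section IntConv.
Variables (R : realType) (G : groupType) (W : walk R G).
Local Notation m := (step W).
Implicit Types (f : G -> R) (h : G).

Lemma gprod_rcons (s : seq G) h : gprod (rcons s h) = (gprod s * h)%g.
Proof. by elim: s => [|a s IH] /=; [rewrite mul1g mulg1|rewrite /gprod /= -mulgA -IH]. Qed.

Lemma int_conv_mean n f : wbounded W f -> (forall g, 0 <= f g) ->
  int_conv m n f = (mean W n f)%:E.
Proof.
elim: n f => [|n IH] f bf f0.
  rewrite /int_conv (_ : [set: 0.-tuple G] = [set [tuple]]); last first.
    by apply/seteqP; split=> x //= _; rewrite tuple0.
  by rewrite esum_set1 /= ?big_ord0 mul1r ?lee_fin//; exact: f0.
pose a h (s : n.-tuple G) := (\prod_(i < n) m (tnth s i)) * f (gprod (rev s) * h)%g.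
have a0 h s : 0 <= a h s by rewrite mulr_ge0// prodr_ge0// => i _; exact: step_ge0.
have ah h : (\esum_(s in [set: n.-tuple G]) (a h s)%:E)%E = (mean W n (fun g => f (g * h)%g))%:E.
  by rewrite -IH//; wbound.
rewrite /= -esum_EFin; first last.
- by apply: wbounded_summable; wbound.
- by move=> h; rewrite mulr_ge0 ?step_ge0//; apply: mean_ge0 => //; wbound.
transitivity (\esum_(h in [set: G]) \esum_(s in [set: n.-tuple G]) (m h * a h s)%:E)%E.
  rewrite esum_esum => [|h s _ _]; last by rewrite lee_fin mulr_ge0 ?step_ge0.
  rewrite /int_conv (@reindex_esum _ _ _ ([set: G] `*`` (fun=> [set: n.-tuple G])) _
     (fun p => [tuple of p.1 :: p.2])); last first.
    split=> //.
      by move=> [h s] [h' s'] _ _ /= /(congr1 val) /= [-> /val_inj ->].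
    move=> t _; exists (thead t, [tuple of behead t]) => //=.
    by rewrite [in RHS](tuple_eta t); apply: val_inj.
  apply: eq_esum => -[h s] _ /=; rewrite big_ord_recl tnth0 -mulrA rev_cons gprod_rcons.
  by under eq_bigr do rewrite tnthS.
apply: eq_esum => h _; under eq_esum do rewrite EFinM.
by rewrite ge0_esumZl ?step_ge0 ?ah// => s; rewrite lee_fin.
Qed.

End IntConv.

(** * Drift and the law of large numbers *)

Lemma fekete (R : realType) (u : nat -> R) : (forall n, 0 <= u n) ->
  (forall n k, u (n + k)%N <= u n + u k) ->
  exists l : R, [/\ 0 <= l, n%:R^-1 * u n @[n --> \oo] --> l & forall n, n%:R * l <= u n].
Proof.
move=> u0 sub; pose A := [set x | exists2 n : nat, (0 < n)%N & x = n%:R^-1 * u n].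
have lbA : lbound A 0 by move=> _ [n n0 ->]; rewrite mulr_ge0// invr_ge0.
have hA : has_inf A by split; [exists (1%:R^-1 * u 1%N), 1%N|exists 0].
have infA n : (0 < n)%N -> inf A <= n%:R^-1 * u n.
  by move=> n0; apply: ge_inf; [exists 0|exists n].
exists (inf A); split; [by apply: lb_le_inf; [case: hA|]| |]; last first.
  move=> n; have [->|n0] := posnP n; first by rewrite mul0r.
  by rewrite -ler_pdivlMl ?ltr0n ?infA.
apply/cvgrPdist_le => /= e e0.
have [x [k k0 ->] uk_lt] := inf_adherent (divr_gt0 e0 (ltr0Sn _ 1)) hA.
have multiple q : u (q * k)%N <= q%:R * u k + u 0%N.
  elim: q => [|q IH]; first by rewrite mul0n mul0r add0r.
  by rewrite mulSn; apply: le_trans (sub _ _) _; rewrite -natr1 mulrDl mul1r; lra.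
pose D := \sum_(r < k) u r + u 0%N.
have D0 : 0 <= D by rewrite addr_ge0// sumr_ge0.
have remainder r : (r < k)%N -> u r + u 0%N <= D.
  by move=> rk; rewrite lerD2r (bigD1 (Ordinal rk))//= lerDl sumr_ge0.
near=> n.
have n0 : (0 < n)%N by near: n; exact: nbhs_infty_gt.
have nD : 2 * D / e <= n%:R.
  apply: le_trans (ltW (truncnS_gt _)) _; rewrite ler_nat; near: n; exact: nbhs_infty_ge.
rewrite ler0_norm ?subr_le0 ?infA// opprB lerBlDr mulrC ler_pdivrMr ?ltr0n//.
have un : u n <= (n %/ k)%:R * u k + D.
  rewrite {1}(divn_eq n k); apply: le_trans (sub _ _) _.
  by have := multiple (n %/ k)%N; have := remainder _ (ltn_pmod n k0); lra.
have quotient : (n %/ k)%:R * u k <= n%:R * (k%:R^-1 * u k).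
  by rewrite mulrA ler_wpM2r// ler_pdivlMr ?ltr0n// -natrM ler_nat leq_divM.
have nR : 0 < n%:R :> R by rewrite ltr0n.
by move: nD; rewrite ler_pdivrMr// => nD; nra.
Unshelve. all: by end_near. Qed.

Section Lengths.
Variables (R : realType) (G : groupType).
Implicit Types (f L : G -> R) (g h : G).

Definition subadditive f := f 1%g <= 0 /\ forall g h, f (g * h)%g <= f g + f h.

Record is_length L : Prop := IsLength {
  len_ge0 : forall g, 0 <= L g;
  len_subadditive : subadditive L }.

Lemma len1 L : is_length L -> L 1%g = 0.
Proof. by move=> [L0 [L1 _]]; apply/eqP; rewrite eq_le L1 L0. Qed.

Lemma lenM L g h : is_length L -> L (g * h)%g <= L g + L h.
Proof. by move=> [_ [_]]; apply. Qed.

Lemma morphism_subadditive f : (forall g h, f (g * h)%g = f g + f h) -> subadditive f.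
Proof.
by move=> fM; split=> [|g h]; [have := fM 1%g 1%g; rewrite mulg1; lra|rewrite fM].
Qed.

End Lengths.

Section Drift.
Variables (R : realType) (G : groupType) (W : walk R G).
Local Notation mean := (mean W).
Local Notation wbounded := (wbounded W).
Implicit Types (L : G -> R) (n : nat) (c : R).

Definition drift L := lim (n%:R^-1 * mean n L @[n --> \oo]).

Lemma driftP L : is_length L -> wbounded L ->
  [/\ 0 <= drift L, n%:R^-1 * mean n L @[n --> \oo] --> drift L &
      forall n, n%:R * drift L <= mean n L].
Proof.
move=> lenL bL; have L0 := len_ge0 lenL.
have [n|n k|l [l0 cl ll]] := @fekete R (mean^~ L).
- exact: mean_ge0.
- rewrite mean_add; apply: le_trans (_ : mean k (fun h => mean n L + L h) <= _).
    apply: le_mean => [||h]; [wbound|wbound|].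
    rewrite -[X in _ + X](mean_cst W n) -meanD//; last wbound.
    by apply: le_mean => [||g]; [wbound|wbound|exact: lenM].
  by rewrite meanD ?mean_cst//; wbound.
by rewrite /drift (cvg_lim _ cl).
Qed.

Lemma drift_ge0 L : is_length L -> wbounded L -> 0 <= drift L.
Proof. by move=> lenL bL; case: (driftP lenL bL). Qed.

Lemma drift_cvg L : is_length L -> wbounded L -> n%:R^-1 * mean n L @[n --> \oo] --> drift L.
Proof. by move=> lenL bL; case: (driftP lenL bL). Qed.

Lemma le_drift L n : is_length L -> wbounded L -> n%:R * drift L <= mean n L.
Proof. by move=> lenL bL; case: (driftP lenL bL). Qed.

Lemma drift_lower_bound L n c : is_length L -> wbounded L -> (0 < n)%N ->
  (forall k, k%:R * (n%:R * c) <= mean (k * n) L) -> c <= drift L.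
Proof.
move=> lenL bL n0 cL; apply/ler_addgt0Pr => e e0.
have /cvgrPdist_le/(_ e e0)[k _ Lk] := drift_cvg lenL bL.
have kn : (k <= k.+1 * n)%N by apply: leq_trans (leq_pmulr _ n0); exact: leqnSn.
have := Lk _ kn; rewrite /= ler_norml => /andP[+ _].
have : c <= (k.+1 * n)%:R^-1 * mean (k.+1 * n) L.
  by rewrite ler_pdivlMl ?ltr0n ?muln_gt0// natrM -mulrA.
by move: (_^-1 * _) => u; lra.
Qed.

End Drift.

Section Excess.
Variables (R : realType) (G : groupType) (W : walk R G).
Local Notation mean := (mean W).
Local Notation wbounded := (wbounded W).
Implicit Types (f : G -> R) (n j : nat) (a b c d B C K : R).

Lemma norm_le_square B c : 0 < B -> `|c| <= c ^+ 2 / (2 * B) + B / 2.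
Proof.
move=> B0; rewrite -subr_ge0.
have -> : c ^+ 2 / (2 * B) + B / 2 - `|c| = (`|c| - B) ^+ 2 / (2 * B).
  by rewrite -(real_normK (num_real c)); field; rewrite gt_eqF.
by rewrite divr_ge0 ?sqr_ge0// mulr_ge0// ltW.
Qed.

(* The linear bound [norm_le_square] makes this a second moment estimate: the
   centred part [Y] enters only through its square, [Z] through its absolute value. *)
Lemma mean_excess_le n f (Y Z : G -> R) a b d B : 0 < B -> wbounded f -> subadditive f ->
  wbounded Y -> wbounded Z -> (forall g, f g = a + Y g + Z g) -> (forall g, `|Y g| <= b) ->
  mean n Y = 0 -> mean n (fun g => `|Z g|) <= d ->
  forall j c1 c2, mean (j * n) (fun g => Num.max (f g - j%:R * a + c1 + c2) 0) <=
    (c1 ^+ 2 + j%:R * b ^+ 2) / (2 * B) + B / 2 + `|c2| + j%:R * d.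
Proof.
move=> B0 bf [f1 fM] bY bZ fE Yb mY mZ.
elim=> [|j IH] c1 c2.
  rewrite mul0n /= !mul0r !subr0 !addr0 ge_max.
  have := norm_le_square c1 B0; have := ler_norm c1; have := ler_norm c2.
  have := normr_ge0 c1; have := normr_ge0 c2.
  by move: (c1 ^+ 2 / _) => ?; lra.
rewrite mulSn addnC mean_add.
pose K := (c1 ^+ 2 + j.+1%:R * b ^+ 2) / (2 * B) + B / 2 + `|c2| + j%:R * d.
have one_step h : mean (j * n) (fun g => Num.max (f (g * h)%g - j.+1%:R * a + c1 + c2) 0) <=
    K + c1 / B * Y h + `|Z h|.
  apply: le_trans (_ : mean (j * n)
      (fun g => Num.max (f g - j%:R * a + (c1 + Y h) + (c2 + Z h)) 0) <= _).
    apply: le_mean => [||g]; [wbound|wbound|].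
    rewrite ge_max !le_max lexx orbT andbT.
    by apply/orP; left; have := fM g h; rewrite (fE h) -natr1; lra.
  apply: le_trans (IH _ _) _.
  have square : (c1 + Y h) ^+ 2 <= c1 ^+ 2 + 2 * c1 * Y h + b ^+ 2.
    by have := Yb h; rewrite ler_norml => /andP[y1 y2]; nra.
  have triangle := ler_normD c2 (Z h).
  have : ((c1 + Y h) ^+ 2 + j%:R * b ^+ 2) / (2 * B) <=
      (c1 ^+ 2 + j.+1%:R * b ^+ 2) / (2 * B) + c1 / B * Y h.
    have -> : (c1 ^+ 2 + j.+1%:R * b ^+ 2) / (2 * B) + c1 / B * Y h =
       (c1 ^+ 2 + 2 * c1 * Y h + j.+1%:R * b ^+ 2) / (2 * B) by field; rewrite gt_eqF.
    rewrite ler_pM2r ?invr_gt0 ?mulr_gt0// -natr1; lra.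
  by rewrite /K; lra.
apply: le_trans (_ : mean n (fun h => K + c1 / B * Y h + `|Z h|) <= _).
  by apply: le_mean => //; [apply: (@wbounded_mean_mulr _ _ _ (j * n)
    (fun g => Num.max (f g - j.+1%:R * a + c1 + c2) 0)); wbound|wbound].
rewrite meanD; [|wbound|wbound]; rewrite meanD; [|wbound|wbound].
by rewrite mean_cst (meanZ _ _ bY) mY mulr0 addr0 /K -natr1 mulrDl; lra.
Qed.

Lemma truncation n C f K : dominated W C f -> 0 < K -> exists Y Z : G -> R,
  [/\ wbounded Y, wbounded Z, forall g, f g = mean n f + Y g + Z g &
      [/\ forall g, `|Y g| <= 2 * (C * K), mean n Y = 0 &
          mean n (fun g => `|Z g|) <= 2 * (C * mean n (fun g => wt W g * (K < wt W g)%R%:R))]].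
Proof.
move=> fC K0; have bf := dominated_wbounded fC; have C0 := dominated_ge0 fC.
pose T g := f g * (wt W g <= K)%R%:R; pose U g := f g * (K < wt W g)%R%:R.
have bounded_mulb (b : G -> bool) k : wbounded k -> wbounded (fun g => k g * (b g)%:R).
  move=> bk; apply: (@wbounded_le _ _ _ _ (fun g => `|k g|)); last wbound.
  by move=> g; rewrite normrM ler_piMr//; case: (b g); rewrite ?normr1 ?normr0.
have bT : wbounded T by exact: bounded_mulb.
have bU : wbounded U by exact: bounded_mulb.
have btail : wbounded (fun g => wt W g * (K < wt W g)%R%:R) by apply: bounded_mulb; wbound.
have fTU g : f g = T g + U g.
  by rewrite /T /U -mulrDr; case: (leP (wt W g) K) => _; rewrite ?addr0 ?add0r mulr1.
have mTU : mean n f = mean n T + mean n U by rewrite -meanD//; congr mean; apply/funext.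
have T_le g : `|T g| <= C * K.
  rewrite /T normrM; case: (leP (wt W g) K) => wK; rewrite ?normr1 ?mulr1 ?normr0 ?mulr0.
    by apply: le_trans (fC g) _; rewrite ler_wpM2l.
  by rewrite mulr_ge0// ltW.
have mT_le : `|mean n T| <= C * K.
  apply: le_trans (norm_mean_le_mean n bT) _; rewrite -[leRHS](mean_cst W n).
  by apply: le_mean => //; wbound.
have U_le : mean n (fun g => `|U g|) <= C * mean n (fun g => wt W g * (K < wt W g)%R%:R).
  rewrite -meanZ//; apply: le_mean => [||g]; [wbound|wbound|].
  rewrite /U normrM mulrA; case: (K < wt W g); rewrite ?normr1 ?normr0 ?mulr0// !mulr1.
  exact: fC.
exists (fun g => T g - mean n T), (fun g => U g - mean n U); split; [wbound|wbound| |split].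
- by move=> g; rewrite mTU fTU; ring.
- by move=> g; apply: le_trans (ler_normB _ _) _; have := T_le g; lra.
- by rewrite meanB ?mean_cst ?subrr//; wbound.
- apply: le_trans (_ : mean n (fun g => `|U g| + `|mean n U|) <= _).
    by apply: le_mean => [||g]; [wbound|wbound|exact: ler_normB].
  rewrite meanD ?mean_cst; [|wbound|wbound].
  by have := norm_mean_le_mean n bU; lra.
Qed.

Lemma mean_excess_small C n d : 0 < d -> exists j0 : nat, forall j f, (j0 <= j)%N ->
  dominated W C f -> subadditive f ->
  mean (j * n) (fun g => Num.max (f g - j%:R * mean n f) 0) <= d * j%:R.
Proof.
move=> d0; have [C0|C0] := ltP C 0.
  by exists 0%N => j f _ /dominated_ge0; rewrite leNgt C0.
have tail0 : 0 < d / (8 * (C + 1)) by rewrite divr_gt0// mulr_gt0// ltr_pwDr.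
have [K K0 tailK] := mean_wt_tail W n tail0.
pose b := 2 * (C * K).
exists (Num.truncn (2 * b ^+ 2 / d ^+ 2)).+1 => j f jj fC subf.
have [Y [Z [bY bZ fE [Yb mY mZ]]]] := truncation n fC K0.
have j0 : 0 < j%:R :> R by rewrite ltr0n; apply: leq_trans jj.
have B0 : 0 < d * j%:R by rewrite mulr_gt0.
have bf := dominated_wbounded fC.
have := mean_excess_le B0 bf subf bY bZ fE Yb mY mZ j 0 0.
rewrite normr0 expr0n /= add0r addr0; under eq_fun do rewrite !addr0.
move=> excess; apply: le_trans excess _; rewrite -/b.
have square : j%:R * b ^+ 2 / (2 * (d * j%:R)) <= d * j%:R / 4.
  have : 2 * b ^+ 2 / d ^+ 2 <= j%:R.
    by apply: le_trans (ltW (truncnS_gt _)) _; rewrite ler_nat.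
  rewrite ler_pdivrMr ?exprn_gt0// => hb; rewrite ler_pdivrMr ?mulr_gt0//.
  have -> : d * j%:R / 4 * (2 * (d * j%:R)) = j%:R * (j%:R * d ^+ 2 / 2) by field.
  by rewrite ler_pM2l//; lra.
have tail : C * mean n (fun g => wt W g * (K < wt W g)%R%:R) <= d / 8.
  apply: le_trans (ler_wpM2l C0 tailK) _.
  rewrite mulrA ler_pdivrMr ?mulr_gt0 ?ltr_pwDr//.
  have -> : d / 8 * (8 * (C + 1)) = d * (C + 1) by field.
  by nra.
move: tail; set tail := C * _ => tail_le.
have : j%:R * (2 * tail) <= j%:R * (d / 4) by rewrite ler_pM2l//; lra.
by move: square; set q := _ / (2 * _); lra.
Qed.

End Excess.

Section Concentration.
Variables (R : realType) (G : groupType) (W : walk R G).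
Local Notation mean := (mean W).
Local Notation drift := (drift W).
Implicit Types (L : G -> R) (i : nat) (d : R).

Lemma mean_excess_pow2 L d : 0 < d -> is_length L -> wbounded W L ->
  exists i0 : nat, forall i, (i0 <= i)%N ->
    mean (2 ^ i) (fun g => Num.max (L g - (2 ^ i)%:R * drift L) 0) <= d * (2 ^ i)%:R.
Proof.
move=> d0 lenL bL; have [C LC] := bL; have d2 : 0 < d / 2 by rewrite divr_gt0.
have [i1 mean_i1] : exists i1 : nat, mean (2 ^ i1) L <= (2 ^ i1)%:R * (drift L + d / 2).
  have /cvgrPdist_le/(_ _ d2)[N _ HN] := drift_cvg lenL bL.
  exists N; have := HN (2 ^ N)%N (ltnW (ltn_expl _ (ltnSn 1))).
  rewrite distrC ler_norml => /andP[_ h]; rewrite -ler_pdivrMl ?ltr0n ?expn_gt0//; lra.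
set n1 := (2 ^ i1)%N in mean_i1.
have [j0 excess] := mean_excess_small W C n1 d2.
exists (i1 + j0)%N => i hi; have i1i := leq_trans (leq_addr _ _) hi.
pose j := (2 ^ (i - i1))%N.
have iE : (2 ^ i = j * n1)%N by rewrite /j /n1 -expnD subnK.
have jj : (j0 <= j)%N by apply: leq_trans (ltnW (ltn_expl _ (ltnSn 1))); rewrite leq_subRL.
have := excess j L jj LC (len_subadditive lenL); rewrite -iE; set n := (2 ^ i)%N => excess_n.
have nR : n%:R = j%:R * n1%:R :> R by rewrite /n iE natrM.
have jn : j%:R * mean n1 L - n%:R * drift L <= n%:R * (d / 2).
  by rewrite nR; have := ler_wpM2l (ler0n R j) mean_i1; lra.
apply: le_trans (_ : mean n (fun g => Num.max (L g - j%:R * mean n1 L) 0 + n%:R * (d / 2)) <= _).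
  apply: le_mean => [||g]; [wbound|wbound|]; rewrite ge_max; apply/andP; split.
    have : L g - j%:R * mean n1 L <= Num.max (L g - j%:R * mean n1 L) 0 by rewrite le_max lexx.
    by lra.
  by rewrite addr_ge0 ?le_max ?lexx ?orbT// mulr_ge0// ltW.
rewrite meanD ?mean_cst; [|wbound|wbound].
have : j%:R <= n%:R :> R by rewrite ler_nat /n iE leq_pmulr// expn_gt0.
by rewrite -(ler_pM2l d2); lra.
Qed.

Lemma mean_dist_drift_small L d : 0 < d -> is_length L -> wbounded W L ->
  exists i0 : nat, forall i, (i0 <= i)%N ->
    mean (2 ^ i) (fun g => `|L g - (2 ^ i)%:R * drift L|) <= d * (2 ^ i)%:R.
Proof.
move=> d0 lenL bL; have d2 : 0 < d / 2 by rewrite divr_gt0.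
have [i0 excess] := mean_excess_pow2 d2 lenL bL.
exists i0 => i /excess; set n := (2 ^ i)%N => excess_n.
have norm_excess (x : R) : `|x| = 2 * Num.max x 0 - x.
  by case: (leP x 0) => x0; [rewrite ler0_norm//|rewrite gtr0_norm//]; lra.
under eq_fun do rewrite norm_excess.
rewrite meanB ?meanZ ?meanB ?mean_cst//; try wbound.
by have := le_drift n lenL bL; lra.
Qed.

End Concentration.

(** * Random walks with drift for a tree-like length *)

Section Probabilities.
Variables (R : realType) (G : groupType) (W : walk R G).
Local Notation mean := (mean W).
Local Notation mean2 := (mean2 W).
Implicit Types (f : G -> R) (b : G -> bool) (s : G) (n : nat).

Lemma mean_predC n b : mean n (fun g => (b g)%:R) + mean n (fun g => (~~ b g)%:R) = 1.
Proof.
rewrite -meanD; [|wbound|wbound]; rewrite -[RHS](mean_cst W n).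
by congr mean; apply/funext => g; case: (b g); rewrite ?addr0 ?add0r.
Qed.

Lemma mean_union_bound n (bs : seq (G -> bool)) :
  \sum_(b <- bs) mean n (fun g => (b g)%:R) < 1 -> exists g, all (fun b => ~~ b g) bs.
Proof.
have count_bounded (l : seq (G -> bool)) : wbounded W (fun g => \sum_(b <- l) (b g)%:R).
  elim: l => [|b l IH]; first by under eq_fun do rewrite big_nil; wbound.
  by under eq_fun do rewrite big_cons; wbound.
have mean_count (l : seq (G -> bool)) :
    mean n (fun g => \sum_(b <- l) (b g)%:R) = \sum_(b <- l) mean n (fun g => (b g)%:R).
  elim: l => [|b l IH]; first by under eq_fun do rewrite big_nil; rewrite big_nil mean_cst.
  by under eq_fun do rewrite big_cons; rewrite big_cons meanD ?IH//; wbound.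
move=> sum_lt1; apply: contrapT => bad; move: sum_lt1; apply/negP; rewrite -leNgt -mean_count.
rewrite -[leLHS](mean_cst W n); apply: le_mean => [||g]; [wbound|exact: count_bounded|].
have /allPn[b bl /negPn bg] : ~~ all (fun b => ~~ b g) bs by apply/negP => ?; apply: bad; exists g.
rewrite (eq_bigr (fun b => ((fun b => b g : nat) b)%:R))// -natr_sum ler1n.
by rewrite lt0n sum_nat_seq_neq0; apply/hasP; exists b => //; rewrite bg.
Qed.

Lemma mean2_markov n (P Q : G -> G -> bool) (D : G -> G -> R) (a : R) : 0 < a ->
  wbounded2 W D -> (forall g h, 0 <= D g h) ->
  (forall g h, P g h -> ~~ Q g h -> a <= D g h) ->
  mean2 n (fun g h => (P g h)%:R) <= mean2 n (fun g h => (Q g h)%:R) + mean2 n D / a.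
Proof.
move=> a0 bD D0 PQ; rewrite [_ / a]mulrC -mean2Z// -mean2D; [|wbound|wbound].
apply: le_mean2 => [||g h]; [wbound|wbound|].
have aD : 0 <= a^-1 * D g h by rewrite mulr_ge0// invr_ge0 ltW.
have [Pgh|_] := boolP (P g h); last by rewrite addr_ge0.
have [_|Qgh] := boolP (Q g h); first by rewrite lerDl.
by rewrite add0r ler_pdivlMl// mulr1 PQ.
Qed.

Lemma exists_step_gt0 : exists s, 0 < step W s.
Proof.
apply: contrapT => no_step; have := step_sum W; rewrite esum1.
  by move/eqP; rewrite eqe eq_sym oner_eq0.
move=> g _; congr EFin; apply/eqP; rewrite eq_le step_ge0 andbT leNgt.
by apply/negP => mg; apply: no_step; exists g.
Qed.

Lemma step_mean_mulr n f s : wbounded W f -> (forall g, 0 <= f g) ->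
  step W s * mean n (fun g => f (g * s)%g) <= mean n.+1 f.
Proof.
move=> bf f0; apply: (mean1_ge_point (f := fun h => mean n (fun g => f (g * h)%g))) => [|g].
  by wbound.
by apply: mean_ge0 => //; wbound.
Qed.

Lemma step_mean_mull n f s : wbounded W f -> (forall g, 0 <= f g) ->
  step W s * mean n (fun g => f (s * g)%g) <= mean n.+1 f.
Proof.
move=> bf f0; rewrite -add1n mean_add -meanZ; last wbound.
apply: le_mean => [||h]; [wbound|wbound|].
by rewrite mean_1; apply: (mean1_ge_point (f := fun g => f (g * h)%g)) => //; wbound.
Qed.

End Probabilities.

Section TreeLength.
Variables (R : realType) (G : groupType).
Implicit Types (N : G -> R) (g h k s : G).

(* The four-point condition says that [N g] is the displacement of a base point of
   a tree; [gromov] is then twice the Gromov product at that point of its images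
   under [g^-1] and [h^-1]. *)
Record is_tree_length N : Prop := IsTreeLength {
  tree_len : is_length N;
  tree_lenV : forall g, N (g^-1)%g = N g;
  tree_four_point : forall g h k,
    N (g * k^-1)%g + N h <= Num.max (N (g * h^-1)%g + N k) (N g + N (h * k^-1)%g) }.

Definition gromov N g h := N g + N h - N (g * h^-1)%g.

Variable N : G -> R.
Hypothesis treeN : is_tree_length N.
Let NV := tree_lenV treeN.
Let NM g h := lenM g h (tree_len treeN).

Lemma gromovC g h : gromov N g h = gromov N h g.
Proof. by rewrite /gromov -(NV (g * h^-1)%g) invgM invgK [N g + _]addrC. Qed.

Lemma gromov_ultra g h k r : r <= gromov N g h -> r <= gromov N h k -> r <= gromov N g k.
Proof.
rewrite /gromov => gh hk.
by have := tree_four_point treeN g h k; rewrite le_max => /orP[] gk; lra.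
Qed.

Lemma gromov_mulr g h s : gromov N g h - 2 * N s <= gromov N (g * s)%g (h * s)%g.
Proof.
rewrite /gromov invgM mulgA mulgK.
have := NM (g * s)%g s^-1%g; have := NM (h * s)%g s^-1%g.
by rewrite !mulgK NV; lra.
Qed.

Lemma gromov_mull g h s : gromov N (s * g)%g h - 2 * N s <= gromov N g h.
Proof.
rewrite /gromov -mulgA; have := NM s g; have := NM s^-1%g (s * (g * h^-1))%g.
by rewrite mulKg NV; lra.
Qed.

Lemma gromov_gprod h (c : R) (s : seq G) : c <= gromov N h h ->
  (forall y, y \in s -> c <= gromov N (h * y)%g h) ->
  c - 2 * \sum_(y <- s) N y <= gromov N (h * gprod s)%g h.
Proof.
have N0 := len_ge0 (tree_len treeN).
move=> chh; elim: s => [|y s IH] cs; first by rewrite big_nil mulr0 subr0 /gprod /= mulg1.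
have Nprod : N (gprod s) <= \sum_(u <- s) N u.
  elim: (s) => [|u s' IHs]; first by rewrite big_nil /gprod /= (len1 (tree_len treeN)).
  by rewrite big_cons; apply: le_trans (NM _ _) _; rewrite lerD2l.
rewrite big_cons /gprod /= -/(gprod s) mulgA.
apply: (@gromov_ultra _ (h * gprod s)%g).
  have := gromov_mulr (h * y)%g h (gprod s); have := cs y (mem_head _ _).
  by have := N0 y; lra.
have := IH (fun u us => cs u ltac:(by rewrite in_cons us orbT)); have := N0 y; lra.
Qed.

End TreeLength.

Section TreeWalk.
Variables (R : realType) (G : groupType) (W : walk R G) (N : G -> R).
Local Notation mean := (mean W).
Local Notation mean2 := (mean2 W).
Local Notation l := (drift W N).
Implicit Types (g h x s : G) (n i k : nat) (d e eta r : R).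

Hypothesis treeN : is_tree_length N.
Hypothesis bN : wbounded W N.
Let lenN := tree_len treeN.

Definition deviation n g h : R :=
  `|N g - n%:R * l| + `|N h - n%:R * l| + `|N (g * h)%g - 2 * n%:R * l|.

Lemma wbounded2_deviation n : wbounded2 W (deviation n).
Proof.
have b (c : R) : wbounded W (fun g => `|N g - c|) by wbound.
apply: wbounded2D; [apply: wbounded2D; [exact: wbounded2_fst|exact: wbounded2_snd]|].
exact: (@wbounded2_mul _ _ _ (fun g => `|N g - 2 * n%:R * l|)).
Qed.

Lemma deviation_ge0 n g h : 0 <= deviation n g h. Proof. by rewrite !addr_ge0. Qed.

Lemma deviation_bounds n g h : [/\
  n%:R * l - deviation n g h <= N g <= n%:R * l + deviation n g h,
  n%:R * l - deviation n g h <= N h <= n%:R * l + deviation n g h,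
  2 * n%:R * l - deviation n g h <= N (g * h)%g + N h - N g &
  N g + N h - N (g * h)%g <= deviation n g h].
Proof.
have abs (y z : R) : - `|y - z| <= y - z <= `|y - z| by rewrite -ler_norml.
have := abs (N g) (n%:R * l); have := abs (N h) (n%:R * l).
have := abs (N (g * h)%g) (2 * n%:R * l); rewrite /deviation.
by move=> /andP[? ?] /andP[? ?] /andP[? ?]; split; try (apply/andP; split); lra.
Qed.

Lemma mean_deviation_small d : 0 < d -> exists i0 : nat, forall i, (i0 <= i)%N ->
  mean2 (2 ^ i) (deviation (2 ^ i)) <= d * (2 ^ i)%:R.
Proof.
move=> d0; have d4 : 0 < d / 4 by rewrite divr_gt0.
have [i0 small] := mean_dist_drift_small d4 lenN bN.
exists i0 => i hi; have := small i hi; have := small i.+1 (leqW hi).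
have -> : (2 ^ i.+1)%:R = 2 * (2 ^ i)%:R :> R by rewrite expnS natrM.
rewrite expnS mul2n -addnn; set n := (2 ^ i)%N.
rewrite -mean2_mul => mul_small small_n.
have b (c : R) : wbounded W (fun g => `|N g - c|) by wbound.
rewrite /deviation mean2D; [|wbound|exact: wbounded2_mul (b _)].
by rewrite mean2D ?mean2_fst ?mean2_snd; [lra|wbound|wbound].
Qed.

Definition mass n r x := mean n (fun g => (r <= gromov N x g)%R%:R).
Definition maxmass n r := sup [set mass n r x | x in [set: G]].

Lemma mass_le1 n r x : mass n r x <= 1.
Proof.
rewrite -[leRHS](mean_cst W n); apply: le_mean => [||g]; [wbound|wbound|].
by case: (_ <= gromov _ _ _).
Qed.

Lemma mass_ge0 n r x : 0 <= mass n r x.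
Proof. by apply: mean_ge0 => //; wbound. Qed.

Lemma le_mass n r r' x : r' <= r -> mass n r x <= mass n r' x.
Proof.
move=> rr; apply: le_mean => [||g]; [wbound|wbound|].
by case: (leP r (gromov N x g)) => // /(le_trans rr) ->.
Qed.

Lemma has_sup_mass n r : has_sup [set mass n r x | x in [set: G]].
Proof.
by split; [exists (mass n r 1%g), 1%g|exists 1 => _ [x _ <-]; exact: mass_le1].
Qed.

Lemma mass_le_maxmass n r x : mass n r x <= maxmass n r.
Proof. by apply: ub_le_sup; [case: (has_sup_mass n r)|exists x]. Qed.

Lemma maxmass_le n r (c : R) : (forall x, mass n r x <= c) -> maxmass n r <= c.
Proof. by move=> mc; apply: ge_sup => [|_ [x _ <-]//]; case: (has_sup_mass n r). Qed.

Lemma maxmass_ge0 n r : 0 <= maxmass n r.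
Proof. exact: le_trans (mass_ge0 n r 1%g) (mass_le_maxmass n r 1%g). Qed.

Lemma maxmass_le1 n r : maxmass n r <= 1.
Proof. by apply: maxmass_le => x; exact: mass_le1. Qed.

Lemma maxmass_adherent n r e : 0 < e -> exists x, maxmass n r - e <= mass n r x.
Proof.
by move=> e0; have [_ [x _ <-] /ltW] := sup_adherent e0 (has_sup_mass n r); exists x.
Qed.

Lemma massD n r x : mass (n + n) r x = mean2 n (fun g h => (r <= gromov N x (g * h)%g)%R%:R).
Proof. by rewrite /mass -mean2_mul. Qed.

Hypothesis drift_gt0 : 0 < l.

Lemma maxmass_double i d r :
  mean2 (2 ^ i) (deviation (2 ^ i)) <= d * (2 ^ i)%:R -> r <= 3 / 2 * l * (2 ^ i)%:R ->
  maxmass (2 ^ i.+1) r <= maxmass (2 ^ i) r + 2 * d / l.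
Proof.
rewrite expnS mul2n -addnn; have : 0 < (2 ^ i)%:R :> R by rewrite ltr0n expn_gt0.
move: (2 ^ i)%N => n n0 dev hr; apply: maxmass_le => x.
have ln : 0 < l * n%:R by rewrite mulr_gt0.
rewrite massD; apply: le_trans (mean2_markov (Q := fun _ h => r <= gromov N x h) n
  (divr_gt0 ln (ltr0Sn _ 1)) (wbounded2_deviation n) (@deviation_ge0 n) _) _.
  move=> g h xgh; apply: contraNle => dev_gh.
  apply: (gromov_ultra treeN xgh); rewrite /gromov mulgK.
  by have [_ _ + _] := deviation_bounds n g h; lra.
rewrite mean2_snd; apply: lerD; first exact: mass_le_maxmass.
by rewrite ler_pdivrMr ?divr_gt0//; apply: le_trans dev _; rewrite le_eqVlt; apply/orP; left;
  apply/eqP; field; rewrite gt_eqF.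
Qed.

(* If [gromov x h] were small, [h^-1] would point towards [x h^-1], hence towards [g],
   whereas independent steps rarely cancel. *)
Lemma mass_double i d x :
  mean2 (2 ^ i) (deviation (2 ^ i)) <= d * (2 ^ i)%:R ->
  mass (2 ^ i.+1) (3 * l * (2 ^ i)%:R) x <=
  mass (2 ^ i) (l * (2 ^ i)%:R) x * maxmass (2 ^ i) (3 / 4 * l * (2 ^ i)%:R) + 8 * d / l.
Proof.
rewrite expnS mul2n -addnn; have : 0 < (2 ^ i)%:R :> R by rewrite ltr0n expn_gt0.
move: (2 ^ i)%N => n n0 dev; have ln : 0 < l * n%:R by rewrite mulr_gt0.
pose r := 3 / 4 * l * n%:R.
pose Q g h := (l * n%:R <= gromov N x h) && (r <= gromov N (x * h^-1)%g g).
rewrite massD; apply: le_trans (mean2_markov (Q := Q) n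
  (divr_gt0 ln (ltr0Sn _ 7)) (wbounded2_deviation n) (@deviation_ge0 n) _) _.
  move=> g h xgh; apply: contraNle => dev_gh.
  have [/andP[g1 g2] /andP[h1 h2] gh1 gh2] := deviation_bounds n g h.
  have xhg : r <= gromov N (x * h^-1)%g g.
    have := gromov_mulr treeN x (g * h)%g h^-1%g.
    by rewrite mulgK (tree_lenV treeN) /r; lra.
  rewrite /Q xhg andbT leNgt; apply/negP => xh.
  have hxh : gromov N h^-1%g (x * h^-1)%g = 2 * N h - gromov N x h.
    by rewrite /gromov invgM invgK mulgA mulVg mul1g !(tree_lenV treeN); lra.
  have r_hxh : r <= gromov N h^-1%g (x * h^-1)%g by rewrite hxh /r; lra.
  have := gromov_ultra treeN r_hxh xhg.
  by rewrite (gromovC treeN) /gromov invgK (tree_lenV treeN) /r; lra.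
apply: lerD; last first.
  rewrite ler_pdivrMr ?divr_gt0//; apply: le_trans dev _; rewrite le_eqVlt; apply/orP; left.
  by apply/eqP; field; rewrite gt_eqF.
rewrite /mass mulrC -meanZ; last wbound.
apply: le_mean => [||h]; [by apply: wbounded_mean; wbound|wbound|].
under eq_fun do rewrite -mulnb natrM.
rewrite meanZ; last wbound.
by rewrite mulrC ler_wpM2r// mass_le_maxmass.
Qed.

Definition spread := forall e eta, 0 < e -> 0 < eta -> forall i0 : nat,
  exists2 i, (i0 <= i)%N &
    mean2 (2 ^ i) (fun g h => (e * (2 ^ i)%:R <= gromov N g h)%R%:R) <= eta.

Definition aligned := forall eta, 0 < eta -> forall i0 : nat,
  exists i x, (i0 <= i)%N /\ 1 - eta <= mass (2 ^ i) (l * (2 ^ i)%:R) x.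

Let scale_mass i := maxmass (2 ^ i) (3 / 2 * l * (2 ^ i)%:R).

Lemma maxmass_iter i k d : 0 <= d ->
  (forall j, (i <= j)%N -> mean2 (2 ^ j) (deviation (2 ^ j)) <= d * (2 ^ j)%:R) ->
  maxmass (2 ^ (i + k)) (3 / 2 * l * (2 ^ i)%:R) <= scale_mass i + k%:R * (2 * d / l).
Proof.
move=> d0 dev; elim: k => [|k IH]; first by rewrite addn0 mul0r addr0.
rewrite addnS; apply: le_trans (maxmass_double (dev (i + k)%N (leq_addr _ _)) _) _.
  by rewrite ler_pM2l ?mulr_gt0// ler_nat leq_exp2l// leq_addr.
by move: IH; rewrite -[k.+1%:R]natr1; lra.
Qed.

Lemma small_maxmass_spread :
  (forall c : R, 0 < c -> forall i0, exists2 i, (i0 <= i)%N & scale_mass i < c) -> spread.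
Proof.
move=> small e eta e0 eta0 i0.
have [k ek] : exists k : nat, 3 / 2 * l <= e * (2 ^ k)%:R.
  exists (Num.truncn (3 / 2 * l / e)).+1; rewrite [leRHS]mulrC -ler_pdivrMr//.
  apply: le_trans (ltW (truncnS_gt _)) _; rewrite ler_nat; exact: ltnW (ltn_expl _ (ltnSn 1)).
pose d := eta * l / (4 * k.+1%:R).
have d0 : 0 < d by rewrite divr_gt0 ?mulr_gt0.
have [i1 dev] := mean_deviation_small d0.
have eta2 : 0 < eta / 2 by rewrite divr_gt0.
have [i + small_i] := small _ eta2 (maxn i0 i1); rewrite geq_max => /andP[hi0 hi1].
exists (i + k)%N; first exact: leq_trans (leq_addr _ _).
have := maxmass_iter k (ltW d0) (fun j hj => dev j (leq_trans hi1 hj)).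
set n := (2 ^ (i + k))%N => maxmass_le_n.
rewrite -[leRHS](mean_cst W n); apply: le_mean => [||h]; [by apply: wbounded_mean; wbound|wbound|].
apply: le_trans (_ : maxmass n (3 / 2 * l * (2 ^ i)%:R) <= _).
  under eq_fun do rewrite (gromovC treeN).
  apply: le_trans (mass_le_maxmass n _ h); apply: le_mass.
  by rewrite /n expnD natrM mulrCA [leRHS]mulrC ler_pM2r// ltr0n expn_gt0.
apply: le_trans maxmass_le_n _.
have : k%:R * (2 * d / l) <= eta / 2.
  have -> : k%:R * (2 * d / l) = eta / 2 * (k%:R / k.+1%:R).
    by rewrite /d; field; rewrite !gt_eqF.
  by rewrite ger_pMr// ler_pdivrMr// mul1r ler_nat.
by lra.
Qed.

Lemma exists_almost_nondecreasing (b : nat -> R) e i0 : 0 < e ->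
  (forall i, 0 <= b i <= 1) -> exists2 i, (i0 <= i)%N & b i - e <= b i.+2.
Proof.
move=> e0 b01; apply: contrapT => decrease.
have dec i : (i0 <= i)%N -> b i.+2 <= b i - e.
  by move=> hi; rewrite leNgt; apply/negP => bi; apply: decrease; exists i => //; exact: ltW.
have dec_iter k : b (i0 + k.*2)%N <= b i0 - k%:R * e.
  elim: k => [|k IH]; first by rewrite addn0 mul0r subr0.
  rewrite doubleS !addnS; apply: le_trans (dec _ (leq_addr _ _)) _.
  by rewrite -natr1 mulrDl mul1r; lra.
have := dec_iter (Num.truncn e^-1).+1.
have /andP[_ ?] := b01 i0; have /andP[? _] := b01 (i0 + (Num.truncn e^-1).+1.*2)%N.
have : 1 < (Num.truncn e^-1).+1%:R * e by rewrite -ltr_pdivrMr// div1r truncnS_gt.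
by lra.
Qed.

Lemma large_maxmass_aligned (c : R) i1 : 0 < c ->
  (forall i, (i1 <= i)%N -> c <= scale_mass i) -> aligned.
Proof.
move=> c0 large eta eta0 i0.
pose d := c * eta * l / 40; pose e := c * eta / 8.
have e0 : 0 < e by rewrite divr_gt0 ?mulr_gt0.
have d0 : 0 < d by rewrite divr_gt0 ?mulr_gt0.
have dl : d / l = c * eta / 40 by rewrite /d; field; rewrite gt_eqF.
have [i2 dev] := mean_deviation_small d0.
have mass01 i : 0 <= scale_mass i <= 1 by rewrite maxmass_ge0 maxmass_le1.
have [i + almost_monotone] := exists_almost_nondecreasing (maxn i0 (maxn i1 i2)) e0 mass01.
rewrite !geq_max => /and3P[hi0 hi1 hi2].
have scale2 : 3 / 2 * l * (2 ^ i.+2)%:R = 3 * l * (2 ^ i.+1)%:R.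
  by rewrite [(2 ^ i.+2)%N]expnS natrM; field.
have scale1 : 3 / 4 * l * (2 ^ i.+1)%:R = 3 / 2 * l * (2 ^ i)%:R.
  by rewrite [(2 ^ i.+1)%N]expnS natrM; field.
have [x mass_x] := maxmass_adherent (2 ^ i.+2) (3 * l * (2 ^ i.+1)%:R) e0.
exists i.+1, x; split; first exact: leqW.
have := le_trans mass_x (mass_double x (dev _ (leqW hi2))).
rewrite -scale2 -/(scale_mass i.+2) scale1.
have := maxmass_double (r := 3 / 2 * l * (2 ^ i)%:R) (dev _ hi2) (lexx _).
rewrite -/(scale_mass i) -![_ * d / l]mulrA dl.
have := mass_ge0 (2 ^ i.+1) (l * (2 ^ i.+1)%:R) x.
have := mass_le1 (2 ^ i.+1) (l * (2 ^ i.+1)%:R) x.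
have := large i hi1; move: almost_monotone.
set p := mass _ _ _; set M := maxmass _ _; set b0 := scale_mass i; set b2 := scale_mass i.+2.
move=> b20 cb p1 p0 Mb Mp.
have pM : p * M <= p * b0 + 2 * (c * eta / 40).
  apply: le_trans (ler_wpM2l p0 Mb) _; rewrite mulrDr lerD2l ler_piMl//.
  by rewrite !mulr_ge0// ?invr_ge0// ltW.
have pc : (1 - p) * c <= (1 - p) * b0 by rewrite ler_wpM2l// subr_ge0.
suff : 1 - p <= eta / 2 by lra.
by rewrite -(ler_pM2r c0); move: Mp b20; rewrite /e; lra.
Qed.

Lemma spread_or_aligned : spread \/ aligned.
Proof.
have [small|] := pselect (forall c : R, 0 < c -> forall i0,
    exists2 i, (i0 <= i)%N & scale_mass i < c); first by left; exact: small_maxmass_spread.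
move=> /existsNP[c /not_implyP[c0 /existsNP[i1 large]]]; right.
apply: (large_maxmass_aligned (i1 := i1) c0) => i hi.
by rewrite leNgt; apply/negP => small; apply: large; exists i.
Qed.

Lemma aligned_common_direction (s : seq G) s0 (D : R) : aligned -> 0 < step W s0 ->
  all (fun x => 0 < step W x) s ->
  exists x h, D <= gromov N x (s0 * h)%g /\ {in s, forall y, D <= gromov N x (h * y)%g}.
Proof.
move=> al step_s0 /allP step_s.
pose T := (step W s0)^-1 + \sum_(y <- s) (step W y)^-1.
have T0 : 0 <= T.
  by rewrite addr_ge0 ?invr_ge0 ?step_ge0// sumr_ge0// => y _; rewrite invr_ge0 step_ge0.
have T1 : 0 < T + 1 by rewrite ltr_pwDr.
have eta0 : 0 < (T + 1)^-1 by rewrite invr_gt0.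
have [i [x [hi +]]] := al _ eta0 (Num.truncn (D / l)).+1.
have Dr : D <= l * (2 ^ i)%:R.
  rewrite [leRHS]mulrC -ler_pdivrMr//; apply: le_trans (ltW (truncnS_gt _)) _; rewrite ler_nat.
  exact: leq_trans hi (ltnW (ltn_expl _ (ltnSn 1))).
move: Dr; set r := l * _ => Dr; rewrite /mass -(prednK (expn_gt0 2 i)).
move: (_.-1) => n mass_x.
pose bad g := ~~ (r <= gromov N x g).
have mean_bad : mean n.+1 (fun g => (bad g)%:R) <= (T + 1)^-1.
  by have := mean_predC W n.+1 (fun g => r <= gromov N x g); rewrite /bad; lra.
have [|h /=] := @mean_union_bound _ _ W n
    ((fun g => bad (s0 * g)%g) :: [seq (fun g => bad (g * y)%g) | y <- s]).
  apply: (@le_lt_trans _ _ ((T + 1)^-1 * T)); last first.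
    by rewrite ltr_pdivrMl// mulr1 ltrDl.
  rewrite big_cons big_map mulrDr mulr_sumr big_seq [leRHS]addrC [leRHS]addrC [in leRHS]big_seq.
  apply: lerD; last apply: ler_sum => y ys.
    rewrite ler_pdivlMr// mulrC; apply: le_trans mean_bad.
    by apply: (@step_mean_mull _ _ _ _ (fun g => (bad g)%:R)) => //; wbound.
  rewrite ler_pdivlMr ?step_s// mulrC; apply: le_trans mean_bad.
  by apply: (@step_mean_mulr _ _ _ _ (fun g => (bad g)%:R)) => //; wbound.
rewrite all_map /bad !negbK => /andP[s0h /allP sh].
exists x, h; split; first exact: le_trans Dr s0h.
by move=> y /sh /=; rewrite negbK; exact: le_trans.
Qed.

Lemma aligned_almost_fixed_letter (s : seq G) D : aligned ->
  exists h, D <= gromov N h h /\ {in s, forall y, 0 < step W y \/ 0 < step W y^-1%g ->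
    D - 2 * N y <= gromov N (h * y)%g h}.
Proof.
move=> al; have [s0 step_s0] := exists_step_gt0 W.
pose F := [seq y <- s ++ [seq y^-1%g | y <- s] | 0 < step W y].
have [|x [h [xs0h xhF]]] := aligned_common_direction (s := F) (D + 2 * N s0) al step_s0.
  by apply/allP => y; rewrite mem_filter => /andP[].
have N0 := len_ge0 lenN.
have xh : D <= gromov N x h.
  by have := gromov_mull treeN h x s0; rewrite !(gromovC treeN _ x); lra.
have hx : D <= gromov N h x by rewrite (gromovC treeN).
have hF y : y \in F -> D <= gromov N h (h * y)%g.
  by move=> /xhF xhy; apply: (gromov_ultra treeN hx); have := N0 s0; lra.
exists h; split=> [|y ys]; first exact: (gromov_ultra treeN hx xh).
case=> step_y.
  have : y \in F by rewrite mem_filter step_y mem_cat ys.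
  by move=> /hF; rewrite (gromovC treeN); have := N0 y; lra.
have : y^-1%g \in F by rewrite mem_filter step_y mem_cat map_f ?orbT.
by move=> /hF; have := gromov_mulr treeN h (h * y^-1)%g y; rewrite mulgVK; lra.
Qed.

Lemma aligned_almost_fixed (vs : seq G) D : supp_generates (step W) -> aligned ->
  exists h, {in vs, forall v, D <= gromov N (h * v)%g h}.
Proof.
move=> gen al; have [word wordP] := choice gen; have N0 := len_ge0 lenN.
pose letters := flatten [seq word v | v <- vs].
pose K := \sum_(y <- letters) N y.
have [h [hh hletters]] := aligned_almost_fixed_letter letters (D + 4 * K) al.
exists h => v vvs; have [steps vE] := wordP v.
have word_letters : {subset word v <= letters} by move=> y yv; apply/flatten_mapP; exists v.
have word_le : \sum_(y <- word v) N y <= K.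
  rewrite /K /letters [leRHS]big_flatten /= big_map [leRHS](big_rem v)//= lerDl.
  by apply: sumr_ge0 => u _; apply: sumr_ge0.
have K0 : 0 <= K by exact: sumr_ge0.
have := @gromov_gprod _ _ N treeN h (D + 2 * K) (word v); rewrite -vE.
move=> gromov_v; apply: le_trans (gromov_v _ _); [lra|lra|] => y yv.
have yl := word_letters y yv.
have := hletters y yl (orP (allP steps y yv)).
have : N y <= K by rewrite /K (big_rem y)//= lerDl sumr_ge0.
by lra.
Qed.

End TreeWalk.

(** * Two-by-two matrices *)

Section TwoByTwo.
Variable R : realType.
Local Notation C := R[i].
Local Notation i0 := (ord0 : 'I_2).
Local Notation i1 := (ord_max : 'I_2).
Implicit Types (A B K : 'M[C]_2) (v : 'cV[C]_2) (r : 'rV[C]_2) (i j : 'I_2) (c : R).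

Lemma ord2P i : i = i0 \/ i = i1.
Proof. by case: i => [[|[|]]] //= lt_i_2; [left|right]; apply: val_inj. Qed.

Lemma sum_ord2 (T : zmodType) (F : 'I_2 -> T) : \sum_(i < 2) F i = F i0 + F i1.
Proof. by rewrite big_ord_recl big_ord1; congr (_ + F _); apply: val_inj. Qed.

Lemma mulmx2E m n (A : 'M[C]_(m, 2)) (B : 'M[C]_(2, n)) (i : 'I_m) (j : 'I_n) :
  (A *m B) i j = A i i0 * B i0 j + A i i1 * B i1 j.
Proof. by rewrite mxE sum_ord2. Qed.

Lemma det_mx22 A : \det A = A i0 i0 * A i1 i1 - A i0 i1 * A i1 i0.
Proof.
rewrite (expand_det_row _ i0) sum_ord2 /cofactor !det_mx11 !mxE /= !addn0 expr0 expr1.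
by rewrite mul1r mulN1r mulrN; congr (_ * A _ _ - _ * A _ _); apply: val_inj.
Qed.

Lemma adj_mx22 A : [/\ (\adj A) i0 i0 = A i1 i1, (\adj A) i0 i1 = - A i0 i1,
  (\adj A) i1 i0 = - A i1 i0 & (\adj A) i1 i1 = A i0 i0].
Proof.
have lift0 : lift i0 ord0 = i1 by apply: val_inj.
have lift1 : lift i1 ord0 = i0 by apply: val_inj.
split; rewrite !mxE /cofactor det_mx11 !mxE /= ?lift0 ?lift1 /= ?expr0 ?expr1 ?mul1r ?mulN1r//.
by rewrite expr2 mulrNN !mul1r.
Qed.

Lemma cV2_eq0 v : (v == 0) = (v i0 0 == 0) && (v i1 0 == 0).
Proof.
apply/eqP/andP => [->|[/eqP v0 /eqP v1]]; first by rewrite !mxE.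
by apply/matrixP => i j; rewrite ord1 mxE; case: (ord2P i) => ->.
Qed.

Lemma rV2_eq0 r : (r == 0) = (r 0 i0 == 0) && (r 0 i1 == 0).
Proof.
apply/eqP/andP => [->|[/eqP r0 /eqP r1]]; first by rewrite !mxE.
by apply/matrixP => i j; rewrite ord1 mxE; case: (ord2P j) => ->.
Qed.

Lemma opnormE A : opnorm A = Num.max (cabs (A i0 i0) + cabs (A i0 i1))
                                     (cabs (A i1 i0) + cabs (A i1 i1)).
Proof.
rewrite /opnorm; under eq_bigr do rewrite sum_ord2.
rewrite 2!big_ord_recl big_ord0.
have -> : lift ord0 ord0 = i1 by apply: val_inj.
by rewrite [X in Num.max _ X]max_l// addr_ge0// cabs_ge0.
Qed.

Lemma row_le_opnorm A i : cabs (A i i0) + cabs (A i i1) <= opnorm A.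
Proof. by rewrite opnormE le_max; case: (ord2P i) => ->; rewrite lexx ?orbT. Qed.

Lemma entry_le_opnorm A i j : cabs (A i j) <= opnorm A.
Proof.
by apply: le_trans (row_le_opnorm A i); case: (ord2P j) => ->; rewrite ?lerDl ?lerDr cabs_ge0.
Qed.

Lemma opnorm_ge0 A : 0 <= opnorm A.
Proof. exact: le_trans (cabs_ge0 _) (entry_le_opnorm A i0 i0). Qed.

Lemma opnorm_le_entry A c : (forall i j, cabs (A i j) <= c) -> opnorm A <= 2 * c.
Proof.
move=> Ac; rewrite opnormE ge_max.
by have := Ac i0 i0; have := Ac i0 i1; have := Ac i1 i0; have := Ac i1 i1; lra.
Qed.

Lemma opnorm_large_entry A : exists i j, opnorm A <= 2 * cabs (A i j).
Proof.
apply: contrapT => small; have : opnorm A < opnorm A; last by rewrite ltxx.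
have {}small i j : 2 * cabs (A i j) < opnorm A.
  by rewrite ltNge; apply/negP => ?; apply: small; exists i, j.
rewrite {1}opnormE gt_max.
by have := small i0 i0; have := small i0 i1; have := small i1 i0; have := small i1 i1; lra.
Qed.

Lemma opnormM A B : opnorm (A *m B) <= opnorm A * opnorm B.
Proof.
suff row_le i : cabs ((A *m B) i i0) + cabs ((A *m B) i i1) <= opnorm A * opnorm B.
  by rewrite {1}opnormE ge_max !row_le.
rewrite !mulmx2E; have triangle j := cabsD (A i i0 * B i0 j) (A i i1 * B i1 j).
have := triangle i0; have := triangle i1; rewrite !cabsM => t1 t0.
apply: le_trans (ler_wpM2r (opnorm_ge0 B) (row_le_opnorm A i)).
have := ler_wpM2l (cabs_ge0 (A i i0)) (row_le_opnorm B i0).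
have := ler_wpM2l (cabs_ge0 (A i i1)) (row_le_opnorm B i1); lra.
Qed.

Lemma opnormZ (a : C) A : opnorm (a *: A) = cabs a * opnorm A.
Proof.
by rewrite !opnormE !mxE !cabsM -!mulrDr maxr_pMr// cabs_ge0.
Qed.

Lemma det_le_opnorm A : cabs (\det A) <= opnorm A * opnorm A.
Proof.
rewrite det_mx22; apply: le_trans (cabsB _ _) _; rewrite !cabsM.
apply: le_trans (ler_pM _ _ (row_le_opnorm A i0) (row_le_opnorm A i1));
  rewrite ?addr_ge0 ?cabs_ge0//.
have := cabs_ge0 (A i0 i0); have := cabs_ge0 (A i0 i1).
by have := cabs_ge0 (A i1 i0); have := cabs_ge0 (A i1 i1); nra.
Qed.

Lemma opnorm_ge1 A : \det A = 1 -> 1 <= opnorm A.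
Proof.
by move=> dA; have := det_le_opnorm A; have := opnorm_ge0 A; rewrite dA cabs1; nra.
Qed.

Lemma opnorm1 : opnorm (1%:M : 'M[C]_2) = 1.
Proof.
rewrite opnormE !mxE !eqxx (_ : (i0 == i1) = false)// (_ : (i1 == i0) = false)//.
by rewrite mulr1n mulr0n cabs0 cabs1 addr0 add0r maxxx.
Qed.

Lemma opnorm_adj A : opnorm (\adj A) <= 2 * opnorm A.
Proof.
have [e1 e2 e3 e4] := adj_mx22 A; apply: opnorm_le_entry => i j.
by case: (ord2P i) => ->; case: (ord2P j) => ->;
  rewrite ?e1 ?e2 ?e3 ?e4 ?cabsN entry_le_opnorm.
Qed.

Definition vnorm v : R := Num.max (cabs (v i0 0)) (cabs (v i1 0)).

Lemma entry_le_vnorm v i : cabs (v i 0) <= vnorm v.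
Proof. by rewrite /vnorm le_max; case: (ord2P i) => ->; rewrite lexx ?orbT. Qed.

Lemma vnorm_ge0 v : 0 <= vnorm v.
Proof. exact: le_trans (cabs_ge0 _) (entry_le_vnorm v i0). Qed.

Lemma vnorm_gt0 v : v != 0 -> 0 < vnorm v.
Proof. by rewrite cV2_eq0 negb_and -!cabs_gt0 /vnorm lt_max. Qed.

Lemma vnorm0 : vnorm 0 = 0.
Proof. by rewrite /vnorm !mxE cabs0 maxxx. Qed.

Lemma vnorm_mulmx A v : vnorm (A *m v) <= opnorm A * vnorm v.
Proof.
suff entry_le i : cabs ((A *m v) i 0) <= opnorm A * vnorm v by rewrite {1}/vnorm ge_max !entry_le.
rewrite mulmx2E; apply: le_trans (cabsD _ _) _; rewrite !cabsM.
apply: le_trans (ler_wpM2r (vnorm_ge0 v) (row_le_opnorm A i)).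
by rewrite mulrDl; apply: lerD; rewrite ler_wpM2l ?cabs_ge0// entry_le_vnorm.
Qed.

Definition wedge (r s : 'rV[C]_2) : C := r 0 i0 * s 0 i1 - r 0 i1 * s 0 i0.

Lemma mul_adj_wedge A B i j :
  (A *m \adj B) i j = if j == i0 then wedge (row i A) (row i1 B) else wedge (row i0 B) (row i A).
Proof.
have [e1 e2 e3 e4] := adj_mx22 B.
by rewrite mulmx2E; case: (ord2P j) => ->;
  rewrite ?e1 ?e2 ?e3 ?e4 /wedge !mxE /=; ring.
Qed.

Lemma wedgeC r (s : 'rV[C]_2) : wedge s r = - wedge r s.
Proof. by rewrite /wedge; ring. Qed.

Lemma cabs_wedge_row_le A B i j : cabs (wedge (row i A) (row j B)) <= opnorm (A *m \adj B).
Proof.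
case: (ord2P j) => ->.
  by have := entry_le_opnorm (A *m \adj B) i i1; rewrite mul_adj_wedge /= wedgeC cabsN.
by have := entry_le_opnorm (A *m \adj B) i i0; rewrite mul_adj_wedge.
Qed.

Lemma opnorm_large_wedge A B : exists i j,
  opnorm (A *m \adj B) <= 2 * cabs (wedge (row i A) (row j B)).
Proof.
have [i [j large]] := opnorm_large_entry (A *m \adj B).
case: (ord2P j) large => ->; rewrite mul_adj_wedge /=; first by exists i, i1.
by rewrite wedgeC cabsN; exists i, i0.
Qed.

Lemma opnorm_pluecker A B K : opnorm (A *m \adj K) * opnorm B <=
  4 * (opnorm (A *m \adj B) * opnorm K + opnorm A * opnorm (B *m \adj K)).
Proof.
have [i [j AK]] := opnorm_large_wedge A K; have [k [n Bkn]] := opnorm_large_entry B.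
have pluecker : wedge (row i A) (row j K) * B k n =
    wedge (row i A) (row k B) * K j n + A i n * wedge (row k B) (row j K).
  by rewrite /wedge !mxE; case: (ord2P n) => ->; ring.
have : cabs (wedge (row i A) (row j K)) * cabs (B k n) <=
    opnorm (A *m \adj B) * opnorm K + opnorm A * opnorm (B *m \adj K).
  rewrite -cabsM pluecker; apply: le_trans (cabsD _ _) _; rewrite !cabsM.
  by apply: lerD; apply: ler_pM; rewrite ?cabs_ge0 ?cabs_wedge_row_le ?entry_le_opnorm.
move=> bound; apply: le_trans (ler_pM (opnorm_ge0 _) (opnorm_ge0 _) AK Bkn) _.
by rewrite mulrACA -natrM ler_pM2l.
Qed.

(* Two matrices that both contract [v] have nearly parallel rows. *)
Lemma opnorm_mul_adj_vnorm A B v : vnorm v * opnorm (A *m \adj B) <=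
  2 * (vnorm (A *m v) * opnorm B + vnorm (B *m v) * opnorm A).
Proof.
have [i [j AB]] := opnorm_large_wedge A B; have [a ra] : exists a, vnorm v = cabs (v a 0).
  by rewrite /vnorm; case: (leP (cabs (v i0 0)) (cabs (v i1 0))); [exists i1|exists i0].
apply: le_trans (ler_wpM2l (vnorm_ge0 v) AB) _; rewrite mulrCA ler_pM2l// ra -cabsM.
have [b wedge_v] : exists b, cabs (v a 0 * wedge (row i A) (row j B)) =
    cabs ((A *m v) i 0 * B j b - (B *m v) j 0 * A i b).
  case: (ord2P a) => ->; [exists i1|exists i0; rewrite -[RHS]cabsN];
  by congr cabs; rewrite /wedge !mulmx2E !mxE; ring.
rewrite wedge_v; apply: le_trans (cabsB _ _) _; rewrite !cabsM.
by apply: lerD; apply: ler_pM; rewrite ?cabs_ge0 ?entry_le_vnorm ?entry_le_opnorm.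
Qed.

Lemma opnorm_mul_adj_stretch A B v (x y z : R) : v != 0 ->
  vnorm (A *m v) = vnorm v * x -> vnorm (B *m v) = vnorm v * y ->
  x * opnorm B <= z -> y * opnorm A <= z -> opnorm (A *m \adj B) <= 4 * z.
Proof.
move=> /vnorm_gt0 v0 Av Bv xz yz; have := opnorm_mul_adj_vnorm A B v.
rewrite Av Bv -!mulrA -mulrDr mulrCA ler_pM2l// => parallel.
apply: le_trans parallel _; lra.
Qed.

Lemma unimodular_row r : r != 0 -> exists U (m : C),
  [/\ \det U = 1, opnorm U <= 2, r = m *: row i0 U & forall j, cabs (r 0 j) <= cabs m].
Proof.
rewrite rV2_eq0 negb_and; set p := r 0 i0; set q := r 0 i1 => r0.
have unimodular (m a b c d : C) : m != 0 -> a * d - b * c = 1 -> cabs a <= 1 -> cabs b <= 1 ->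
    cabs c <= 1 -> cabs d <= 1 -> p = m * a -> q = m * b -> exists U (m' : C),
  [/\ \det U = 1, opnorm U <= 2, r = m' *: row i0 U & forall j, cabs (r 0 j) <= cabs m'].
  move=> m0 D a1 b1 c1 d1 pE qE.
  pose U : 'M[C]_2 := \matrix_(i, j) if i == i0 then (if j == i0 then a else b)
                                     else (if j == i0 then c else d).
  exists U, m; split; first by rewrite det_mx22 !mxE.
  - rewrite -[leRHS]mulr1; apply: opnorm_le_entry => i j.
    by case: (ord2P i) => ->; case: (ord2P j) => ->; rewrite !mxE.
  - apply/matrixP => i j; rewrite ord1 !mxE.
    by case: (ord2P j) => -> /=.
  - move=> j; case: (ord2P j) => ->; rewrite -?/p -?/q ?pE ?qE cabsM ler_piMr ?cabs_ge0//.
have [qp|pq] := leP (cabs q) (cabs p).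
  have p0 : p != 0.
    by move: r0; case: (eqVneq p 0) qp => // ->; rewrite cabs0 -cabs_gt0 leNgt => /negbTE ->.
  apply: (unimodular p 1 (q / p) 0 1); rewrite ?cabs0 ?cabs1 ?ler01//.
  - by ring.
  - by rewrite cabsM cabsV ler_pdivrMr ?cabs_gt0// mul1r.
  - by rewrite mulr1.
  - by rewrite mulrC divfK.
have q0 : q != 0 by rewrite -cabs_gt0; apply: le_lt_trans pq; exact: cabs_ge0.
apply: (unimodular q (p / q) 1 (- 1) 0); rewrite ?cabs0 ?cabsN ?cabs1 ?ler01//.
- by ring.
- by rewrite cabsM cabsV ler_pdivrMr ?cabs_gt0// mul1r ltW.
- by rewrite mulrC divfK.
- by rewrite mulr1.
Qed.

End TwoByTwo.

Section Conjugation.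
Variable R : realType.
Local Notation C := R[i].
Local Notation i0 := (ord0 : 'I_2).
Local Notation i1 := (ord_max : 'I_2).
Implicit Types (A B U V W : 'M[C]_2) (r s : 'rV[C]_2) (la mu : C).

Definition conj_mx U A := U *m A *m \adj U.

Lemma mulmx_adj1 U : \det U = 1 -> U *m \adj U = 1%:M.
Proof. by rewrite mul_mx_adj => ->. Qed.

Lemma mul_adjmx1 U : \det U = 1 -> \adj U *m U = 1%:M.
Proof. by rewrite mul_adj_mx => ->. Qed.

Lemma conj_mxM U A B : \det U = 1 -> conj_mx U (A *m B) = conj_mx U A *m conj_mx U B.
Proof.
move=> dU; rewrite /conj_mx !mulmxA -(mulmxA (U *m A) (\adj U) U).
by rewrite (mul_adjmx1 dU) mulmx1.
Qed.

Lemma det_conj_mx U A : \det U = 1 -> \det (conj_mx U A) = \det A.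
Proof.
move=> dU; have dUU : \det U * \det (\adj U) = 1 by rewrite -det_mulmx mulmx_adj1// det1.
by rewrite !det_mulmx mulrAC dUU mul1r.
Qed.

Lemma opnorm_mulmx3 A B V a c : opnorm A <= a -> opnorm V <= c ->
  opnorm (A *m B *m V) <= a * c * opnorm B.
Proof.
move=> Aa Vc; apply: le_trans (opnormM _ _) _; rewrite mulrAC.
apply: ler_pM; rewrite ?opnorm_ge0//; apply: le_trans (opnormM _ _) _.
by apply: ler_pM; rewrite ?opnorm_ge0.
Qed.

Lemma opnorm_adj_le4 U : opnorm U <= 2 -> opnorm (\adj U) <= 4.
Proof. by have := opnorm_adj U; lra. Qed.

Lemma opnorm_conj_le U A : opnorm U <= 2 -> opnorm (conj_mx U A) <= 8 * opnorm A.
Proof.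
move=> U2; apply: le_trans (opnorm_mulmx3 A U2 (opnorm_adj_le4 U2)) _.
by rewrite -natrM.
Qed.

Lemma opnorm_le_conj U A : \det U = 1 -> opnorm U <= 2 -> opnorm A <= 8 * opnorm (conj_mx U A).
Proof.
move=> dU U2; have {1}-> : A = \adj U *m conj_mx U A *m U.
  by rewrite /conj_mx -!mulmxA mul_adjmx1// mulmx1 mulmxA mul_adjmx1// mul1mx.
by apply: le_trans (opnorm_mulmx3 _ (opnorm_adj_le4 U2) U2) _; rewrite -natrM.
Qed.

Lemma wedgeZ la mu r s : wedge (la *: r) (mu *: s) = la * mu * wedge r s.
Proof. by rewrite /wedge !mxE; ring. Qed.

Lemma wedge_eq0 r s : r != 0 -> (wedge r s == 0) = (s <= r)%MS.
Proof.
move=> r0; apply/eqP/sub_rVP => [|[la ->]]; last by rewrite /wedge !mxE; ring.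
have [p0|p0] := eqVneq (r 0 i0) 0.
  have q0 : r 0 i1 != 0 by move: r0; rewrite rV2_eq0 p0 eqxx.
  rewrite /wedge p0 mul0r sub0r => /eqP; rewrite oppr_eq0 mulf_eq0 (negbTE q0) /= => /eqP s0.
  exists (s 0 i1 / r 0 i1); apply/matrixP => i j; rewrite ord1 !mxE.
  by case: (ord2P j) => ->; rewrite ?s0 ?p0 ?mulr0// divfK.
rewrite /wedge => /eqP; rewrite subr_eq0 => /eqP rs.
exists (s 0 i0 / r 0 i0); apply/matrixP => i j; rewrite ord1 !mxE.
case: (ord2P j) => ->; first by rewrite divfK.
by apply: (mulfI p0); rewrite rs; field.
Qed.

Lemma conj_mx01 U A : (conj_mx U A) i0 i1 = wedge (row i0 U) (row i0 U *m A).
Proof. by rewrite mul_adj_wedge /= row_mul. Qed.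

Definition detcomm V W := \det (V *m W - W *m V).

Lemma detcommE V W : detcomm V W =
  - (V i0 i1 * W i1 i0 - V i1 i0 * W i0 i1) ^+ 2 -
  ((V i0 i0 - V i1 i1) * W i0 i1 - (W i0 i0 - W i1 i1) * V i0 i1) *
  ((W i0 i0 - W i1 i1) * V i1 i0 - (V i0 i0 - V i1 i1) * W i1 i0).
Proof.
have entry (i j : 'I_2) : (V *m W - W *m V) i j =
    V i i0 * W i0 j + V i i1 * W i1 j - (W i i0 * V i0 j + W i i1 * V i1 j).
  by rewrite mxE mulmx2E; congr (_ + _); rewrite mxE mulmx2E.
by rewrite /detcomm det_mx22 !entry; ring.
Qed.

Lemma detcomm_conj U V W : \det U = 1 -> detcomm (conj_mx U V) (conj_mx U W) = detcomm V W.
Proof.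
move=> dU; rewrite /detcomm -!conj_mxM// -[RHS](det_conj_mx _ dU); congr (\det _).
by rewrite /conj_mx mulmxBr mulmxBl.
Qed.

Lemma detcommZ la mu V W : detcomm (la *: V) (mu *: W) = (la * mu) ^+ 2 * detcomm V W.
Proof. by rewrite !detcommE !mxE; ring. Qed.

Lemma detcomm_le V W : cabs (detcomm V W) <= 10 * (opnorm V * opnorm W) *
  (opnorm W * cabs (V i0 i1) + opnorm V * cabs (W i0 i1)).
Proof.
rewrite detcommE; have entry_bd (X : 'M[C]_2) i j := entry_le_opnorm X i j.
set s := opnorm W * _ + _; have diag (X : 'M[C]_2) : cabs (X i0 i0 - X i1 i1) <= 2 * opnorm X.
  by apply: le_trans (cabsB _ _) _; have := entry_bd X i0 i0; have := entry_bd X i1 i1; lra.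
have prodB (a b c d : C) x y z t : cabs a <= x -> cabs b <= y -> cabs c <= z -> cabs d <= t ->
    cabs (a * b - c * d) <= x * y + z * t.
  move=> ax byy cz dt; apply: le_trans (cabsB _ _) _; rewrite !cabsM.
  by apply: lerD; apply: ler_pM; rewrite ?cabs_ge0.
have x_le := prodB _ _ _ _ _ _ _ _ (lexx (cabs (V i0 i1))) (entry_bd W i1 i0) (entry_bd V i1 i0)
  (lexx (cabs (W i0 i1))).
have x_le' := prodB _ _ _ _ _ _ _ _ (entry_bd V i0 i1) (entry_bd W i1 i0) (entry_bd V i1 i0)
  (entry_bd W i0 i1).
have y_le := prodB _ _ _ _ _ _ _ _ (diag V) (lexx (cabs (W i0 i1))) (diag W)
  (lexx (cabs (V i0 i1))).
have z_le := prodB _ _ _ _ _ _ _ _ (diag W) (entry_bd V i1 i0) (diag V) (entry_bd W i1 i0).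
apply: le_trans (cabsB _ _) _; rewrite cabsN expr2 !cabsM.
apply: le_trans (lerD (ler_pM (cabs_ge0 _) (cabs_ge0 _) x_le x_le')
  (ler_pM (cabs_ge0 _) (cabs_ge0 _) y_le z_le)) _.
rewrite le_eqVlt; apply/orP; left; apply/eqP; rewrite /s; ring.
Qed.

Lemma commutator_monotone (x v h a b v' h' a' b' : R) : 0 <= v -> 0 <= h -> 0 <= a -> 0 <= b ->
  v <= 8 * v' -> h <= 8 * h' -> x ^+ 2 * a <= a' -> x ^+ 2 * b <= b' ->
  4 * x ^+ 2 * (10 * (v * h) * (h * a + v * b)) <= 40 * 8 ^+ 3 * (v' * h') * (h' * a' + v' * b').
Proof.
move=> v0 h0 a0 b0 vv hh aa bb.
have -> : 4 * x ^+ 2 * (10 * (v * h) * (h * a + v * b)) =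
    40 * (v * h * (h * (x ^+ 2 * a) + v * (x ^+ 2 * b))) by ring.
have -> : 40 * 8 ^+ 3 * (v' * h') * (h' * a' + v' * b') =
    40 * (8 * v' * (8 * h') * (8 * h' * a' + 8 * v' * b')) by ring.
have x0 : 0 <= x ^+ 2 by exact: sqr_ge0.
rewrite ler_pM2l//; apply: ler_pM; [exact: mulr_ge0| |exact: ler_pM|].
  by apply: addr_ge0; apply: mulr_ge0 => //; exact: mulr_ge0.
by apply: lerD; apply: ler_pM => //; exact: mulr_ge0.
Qed.

(* In a basis whose first vector is a large row of [A], the upper right entry of [V]
   is bounded by [A V A^-1]. *)
Lemma opnorm_conj_detcomm A V W : 0 < opnorm A -> opnorm A ^+ 2 * cabs (detcomm V W) <=
  40 * 8 ^+ 3 * (opnorm V * opnorm W) *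
  (opnorm W * opnorm (A *m V *m \adj A) + opnorm V * opnorm (A *m W *m \adj A)).
Proof.
move=> A0; have [i [j Aij]] := opnorm_large_entry A.
have r0 : row i A != 0.
  apply: contraTneq A0 => /matrixP/(_ 0 j); rewrite !mxE => Aij0.
  by move: Aij; rewrite Aij0 cabs0 mulr0 leNgt.
have [U [m [dU U2 rE rm]]] := unimodular_row r0.
have Am : opnorm A ^+ 2 <= 4 * cabs m ^+ 2.
  have := rm j; rewrite mxE => mij; have := opnorm_ge0 A; nra.
have entry_le X : cabs m ^+ 2 * cabs ((conj_mx U X) i0 i1) <= opnorm (A *m X *m \adj A).
  have := cabs_wedge_row_le (A *m X) A i i.
  by rewrite row_mul rE -scalemxAl wedgeZ wedgeC conj_mx01 mulrN cabsN !cabsM expr2.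
rewrite -(detcomm_conj V W dU).
apply: le_trans (ler_pM (exprn_ge0 2 (ltW A0)) (cabs_ge0 _) Am (detcomm_le _ _)) _.
apply: commutator_monotone (opnorm_conj_le V U2) (opnorm_conj_le W U2) (entry_le V) (entry_le W);
  by rewrite ?opnorm_ge0 ?cabs_ge0.
Qed.

Lemma opnorm_mul_triangular A B : A i0 i1 = 0 -> B i0 i1 = 0 -> \det A = 1 ->
  opnorm (A *m B) <= opnorm A * cabs (B i0 i0) + opnorm B / cabs (A i0 i0).
Proof.
move=> A01 B01; rewrite det_mx22 A01 mul0r subr0 => dA.
have A00 : A i0 i0 != 0 by apply: contraTneq (oner_neq0 C) => A00; rewrite -dA A00 mul0r eqxx.
have A11 : cabs (A i1 i1) = (cabs (A i0 i0))^-1 by rewrite -cabsV -(mulKf A00 (A i1 i1)) dA mulr1.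
have ib : 0 <= opnorm B / cabs (A i0 i0) by rewrite divr_ge0 ?opnorm_ge0 ?cabs_ge0.
have entry i : cabs (A i i0) * cabs (B i0 i0) <= opnorm A * cabs (B i0 i0).
  by rewrite ler_wpM2r ?cabs_ge0 ?entry_le_opnorm.
rewrite opnormE !mulmx2E A01 B01 !mulr0 !mul0r !addr0 add0r !cabsM cabs0 addr0 ge_max.
apply/andP; split; first by rewrite ler_wpDr.
apply: le_trans (lerD (cabsD _ _) (lexx _)) _; rewrite !cabsM A11 -addrA -mulrDr [_^-1 * _]mulrC.
by apply: lerD => //; rewrite ler_wpM2r ?invr_ge0 ?cabs_ge0 ?row_le_opnorm.
Qed.

Lemma conj_mx_eigenrow U A la : \det U = 1 -> row i0 U *m A = la *: row i0 U ->
  conj_mx U A i0 i0 = la /\ conj_mx U A i0 i1 = 0.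
Proof.
move=> dU rA; have row_conj : row i0 (conj_mx U A) = la *: row i0 1%:M.
  by rewrite /conj_mx !row_mul rA -scalemxAl -row_mul mulmx_adj1.
by split; [have := congr1 (fun s => s 0 i0) row_conj|have := congr1 (fun s => s 0 i1) row_conj];
  rewrite !mxE /= ?mulr1 ?mulr0.
Qed.

Lemma eigenrow_scale A r la mu : la != 0 -> (la *: r) *m A = mu *: (la *: r) ->
  r *m A = mu *: r.
Proof. by move=> la0; rewrite -scalemxAl scalerA mulrC -scalerA => /(scalerI la0). Qed.

Lemma opnorm_mul_common_row A B r la mu : r != 0 -> \det A = 1 ->
  r *m A = la *: r -> r *m B = mu *: r ->
  opnorm (A *m B) <= 64 * (opnorm A * cabs mu + opnorm B / cabs la).
Proof.
move=> r0 dA rA rB; have [U [m [dU U2 rE _]]] := unimodular_row r0.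
have m0 : m != 0 by apply: contraNneq r0 => m0; rewrite rE m0 scale0r.
rewrite rE in rA rB.
have [A00 A01] := conj_mx_eigenrow dU (eigenrow_scale m0 rA).
have [B00 B01] := conj_mx_eigenrow dU (eigenrow_scale m0 rB).
have dA' : \det (conj_mx U A) = 1 by rewrite det_conj_mx.
have := opnorm_mul_triangular A01 B01 dA'; rewrite A00 B00 -conj_mxM// => product_le.
have A_le : opnorm (conj_mx U A) * cabs mu <= 8 * (opnorm A * cabs mu).
  by rewrite mulrA; apply: ler_wpM2r; [exact: cabs_ge0|exact: opnorm_conj_le].
have B_le : opnorm (conj_mx U B) / cabs la <= 8 * (opnorm B / cabs la).
  by rewrite mulrA; apply: ler_wpM2r; [rewrite invr_ge0 cabs_ge0|exact: opnorm_conj_le].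
apply: le_trans (opnorm_le_conj _ dU U2) _.
rewrite -[64]/(8 * 8)%:R natrM -mulrA ler_pM2l// mulrDr.
exact: le_trans product_le (lerD A_le B_le).
Qed.

Lemma cabs_eigenrow_le A r la : r != 0 -> r *m A = la *: r -> cabs la <= 8 * opnorm A.
Proof.
move=> r0 rA; have [U [m [dU U2 rE _]]] := unimodular_row r0.
have m0 : m != 0 by apply: contraNneq r0 => m0; rewrite rE m0 scale0r.
rewrite rE in rA; have [<- _] := conj_mx_eigenrow dU (eigenrow_scale m0 rA).
exact: le_trans (entry_le_opnorm _ _ _) (opnorm_conj_le A U2).
Qed.

Lemma detcomm_triangular V W : V i0 i1 = 0 -> detcomm V W =
  - W i0 i1 * wedge (row i1 V - row i1 (V i0 i0)%:M) ((row i1 V - row i1 (V i0 i0)%:M) *m W).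
Proof. by move=> V01; rewrite detcommE V01 /wedge !mulmx2E !mxE /= ?mulr1n ?mulr0n; ring. Qed.

(* In a basis where [A] is lower triangular the determinant of the commutator factors,
   each factor vanishing exactly when [B] preserves one eigenline of [A]. *)
Lemma detcomm_eq0_stable A : ~~ is_scalar_mx A -> exists r s, [/\ r != 0, s != 0 &
  forall B, detcomm A B = 0 -> stablemx r B \/ stablemx s B].
Proof.
move=> nsA; have [a /eigenvalueP[r rA r0]] := eigenvalue_closed A isT.
have [U [m [dU _ rE _]]] := unimodular_row r0.
have m0 : m != 0 by apply: contraNneq r0 => m0; rewrite rE m0 scale0r.
rewrite rE in rA; have [T00 T01] := conj_mx_eigenrow dU (eigenrow_scale m0 rA).
set T := conj_mx U A in T00 T01; pose s := row i1 T - row i1 (T i0 i0)%:M.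
have U0 : row i0 U != 0 by apply: contraNneq r0 => U0; rewrite rE U0 scaler0.
have s0 : s != 0.
  apply: contraNneq nsA => /subr0_eq row1.
  have [T10 T11] : T i1 i0 = 0 /\ T i1 i1 = T i0 i0.
    by split; [have := congr1 (fun v : 'rV_2 => v 0 i0) row1|
               have := congr1 (fun v : 'rV_2 => v 0 i1) row1];
      rewrite !mxE /= ?mulr0n ?mulr1n.
  have TE : T = (T i0 i0)%:M.
    apply/matrixP => i j; rewrite [RHS]mxE.
    by case: (ord2P i) => ->; case: (ord2P j) => -> /=; rewrite ?mulr0n ?mulr1n.
  have -> : A = (T i0 i0)%:M; last exact: scalar_mx_is_scalar.
  rewrite -[LHS]mul1mx -(mul_adjmx1 dU) -[LHS]mulmx1 -(mul_adjmx1 dU).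
  rewrite (_ : _ *m (_ *m _) = \adj U *m T *m U); last by rewrite /T /conj_mx !mulmxA.
  by rewrite {1}TE mul_mx_scalar -scalemxAl (mul_adjmx1 dU) scalemx1.
exists (row i0 U), (s *m U); split=> // [|B].
  by apply: contraNneq s0 => sU; rewrite -[s]mulmx1 -(mulmx_adj1 dU) mulmxA sU mul0mx.
rewrite -(detcomm_conj A B dU) -/T (detcomm_triangular _ T01) => /eqP.
rewrite mulf_eq0 oppr_eq0 conj_mx01 => /orP[]; rewrite wedge_eq0//; first by left.
move=> /sub_rVP[mu sB]; right; apply/sub_rVP; exists mu.
by rewrite scalemxAl -sB /conj_mx -!mulmxA (mul_adjmx1 dU) mulmx1.
Qed.

End Conjugation.

(** * Drifts of converging lengths *)

Section NormCharacter.
Variables (R : realType) (G : groupType).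
Implicit Types (L phi : G -> R) (g h : G) (c : R).

(* Modelled on the logarithm of the eigenvalue on a common eigenline of matrices [M g],
   for [L g := ln (opnorm (M g))]. *)
Record norm_character L c phi : Prop := NormCharacter {
  characterM : forall g h, phi (g * h)%g = phi g + phi h;
  character_le : forall g, `|phi g| <= L g + c;
  character_prod : forall g h, L (g * h)%g <= Num.max (L g + phi h) (L h - phi g) + c }.

(* Modelled on [psi v g := ln (vnorm (M g *m v) / vnorm v)]. *)
Record norm_cocycle L c (V : Type) (act : G -> V -> V) (psi : V -> G -> R) : Prop :=
  NormCocycle {
  cocycle1 : forall v, psi v 1%g = 0;
  cocycleM : forall v g h, psi v (g * h)%g = psi (act h v) g + psi v h;
  cocycle_le : forall v g, psi v g <= L g;
  cocycle_ge : forall v g, - (L g + c) <= psi v g;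
  cocycle_pair : forall v g h x, x <= L g - psi v g -> x <= L h - psi v h ->
    x <= gromov L g h + c }.

End NormCharacter.

Section CharacterDrift.
Variables (R : realType) (G : groupType) (W : walk R G).
Local Notation mean := (mean W).
Local Notation drift := (drift W).
Implicit Types (phi L : G -> R) (n : nat) (c d : R).

Lemma mean_dist_morphism_small C d : 0 < d -> exists n0 : nat, forall n phi, (n0 <= n)%N ->
  dominated W C phi -> (forall g h, phi (g * h)%g = phi g + phi h) ->
  mean n (fun g => `|phi g - n%:R * mean 1 phi|) <= d * n%:R.
Proof.
move=> d0; have d2 : 0 < d / 2 by rewrite divr_gt0.
have [n0 excess] := mean_excess_small W C 1 d2.
exists n0 => n phi hn phiC phiM; have bphi := dominated_wbounded phiC.
have := excess n phi hn phiC (morphism_subadditive phiM).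
have phiNC : dominated W C (fun g => - phi g) by move=> g; rewrite normrN.
have phiNM g h : - phi (g * h)%g = - phi g + - phi h by rewrite phiM opprD.
have := excess n _ hn phiNC (morphism_subadditive phiNM).
rewrite muln1 (meanN _ bphi) => excessN excessP.
have norm_max (x : R) : `|x| = Num.max x 0 + Num.max (- x) 0.
  by case: (leP x 0) => x0; case: (leP (- x) 0) => y0;
     [rewrite ler0_norm//|rewrite ler0_norm//|rewrite gtr0_norm//|rewrite gtr0_norm//]; lra.
under eq_fun do rewrite norm_max opprB addrC.
rewrite meanD; [|wbound|wbound].
under eq_fun do rewrite addrC -[n%:R * _]opprK -mulrN; lra.
Qed.

Lemma norm_character_drift L c phi : is_length L -> wbounded W L -> norm_character L c phi ->
  wbounded W phi -> `|mean 1 phi| <= drift L.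
Proof.
move=> lenL bL chi bphi; have phi_le := character_le chi.
apply/ler_addgt0Pr => e e0.
pose n := (Num.truncn (c / e)).+1.
have cn : c <= n%:R * e by rewrite -ler_pdivrMr//; exact: ltW (truncnS_gt _).
rewrite -lerBlDr; apply: (drift_lower_bound (n := n) lenL bL) => // k.
have [->|k0] := posnP k; first by rewrite mul0r mul0n /= (len1 lenL).
have mean_le : (k * n)%:R * `|mean 1 phi| <= mean (k * n) L + c.
  rewrite -[_%:R]ger0_norm// -normrM -mean_hom//; last exact: characterM chi.
  apply: le_trans (norm_mean_le_mean _ bphi) _.
  rewrite -[c in leRHS](mean_cst W (k * n)) -meanD; [|wbound|wbound].
  by apply: le_mean => //; wbound.
have ck : c <= k%:R * n%:R * e.
  apply: le_trans cn _; rewrite -mulrA ler_peMl ?ler1n//.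
  by rewrite mulr_ge0// ltW.
by move: mean_le; rewrite natrM; lra.
Qed.

Lemma norm_character_drift_ge L c phi n (l d : R) : is_length L -> wbounded W L ->
  norm_character L c phi -> wbounded W phi -> (0 < n)%N -> c <= d * n%:R ->
  mean n (fun g => `|L g - n%:R * l|) <= d * n%:R ->
  mean n (fun g => `|phi g - n%:R * mean 1 phi|) <= d * n%:R ->
  (2 * l - d) * n%:R <= mean (n + n) L -> l - 6 * d <= drift L.
Proof.
move=> lenL bL chi bphi n0 cn L_near phi_near low.
apply: le_trans (norm_character_drift lenL bL chi bphi); set a := mean 1 phi in phi_near *.
pose p g := `|L g - n%:R * l| + `|phi g - n%:R * a|.
have bp : wbounded W p by rewrite /p; wbound.
have mean_p : mean n p <= 2 * d * n%:R by rewrite /p meanD; [lra|wbound|wbound].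
have nR : 0 < n%:R :> R by rewrite ltr0n.
suff : mean (n + n) L <= n%:R * l + n%:R * `|a| + c + 2 * mean n p.
  by move=> up; rewrite -(ler_pM2l nR); lra.
rewrite -mean2_mul; apply: le_trans (_ : mean2 W n (fun g h =>
    (n%:R * l + n%:R * `|a| + c) + (p g + p h)) <= _); last first.
  have bpp : wbounded2 W (fun g h => p g + p h) by wbound.
  rewrite mean2D; [|wbound|exact: bpp]; rewrite [X in X + _]mean2_fst mean_cst.
  by rewrite mean2D ?mean2_fst ?mean2_snd; [lra|wbound|wbound].
apply: le_mean2 => [||g h]; [wbound|by rewrite /p; wbound|].
apply: le_trans (character_prod chi g h) _; rewrite -lerBrDr ge_max /p.
have := ler_norm (L g - n%:R * l); have := ler_norm (L h - n%:R * l).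
have := normr_ge0 (L g - n%:R * l); have := normr_ge0 (L h - n%:R * l).
have := ler_norm (phi h - n%:R * a); have := ler_norm (- (phi g - n%:R * a)); rewrite normrN.
have := normr_ge0 (phi g - n%:R * a); have := normr_ge0 (phi h - n%:R * a).
have : n%:R * a <= n%:R * `|a| by rewrite ler_pM2l// ler_norm.
have : - (n%:R * a) <= n%:R * `|a| by rewrite -mulrN ler_pM2l// -normrN ler_norm.
by move=> ? ? ? ? ? ? ? ? ? ?; apply/andP; split; lra.
Qed.

End CharacterDrift.

Section CocycleDrift.
Variables (R : realType) (G : groupType) (W : walk R G) (L : G -> R) (c : R).
Variables (V : Type) (act : G -> V -> V) (psi : V -> G -> R).
Local Notation mean := (mean W).
Local Notation mean2 := (mean2 W).
Hypothesis lenL : is_length L.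
Hypothesis bL : wbounded W L.
Hypothesis cocycle : norm_cocycle L c act psi.
Implicit Types (v : V) (n k : nat) (a eta : R).

Lemma wbounded_cocycle v : wbounded W (psi v).
Proof.
have L0 := len_ge0 lenL.
apply: (@wbounded_le _ _ _ _ (fun g => L g + `|c|)); last wbound.
move=> g; have := cocycle_le cocycle v g; have := cocycle_ge cocycle v g.
by have := ler_norm c; rewrite ler_norml; have := normr_ge0 c; lra.
Qed.

Lemma cocycle_drift_ge v n a : (0 < n)%N -> (forall u, n%:R * a <= mean n (psi u)) ->
  a <= drift W L.
Proof.
move=> n0 low; have bpsi := wbounded_cocycle.
suff iter k u : k%:R * (n%:R * a) <= mean (k * n) (psi u).
  apply: (drift_lower_bound lenL bL n0) => k; apply: le_trans (iter k v) _.
  by apply: le_mean => [||g]; [exact: bpsi|exact: bL|exact: cocycle_le cocycle _ _].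
elim: k u => [|k IH] u; first by rewrite mul0r mul0n /= (cocycle1 cocycle).
rewrite mulSn addnC mean_add -natr1 mulrDl mul1r.
apply: le_trans (_ : mean n (fun h => k%:R * (n%:R * a) + psi u h) <= _).
  by rewrite meanD ?mean_cst; [rewrite lerD2l; exact: low|wbound|exact: bpsi].
apply: le_mean => [||h]; [wbound|exact: (wbounded_mean_mulr (k * n) (bpsi u))|].
under eq_fun do rewrite (cocycleM cocycle).
by rewrite meanD ?mean_cst; [rewrite lerD2r; exact: IH|exact: bpsi|wbound].
Qed.

Lemma cocycle_defect_le v g : L g - psi v g <= 2 * L g + c.
Proof. by have := cocycle_ge cocycle v g; lra. Qed.

Variable N : G -> R.

Lemma cocycle_defect_mass v n a eta : 0 < a -> c <= a ->
  wbounded2 W (fun g h => `|gromov L g h - gromov N g h|) ->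
  mean2 n (fun g h => (a <= gromov N g h)%R%:R) <= eta ->
  mean2 n (fun g h => `|gromov L g h - gromov N g h|) <= eta * a ->
  mean n (fun g => (3 * a <= L g - psi v g)%R%:R) ^+ 2 <= 2 * eta.
Proof.
move=> a0 ca bD low near; rewrite expr2 -mean2_prod; [|wbound|wbound].
under eq_fun do under eq_fun do rewrite -natrM mulnb.
apply: le_trans (mean2_markov (Q := fun g h => a <= gromov N g h) n a0 bD _ _) _ => //.
  move=> g h /andP[Xg Xh]; rewrite -ltNge => gN.
  have := cocycle_pair cocycle Xg Xh.
  by have := ler_norm (gromov L g h - gromov N g h); lra.
have : mean2 n (fun g h => `|gromov L g h - gromov N g h|) / a <= eta by rewrite ler_pdivrMr.
lra.
Qed.

Lemma cocycle_mean_ge v n a (l d k : R) : 0 <= a -> 0 <= 2 * n%:R * l + c ->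
  mean n (fun g => `|L g - n%:R * l|) <= d * n%:R ->
  mean n (fun g => (a <= L g - psi v g)%R%:R) <= k ->
  n%:R * l - (a + (2 * n%:R * l + c) * k + 3 * (d * n%:R)) <= mean n (psi v).
Proof.
move=> a0 c0 L_near mass_le; have bpsi := wbounded_cocycle v.
have defect g : L g - psi v g <= a + (2 * n%:R * l + c) * (a <= L g - psi v g)%R%:R +
    2 * `|L g - n%:R * l|.
  have := normr_ge0 (L g - n%:R * l).
  have [_|] := leP a (L g - psi v g); last by rewrite mulr0; lra.
  by have := cocycle_defect_le v g; have := ler_norm (L g - n%:R * l); rewrite mulr1; lra.
have mean_defect : mean n (fun g => L g - psi v g) <=
    a + (2 * n%:R * l + c) * k + 2 * (d * n%:R).
  apply: le_trans (_ : mean n (fun g => a +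
      (2 * n%:R * l + c) * (a <= L g - psi v g)%R%:R + 2 * `|L g - n%:R * l|) <= _).
    by apply: le_mean => //; wbound.
  rewrite meanD ?meanD ?meanZ ?mean_cst; try wbound.
  by have := ler_wpM2l c0 mass_le; lra.
have : n%:R * l <= mean n L + d * n%:R.
  rewrite addrC -lerBlDr; apply: le_trans L_near.
  rewrite -[X in X - _](mean_cst W n) -meanB; [|wbound|wbound].
  apply: le_mean => [||g]; [wbound|wbound|].
  by have := ler_norm (- (L g - n%:R * l)); rewrite normrN; lra.
have : mean n (psi v) = mean n L - mean n (fun g => L g - psi v g).
  by rewrite -meanB; [congr mean; apply/funext => g; ring|wbound|wbound].
by lra.
Qed.

End CocycleDrift.

Lemma cvg_max (R : realType) (I : Type) (F : set_system I) (FF : Filter F)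
    (f k : I -> R) (a b : R) : f i @[i --> F] --> a -> k i @[i --> F] --> b ->
  Num.max (f i) (k i) @[i --> F] --> Num.max a b.
Proof.
have maxE (x y : R) : Num.max x y = (x + y + `|x - y|) / 2.
  by case: (leP x y) => xy; [rewrite ler0_norm ?subr_le0//|rewrite gtr0_norm ?subr_gt0//]; lra.
move=> fa kb; under eq_fun do rewrite maxE; rewrite maxE.
by apply: cvgMl; apply: cvgD; [apply: cvgD|apply: cvg_norm; apply: cvgB].
Qed.

Lemma dominated2_gromov (R : realType) (G : groupType) (W : walk R G) (L : G -> R) (C : R) :
  is_length L -> dominated W C L -> (forall g, L g^-1%g <= L g + 1) ->
  dominated2 W (2 * C + 1) (gromov L).
Proof.
move=> lenL LC LV g h; have L0 := len_ge0 lenL.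
have [Cg Ch] := (le_trans (ler_norm _) (LC g), le_trans (ler_norm _) (LC h)).
have C0 := dominated_ge0 LC; have [g1 h1] := (wt_ge1 W g, wt_ge1 W h).
have w1 : 1 <= wt W g * wt W h by rewrite -[1]mulr1; apply: ler_pM.
have Cgw : C * wt W g <= C * (wt W g * wt W h) by rewrite ler_wpM2l// ler_peMr// wt_ge0.
have Chw : C * wt W h <= C * (wt W g * wt W h) by rewrite ler_wpM2l// ler_peMl// wt_ge0.
have := lenM g h^-1%g lenL; have := LV h; have := L0 (g * h^-1)%g; have := L0 g; have := L0 h.
by rewrite ler_norml /gromov; move=> *; apply/andP; split; lra.
Qed.

Lemma le_cvg (R : realType) (I : Type) (F : set_system I) (FF : ProperFilter F)
    (f k : I -> R) (a b : R) : f i @[i --> F] --> a -> k i @[i --> F] --> b ->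
  (\forall i \near F, f i <= k i) -> a <= b.
Proof.
move=> fa kb fk; rewrite -subr_ge0; apply: (@cvgr_to_ge _ _ FF R _ _ _ (cvgB kb fa)).
by apply: filterS fk => i; rewrite subr_ge0.
Qed.

Section ConvergingLengths.
Variables (R : realType) (G : groupType) (I : Type) (F : set_system I).
Context {FF : ProperFilter F}.
Implicit Types (g h k : G) (a b d e : R).

Record is_almost_tree_length (L : G -> R) (c : R) : Prop := IsAlmostTreeLength {
  almost_len : is_length L;
  almost_lenV : forall g, L g^-1%g <= L g + c;
  almost_four_point : forall g h k,
    L (g * k^-1)%g + L h <= Num.max (L (g * h^-1)%g + L k) (L g + L (h * k^-1)%g) + c }.

Variables (L : I -> G -> R) (c : I -> R) (N : G -> R).
Hypothesis almost : \forall i \near F, is_almost_tree_length (L i) (c i).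
Hypothesis L_cvg : forall g, L i g @[i --> F] --> N g.
Hypothesis c_cvg : c i @[i --> F] --> (0 : R).

Lemma cvg_almost_le (f k : I -> R) a b : f i @[i --> F] --> a -> k i @[i --> F] --> b ->
  (\forall i \near F, f i <= k i + c i) -> a <= b.
Proof.
move=> fa kb; rewrite -[b]addr0.
exact: (@le_cvg _ _ _ FF f (fun i => k i + c i) _ _ fa (cvgD kb c_cvg)).
Qed.

Lemma is_tree_length_lim : is_tree_length N.
Proof.
have NV g : N g^-1%g <= N g.
  by apply: (cvg_almost_le (@L_cvg g^-1%g) (@L_cvg g)); apply: filterS almost => i [].
split; [split; [|split]| |] => [g||g h|g|g h k].
- by apply: (cvgr_to_ge (@L_cvg g)); apply: filterS almost => i [/len_ge0].
- by apply: (cvgr_to_le (@L_cvg _)); apply: filterS almost => i [/len1 ->].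
- apply: (le_cvg FF (@L_cvg _) (cvgD (@L_cvg g) (@L_cvg h))).
  by apply: filterS almost => i [/lenM lenM _ _]; exact: lenM.
- by apply/eqP; rewrite eq_le NV -{1}(invgK g) NV.
- apply: (@cvg_almost_le (fun i => L i (g * k^-1)%g + L i h)
    (fun i => Num.max (L i (g * h^-1)%g + L i k) (L i g + L i (h * k^-1)%g))).
  + exact: cvgD.
  + by apply: cvg_max; exact: cvgD.
  + by apply: filterS almost => i [].
Qed.

Variables (W : walk R G) (K : R).
Local Notation mean := (mean W).
Local Notation mean2 := (mean2 W).
Local Notation drift := (drift W).
Hypothesis LK : \forall i \near F, dominated W K (L i).

Let lenN := tree_len is_tree_length_lim.

Lemma near_wbounded : \forall i \near F, wbounded W (L i).
Proof. by apply: filterS LK => i; exact: dominated_wbounded. Qed.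

Lemma near_almost_len : \forall i \near F, is_length (L i).
Proof. by apply: filterS almost => i []. Qed.

Lemma dominated_lim : dominated W K N.
Proof.
move=> g; apply: (cvgr_to_le (cvg_norm (@L_cvg g))).
by apply: filterS LK => i /(_ g).
Qed.

Let bN : wbounded W N := dominated_wbounded dominated_lim.

Lemma near_mean_dist n e : 0 < e -> \forall i \near F, mean n (fun g => `|L i g - N g|) <= e.
Proof.
move=> e0; suff /cvgr_le/(_ e e0) : mean n (fun g => `|L i g - N g|) @[i --> F] --> (0 : R) by [].
apply: (@dominated_mean_cvg0 _ _ W n I F _ (2 * K)).
  apply: filterS LK => i LiK g; rewrite normr_id; apply: le_trans (ler_normB _ _) _.
  by have := LiK g; have := dominated_lim g; lra.
move=> g; have := cvg_norm (cvgB (@L_cvg g) (cvg_cst (N g))).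
by rewrite subrr normr0; apply.
Qed.

Lemma near_mean_dist_drift d : 0 < d -> exists j0 : nat, forall j, (j0 <= j)%N ->
  \forall i \near F, mean (2 ^ j) (fun g => `|L i g - (2 ^ j)%:R * drift N|) <= d * (2 ^ j)%:R.
Proof.
move=> d0; have d2 : 0 < d / 2 by rewrite divr_gt0.
have [j0 conc] := mean_dist_drift_small d2 lenN bN.
exists j0 => j /conc; set n := (2 ^ j)%N => N_near.
have n1 : 1 <= n%:R :> R by rewrite ler1n expn_gt0.
near=> i; have bL : wbounded W (L i) by near: i; exact: near_wbounded.
have L_near : mean n (fun g => `|L i g - N g|) <= d / 2 by near: i; exact: near_mean_dist.
apply: le_trans (_ : mean n (fun g => `|L i g - N g| + `|N g - n%:R * drift N|) <= _).
  apply: le_mean => [||g]; [wbound|wbound|].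
  by rewrite -[L i g - n%:R * _](subrKA (N g)) ler_normD.
by rewrite meanD; [nra|wbound|wbound].
Unshelve. all: by end_near. Qed.

Lemma near_drift_le e : 0 < e -> \forall i \near F, drift (L i) <= drift N + e.
Proof.
move=> e0; have e2 : 0 < e / 2 by rewrite divr_gt0.
have [j0 /(_ j0 (leqnn _))] := near_mean_dist_drift e0; set n := (2 ^ j0)%N => L_near.
have nR : 0 < n%:R :> R by rewrite ltr0n expn_gt0.
near=> i.
have lenL : is_length (L i) by near: i; exact: near_almost_len.
have bL : wbounded W (L i) by near: i; exact: near_wbounded.
have : mean n (fun g => `|L i g - n%:R * drift N|) <= e * n%:R by near: i.
have bLN : wbounded W (fun g => L i g - n%:R * drift N) by wbound.
move=> /(le_trans (norm_mean_le_mean n bLN)) /(le_trans (ler_norm _)).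
rewrite meanB ?mean_cst; [|wbound|wbound] => mean_le.
by rewrite -(ler_pM2l nR); have := le_drift n lenL bL; lra.
Unshelve. all: by end_near. Qed.

Lemma near_drift_ge_character e : 0 < e ->
  (\forall i \near F, exists phi, norm_character (L i) (c i) phi) ->
  \forall i \near F, drift N - e <= drift (L i).
Proof.
move=> e0 chi; pose d := e / 6; have d0 : 0 < d by rewrite divr_gt0.
have [j0 conc] := near_mean_dist_drift d0.
have [n0 phi_small] := mean_dist_morphism_small W (K + 1) d0.
pose n := (2 ^ (j0 + n0))%N; have n1 : 1 <= n%:R :> R by rewrite ler1n expn_gt0.
have n0n : (n0 <= n)%N.
  by apply: leq_trans (leq_addl j0 n0) (ltnW (ltn_expl _ (ltnSn 1))).
near=> i.
have lenL : is_length (L i) by near: i; exact: near_almost_len.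
have LiK : dominated W K (L i) by near: i.
have bL := dominated_wbounded LiK.
have L_near : mean n (fun g => `|L i g - n%:R * drift N|) <= d * n%:R.
  by near: i; exact: conc (leq_addr _ _).
have LN_near : mean (n + n) (fun g => `|L i g - N g|) <= d by near: i; exact: near_mean_dist.
have c1 : c i <= 1 by near: i; exact: (cvgr_le (0 : R)).
have cd : c i <= d by near: i; exact: (cvgr_le (0 : R)).
have [phi chi_phi] : exists phi, norm_character (L i) (c i) phi by near: i.
have phiK : dominated W (K + 1) phi.
  move=> g; have := character_le chi_phi g; have := le_trans (ler_norm _) (LiK g).
  by rewrite mulrDl mul1r; have := wt_ge1 W g; lra.
have phi_near := phi_small n phi n0n phiK (characterM chi_phi).
have -> : drift N - e = drift N - 6 * d by rewrite /d; field.
apply: (norm_character_drift_ge lenL bL chi_phi (dominated_wbounded phiK) (n := n)) => //.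
- by rewrite expn_gt0.
- by apply: le_trans cd _; rewrite ler_peMr// ltW.
have : mean (n + n) N <= mean (n + n) (L i) + d.
  rewrite -lerBlDl -meanB//; apply: le_trans LN_near; apply: le_mean => [||g]; [wbound|wbound|].
  by rewrite distrC ler_norm.
by have := le_drift (n + n) lenN bN; rewrite natrD; nra.
Unshelve. all: by end_near. Qed.

Let dominated2_gromovN : dominated2 W (2 * K + 1) (gromov N).
Proof.
apply: dominated2_gromov dominated_lim _ => // g.
by rewrite (tree_lenV is_tree_length_lim) lerDl.
Qed.

Lemma near_dominated2_gromov_dist : \forall i \near F,
  dominated2 W (4 * K + 2) (fun g h => `|gromov (L i) g h - gromov N g h|).
Proof.
near=> i.
have [lenL LV _] : is_almost_tree_length (L i) (c i) by near: i.
have LiK : dominated W K (L i) by near: i.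
have c1 : c i <= 1 by near: i; exact: (cvgr_le (0 : R)).
have LV1 g : L i g^-1%g <= L i g + 1 by apply: le_trans (LV g) _; rewrite lerD2l.
move=> g h; rewrite normr_id; apply: le_trans (ler_normB _ _) _.
by have := dominated2_gromov lenL LiK LV1 g h; have := dominated2_gromovN g h; lra.
Unshelve. all: by end_near. Qed.

Lemma near_mean2_gromov_dist n e : 0 < e -> \forall i \near F,
  mean2 n (fun g h => `|gromov (L i) g h - gromov N g h|) <= e.
Proof.
move=> e0; suff /cvgr_le/(_ e e0) :
  mean2 n (fun g h => `|gromov (L i) g h - gromov N g h|) @[i --> F] --> (0 : R) by [].
apply: (dominated_mean2_cvg0 n _ near_dominated2_gromov_dist) => g h.
have := cvg_norm (cvgB (cvgB (cvgD (@L_cvg g) (@L_cvg h)) (@L_cvg (g * h^-1)%g))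
  (cvg_cst (gromov N g h))).
by rewrite -/(gromov N g h) subrr normr0; apply.
Qed.

Lemma near_drift_ge_cocycle (V : Type) (v : V) e : 0 < e -> 0 < drift N -> spread W N ->
  (\forall i \near F, exists (act : G -> V -> V) (psi : V -> G -> R),
    norm_cocycle (L i) (c i) act psi) ->
  \forall i \near F, drift N - e <= drift (L i).
Proof.
move=> e0 l0 sp cocycle; set l := drift N in l0 *.
pose d := e / 16; have d0 : 0 < d by rewrite divr_gt0.
pose k := e / (4 * (2 * l + 1)); have l1 : 0 < 2 * l + 1 by rewrite addr_gt0// mulr_gt0.
have k0 : 0 < k by rewrite divr_gt0// mulr_gt0.
have eta0 : 0 < k ^+ 2 / 2 by rewrite divr_gt0// exprn_gt0.
have [j0 conc] := near_mean_dist_drift d0.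
have [j hj] := sp d _ d0 eta0 j0; have {conc} := conc j hj.
set n := (2 ^ j)%N => L_near N_spread.
have n1 : 1 <= n%:R :> R by rewrite ler1n expn_gt0.
have n0 : 0 < n%:R :> R by rewrite ltr0n expn_gt0.
have a0 : 0 < d * n%:R by rewrite mulr_gt0.
have gr0 : 0 < k ^+ 2 / 2 * (d * n%:R) by rewrite mulr_gt0.
near=> i.
have lenL : is_length (L i) by near: i; exact: near_almost_len.
have bL : wbounded W (L i) by near: i; exact: near_wbounded.
have [act [psi cc]] : exists (act : G -> V -> V) (psi : V -> G -> R),
    norm_cocycle (L i) (c i) act psi by near: i.
have L_dist : mean n (fun g => `|L i g - n%:R * l|) <= d * n%:R by near: i.
have gromov_dist : mean2 n (fun g h => `|gromov (L i) g h - gromov N g h|) <=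
    k ^+ 2 / 2 * (d * n%:R) by near: i; exact: near_mean2_gromov_dist.
have bD : wbounded2 W (fun g h => `|gromov (L i) g h - gromov N g h|).
  by exists (4 * K + 2); near: i; exact: near_dominated2_gromov_dist.
have c_small : `|c i| <= Num.min 1 (Num.min (d * n%:R) (2 * n%:R * l)).
  near: i; apply: (cvgr_norm_le (0 : R) c_cvg).
  by rewrite normr0 !lt_min ltr01 a0 !mulr_gt0.
have [c1 cd cl] : [/\ c i <= 1, c i <= d * n%:R & 0 <= 2 * n%:R * l + c i].
  move: c_small; rewrite !le_min => /and3P[/(le_trans (ler_norm _)) ? /(le_trans (ler_norm _)) ?].
  by have := ler_norm (- c i); rewrite normrN; split=> //; lra.
apply: (cocycle_drift_ge lenL bL cc v (n := n)) => [|u]; first by rewrite expn_gt0.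
have := cocycle_defect_mass (N := N) cc u a0 cd bD N_spread gromov_dist.
have -> : 2 * (k ^+ 2 / 2) = k ^+ 2 by field.
rewrite ler_sqr ?nnegrE ?(ltW k0)//; last by apply: mean_ge0 => //; wbound.
move=> mass_le; have a3 : 0 <= 3 * (d * n%:R) by rewrite mulr_ge0// ltW.
have := cocycle_mean_ge lenL bL cc a3 cl L_dist mass_le.
have : (2 * n%:R * l + c i) * k <= n%:R * (2 * l + 1) * k by rewrite ler_pM2r//; lra.
have -> : n%:R * (2 * l + 1) * k = n%:R * e / 4 by rewrite /k; field; rewrite gt_eqF.
have ne : 0 < n%:R * e by rewrite mulr_gt0.
by rewrite /d; lra.
Unshelve. all: by end_near. Qed.

End ConvergingLengths.

(** * Degeneration of the representation *)

Section NearZero.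
Variable R : realType.
Local Notation C := R[i].
Local Notation disk := (@cdisk R).
Implicit Types (t z : C) (f k : C -> C) (U : set C).

Lemma near0P (P : set C) : (\forall t \near (0 : C)^', P t) <->
  exists2 d : R, 0 < d & forall t, t != 0 -> cabs t < d -> P t.
Proof.
split=> [/dnbhs_cabsP[d d0 Pd]|[d d0 Pd]]; last apply/dnbhs_cabsP;
  by exists d => // t t0; have := Pd t t0; rewrite subr0.
Qed.

Definition scale t : R := ln (cabs t)^-1.

Lemma scale_gt0 t : cpdisk t -> 0 < scale t.
Proof. by move=> [t1 t0]; apply: ln_gt0; rewrite invf_gt1// cabs_gt0. Qed.

Lemma near0_cpdisk : \forall t \near (0 : C)^', cpdisk t.
Proof. by apply/near0P; exists 1 => // t t0 t1; split. Qed.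

Lemma scale_cvg : scale t @[t --> (0 : C)^'] --> +oo.
Proof.
apply/cvgryPge => B; apply/near0P; exists (expR (- B)) => [|t t0 tB]; first exact: expR_gt0.
rewrite /scale -ler_expR lnK ?posrE ?invr_gt0 ?cabs_gt0//.
by rewrite -[expR B]invrK -expRN lef_pV2 ?posrE ?expR_gt0 ?cabs_gt0// ltW.
Qed.

Lemma div_scale_cvg0 (c : R) : c / scale t @[t --> (0 : C)^'] --> (0 : R).
Proof.
rewrite -(mulr0 c); apply: cvgMr.
apply: (gtr0_cvgV0 _).2; last exact: scale_cvg.
by apply: filterS near0_cpdisk => t; exact: scale_gt0.
Qed.

Lemma holo_onX U n : holo_on U (fun z : C => z ^+ n).
Proof. by apply/holo_onP => z _; exact: cderivableX. Qed.

Lemma holo_onM U f k : holo_on U f -> holo_on U k -> holo_on U (fun z => f z * k z).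
Proof.
by rewrite !holo_onP => df dk z zU; apply: cderivableM; [exact: df|exact: dk].
Qed.

Lemma holo_onB U f k : holo_on U f -> holo_on U k -> holo_on U (fun z => f z - k z).
Proof.
by rewrite !holo_onP => df dk z zU; apply: cderivableB; [exact: df|exact: dk].
Qed.

Lemma holo_onD U f k : holo_on U f -> holo_on U k -> holo_on U (fun z => f z + k z).
Proof.
by rewrite !holo_onP => df dk z zU; apply: cderivableD; [exact: df|exact: dk].
Qed.

Lemma holo_cabs_cvg0 f : holo_on disk f -> cabs (f t) @[t --> (0 : C)^'] --> cabs (f 0).
Proof.
move=> hf; apply: cvg_within_filter.
exact: (@continuous_comp _ _ _ f (@cabs R) 0 (holo_continuous hf (@disk0 R))
  (@cabs_continuous R (f 0))).
Qed.

Lemma near0_holo_le f (a : R) : holo_on disk f -> cabs (f 0) < a ->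
  \forall t \near (0 : C)^', cabs (f t) <= a.
Proof. by move=> hf; exact: (cvgr_le _ (holo_cabs_cvg0 hf)). Qed.

Lemma near0_holo_ge f : holo_on disk f -> f 0 != 0 ->
  \forall t \near (0 : C)^', cabs (f 0) / 2 <= cabs (f t).
Proof.
move=> hf; rewrite -cabs_gt0 => f0; apply: (cvgr_ge _ (holo_cabs_cvg0 hf)); lra.
Qed.

Lemma holo_eq0 f k : holo_on disk f -> holo_on disk k ->
  (forall t, cpdisk t -> f t = k t) -> f 0 = k 0.
Proof.
move=> hf hk fk; apply: continuous_eq_dnbhs.
- exact: holo_continuous hf (@disk0 R).
- exact: holo_continuous hk (@disk0 R).
- by apply: filterS near0_cpdisk.
Qed.

End NearZero.

(* [lognorm rho t g] and [defect t] are the logarithms of the norm of [eval_rep rho t g]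
   and of a constant in base [(cabs t)^-1], so that they have limits as [t] tends to [0]. *)
HB.lock Definition lognorm (R : realType) (G : groupType)
    (rho : G -> 'I_2 -> 'I_2 -> R[i] -> R[i]) (t : R[i]) (g : G) : R :=
  ln (opnorm (eval_rep rho t g)) / scale t.

Definition defect (R : realType) (t : R[i]) : R := ln 128 / scale t.

Section LogNorm.
Variables (R : realType) (G : groupType) (rho : G -> 'I_2 -> 'I_2 -> R[i] -> R[i]).
Local Notation C := R[i].
Local Notation M := (eval_rep rho).
Local Notation lognorm := (lognorm rho).
Hypothesis hrho : is_SL2M_hom rho.
Implicit Types (g h : G) (t : C) (k : nat).

Lemma eval_rep_det t g : cpdisk t -> \det (M t g) = 1.
Proof. by case: hrho => _ + _; apply. Qed.

Lemma eval_repM t g h : cpdisk t -> M t (g * h)%g = M t g *m M t h.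
Proof. by case: hrho => _ _; apply. Qed.

Lemma eval_rep1 t : cpdisk t -> M t 1%g = 1%:M.
Proof.
move=> tD; have d1 := eval_rep_det 1%g tD.
by rewrite -(mul_adjmx1 d1) -{3}(mulg1 1%g) eval_repM// mulmxA (mul_adjmx1 d1) mul1mx.
Qed.

Lemma eval_repV t g : cpdisk t -> M t g^-1%g = \adj (M t g).
Proof.
move=> tD; rewrite -[RHS]mulmx1 -(eval_rep1 tD) -(mulgV g) eval_repM// mulmxA.
by rewrite (mul_adjmx1 (eval_rep_det g tD)) mul1mx.
Qed.

Lemma opnorm_rep_gt0 t g : cpdisk t -> 0 < opnorm (M t g).
Proof. by move=> tD; apply: lt_le_trans (opnorm_ge1 (eval_rep_det g tD)). Qed.

Lemma expR_lognorm t g : cpdisk t -> expR (scale t * lognorm t g) = opnorm (M t g).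
Proof.
move=> tD; rewrite lognorm.unlock mulrC divfK ?gt_eqF ?scale_gt0//.
by rewrite lnK// posrE opnorm_rep_gt0.
Qed.

Lemma le_expR_scale t (x y c : R) : cpdisk t -> 0 < c ->
  expR (scale t * x) <= c * expR (scale t * y) -> x <= y + ln c / scale t.
Proof.
move=> tD c0; have s0 := scale_gt0 tD.
rewrite -{1}(@lnK _ c) ?posrE// -expRD ler_expR => xy.
by rewrite -(ler_pM2l s0) mulrDr [scale t * (_ / _)]mulrC divfK ?gt_eqF//; lra.
Qed.

Lemma le_defect t (x y c : R) : cpdisk t -> c <= 128 ->
  expR (scale t * x) <= c * expR (scale t * y) -> x <= y + defect t.
Proof.
move=> tD c128 xy; apply: le_expR_scale => //; apply: le_trans xy _.
by rewrite ler_wpM2r// expR_ge0.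
Qed.

Lemma lognorm_is_length t : cpdisk t -> is_length (lognorm t).
Proof.
move=> tD; split=> [g|]; last split=> [|g h].
- rewrite lognorm.unlock; apply: divr_ge0; last exact/ltW/scale_gt0.
  by apply/ln_ge0/opnorm_ge1/eval_rep_det.
- by rewrite lognorm.unlock eval_rep1// opnorm1 ln1 mul0r.
- rewrite lognorm.unlock -mulrDl ler_pM2r ?invr_gt0 ?scale_gt0// -lnM ?posrE ?opnorm_rep_gt0//.
  by rewrite ler_ln ?posrE ?mulr_gt0 ?opnorm_rep_gt0// eval_repM// opnormM.
Qed.

Lemma lognorm_almost_tree_length t : cpdisk t ->
  is_almost_tree_length (lognorm t) (defect t).
Proof.
move=> tD; split; first exact: lognorm_is_length.
  move=> g; apply: (le_defect (c := 2)) => //; first by lra.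
  by rewrite !expR_lognorm// eval_repV// opnorm_adj.
move=> g h k; set m := Num.max _ _; have s0 := scale_gt0 tD.
have max_ge x : x <= m -> expR (scale t * x) <= expR (scale t * m).
  by move=> xm; rewrite ler_expR ler_pM2l.
apply: (le_defect (c := 8)) => //; first by lra.
have := opnorm_pluecker (M t g) (M t h) (M t k).
rewrite -!eval_repV// -!eval_repM// -!expR_lognorm// -!expRD -!mulrDr => pluecker.
apply: le_trans pluecker _.
have := max_ge (lognorm t (g * h^-1)%g + lognorm t k); rewrite le_max lexx => /(_ isT).
have := max_ge (lognorm t g + lognorm t (h * k^-1)%g); rewrite le_max lexx orbT => /(_ isT).
by move: (expR (scale t * m)) => ?; lra.
Qed.

Definition pole_order g k (E : C -> 'M[C]_2) :=
  [/\ forall i j, holo_on (@cdisk R) (fun t => E t i j),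
      forall t, cpdisk t -> M t g = (t ^+ k)^-1 *: E t & E 0 != 0].

Lemma det_holo (E : C -> 'M[C]_2) : (forall i j, holo_on (@cdisk R) (fun t => E t i j)) ->
  holo_on (@cdisk R) (fun t => \det (E t)).
Proof.
move=> hE; under eq_fun do rewrite det_mx22.
by apply: holo_onB; apply: holo_onM.
Qed.

Lemma exists_pole_order_le g k (E : C -> 'M[C]_2) :
  (forall i j, holo_on (@cdisk R) (fun t => E t i j)) ->
  (forall t, cpdisk t -> M t g = (t ^+ k)^-1 *: E t) -> exists k' E', pole_order g k' E'.
Proof.
elim: k E => [|k IHk] E hE ME; have [E_at0|E_at0] := eqVneq (E 0) 0; last 1 first.
- by exists k.+1, E.
- have : \det (E 0) = 1.
    apply: (holo_eq0 (det_holo hE) (k := fun=> 1)) => [|t tD].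
      by apply/holo_onP => z _; exact: cderivable_cst.
    by have := ME t tD; rewrite expr0 invr1 scale1r => <-; exact: eval_rep_det.
  by rewrite E_at0 det0 => /eqP; rewrite eq_sym oner_eq0.
- by exists 0%N, E.
have divide i j : exists F, holo_on (@cdisk R) F /\ forall z, E z i j = z * F z.
  by have [|F hF EF] := holo_div_id (hE i j); [rewrite E_at0 mxE|exists F].
have [F FP] := choice (fun ij : 'I_2 * 'I_2 => divide ij.1 ij.2).
apply: (IHk (fun t => \matrix_(i, j) F (i, j) t)) => [i j|t tD].
  by under eq_fun do rewrite mxE; exact: (FP (i, j)).1.
have t0 : t != 0 by case: tD.
rewrite ME//; apply/matrixP => i j; rewrite [LHS]mxE (FP (i, j)).2 !mxE exprSr invfM.
by rewrite mulrA divfK.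
Qed.

Lemma exists_pole_order g : exists k E, pole_order g k E.
Proof.
have pole (ij : 'I_2 * 'I_2) : exists p : nat * (C -> C), holo_on (@cdisk R) p.2 /\
    forall t, cpdisk t -> rho g ij.1 ij.2 t = p.2 t / t ^+ p.1.
  by case: hrho => /(_ g ij.1 ij.2)[_ [k [E [hE rhoE]]]] _ _; exists (k, E).
have [p pP] := choice pole; pose m := \max_ij (p ij).1.
have km ij : ((p ij).1 <= m)%N by exact: leq_bigmax.
apply: (@exists_pole_order_le g m
    (fun t => \matrix_(i, j) (t ^+ (m - (p (i, j)).1) * (p (i, j)).2 t))).
  move=> i j; under eq_fun do rewrite mxE.
  by apply: holo_onM; [exact: holo_onX|exact: (pP (i, j)).1].
move=> t tD; have t0 : t != 0 by case: tD.
apply/matrixP => i j; rewrite !mxE (pP (i, j)).2//.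
have -> : t ^+ m = t ^+ (m - (p (i, j)).1) * t ^+ (p (i, j)).1 by rewrite -exprD subnK.
by field; rewrite !expf_neq0.
Qed.

Lemma nalog_pole_order g k E : pole_order g k E -> nalog rho g = k%:R.
Proof.
move=> [hE ME E_at0].
have bound (n : int) : (forall i j, ord_ge (rho g i j) (- n)) -> k%:Z <= n.
  move=> ord_n; rewrite leNgt; apply: contra E_at0 => nk.
  apply/eqP/matrixP => i j; rewrite mxE; have [F [hF rhoF]] := ord_n i j.
  have [p kE] : exists p, k%:Z = n + p.+1%:Z.
    by exists `|k%:Z - n|%N.-1; lia.
  rewrite (holo_eq0 (hE i j) (k := fun t => t ^+ p.+1 * F t)) ?expr0n ?mul0r//.
    by apply: holo_onM => //; exact: holo_onX.
  move=> t tD; have t0 : t != 0 by case: tD.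
  have := congr1 (fun A : 'M[C]_2 => A i j) (ME t tD); rewrite !mxE rhoF// => rhoE.
  apply: (mulfI (invr_neq0 (expf_neq0 k t0))); rewrite -rhoE.
  by rewrite mulrA exprnN exprnP -expfzDr// kE; congr (t ^ _ * _); lia.
have k_in : [set x : R | exists k : int, x = k%:~R /\ forall i j, ord_ge (rho g i j) (- k)] k%:R.
  exists k%:Z; split=> // i j; exists (fun t => E t i j); split=> // t tD.
  have := congr1 (fun A : 'M[C]_2 => A i j) (ME t tD); rewrite !mxE => ->.
  by rewrite exprnN.
apply/eqP; rewrite eq_le; apply/andP; split.
  by apply: ge_inf => //; exists k%:R => _ [n [-> /bound kn]]; rewrite pmulrn ler_int.
apply: lb_le_inf; first by exists k%:R.
by move=> _ [n [-> /bound kn]]; rewrite pmulrn ler_int.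
Qed.

Lemma lognorm_cvg g : lognorm t g @[t --> (0 : C)^'] --> nalog rho g.
Proof.
have [k [E Ek]] := exists_pole_order g; rewrite (nalog_pole_order Ek).
have [hE ME E_at0] := Ek.
have [i [j Eij]] : exists i j, E 0 i j != 0.
  apply: contrapT => all0; move/eqP: E_at0; apply; apply/matrixP => i j; rewrite mxE.
  by apply/eqP; apply: contraT => Eij; exfalso; apply: all0; exists i, j.
have cvg_k (c : R) : k%:R + ln c / scale t @[t --> (0 : C)^'] --> (k%:R : R).
  by have := cvgD (cvg_cst (k%:R : R)) (div_scale_cvg0 (ln c)); rewrite addr0; apply.
pose a := cabs (E 0 i j) / 2; pose b := 2 * (opnorm (E 0) + 1).
have a0 : 0 < a by rewrite divr_gt0// cabs_gt0.
have entry i' j' : \forall t \near (0 : C)^', cabs (E t i' j') <= opnorm (E 0) + 1.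
  by apply: near0_holo_le (hE i' j') _; rewrite ltr_pwDr// entry_le_opnorm.
apply: squeeze_cvgr (cvg_k a) (cvg_k b).
near=> t.
have tD : cpdisk t by near: t; exact: near0_cpdisk.
have s0 := scale_gt0 tD.
have aE : a <= opnorm (E t).
  by apply: le_trans (entry_le_opnorm _ i j); near: t; exact: near0_holo_ge (hE i j) Eij.
have Eb : opnorm (E t) <= b.
  apply: opnorm_le_entry => i' j'.
  by case: (ord2P i') => ->; case: (ord2P j') => ->; near: t; exact: entry.
have Et0 : 0 < opnorm (E t) by exact: lt_le_trans aE.
have -> : lognorm t g = k%:R + ln (opnorm (E t)) / scale t.
  have t0 : 0 < cabs t by rewrite cabs_gt0; case: tD.
  rewrite lognorm.unlock ME// opnormZ cabsV cabsX -exprVn lnM ?posrE ?exprn_gt0 ?invr_gt0//.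
  by rewrite lnXn ?invr_gt0// -/(scale t) -[scale t *+ k]mulr_natl mulrDl mulfK// gt_eqF.
by apply/andP; split; rewrite lerD2l ler_pM2r ?invr_gt0// ler_ln ?posrE//;
  exact: lt_le_trans Eb.
Unshelve. all: by end_near. Qed.

Lemma defect_cvg : defect t @[t --> (0 : C)^'] --> (0 : R).
Proof. exact: div_scale_cvg0. Qed.

Lemma near0_almost_tree_length :
  \forall t \near (0 : C)^', is_almost_tree_length (lognorm t) (defect t).
Proof. by apply: filterS (near0_cpdisk R) => t; exact: lognorm_almost_tree_length. Qed.

Lemma nalog_is_tree_length : is_tree_length (nalog rho).
Proof. exact: is_tree_length_lim near0_almost_tree_length lognorm_cvg defect_cvg. Qed.

End LogNorm.

(** * Commutators and invariant lines *)

Lemma group_union2 (G : groupType) (P Q : G -> Prop) :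
  (forall g h, P g -> P h -> P (g * h)%g) -> (forall g, P g -> P g^-1%g) ->
  (forall g h, Q g -> Q h -> Q (g * h)%g) -> (forall g, Q g -> Q g^-1%g) ->
  (forall g, P g \/ Q g) -> (forall g, P g) \/ (forall g, Q g).
Proof.
move=> PM PV QM QV PQ.
have [|/existsNP[g nPg]] := pselect (forall g, P g); first by left.
have [|/existsNP[h nQh]] := pselect (forall g, Q g); first by right.
have Qg : Q g by case: (PQ g).
have Ph : P h by case: (PQ h).
case: (PQ (g * h)%g) => gh; exfalso.
  by apply: nPg; rewrite -(mulgK h g); apply: PM => //; exact: PV.
by apply: nQh; rewrite -(mulKg g h); apply: QM => //; exact: QV.
Qed.

Definition nonzero_vector (R : realType) := {v : 'cV[R[i]]_2 | v != 0}.

HB.lock Definition log_stretch (R : realType) (G : groupType)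
    (rho : G -> 'I_2 -> 'I_2 -> R[i] -> R[i]) (t : R[i]) (v : nonzero_vector R) (g : G) : R :=
  ln (vnorm (eval_rep rho t g *m val v) / vnorm (val v)) / scale t.

Section FixedParameter.
Variables (R : realType) (G : groupType) (rho : G -> 'I_2 -> 'I_2 -> R[i] -> R[i]).
Local Notation C := R[i].
Local Notation M := (eval_rep rho).
Local Notation lognorm := (lognorm rho).
Local Notation log_stretch := (log_stretch rho).
Hypothesis hrho : is_SL2M_hom rho.
Variable t : C.
Hypothesis tD : cpdisk t.
Implicit Types (g h : G) (r : 'rV[C]_2).

Let s0 : 0 < scale t := scale_gt0 tD.

Lemma eigenrow_neq0 r g (la : C) : r != 0 -> r *m M t g = la *: r -> la != 0.
Proof.
move=> r0 rg; apply: contraNneq r0 => la0.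
rewrite -[r]mulmx1 -(mulmx_adj1 (eval_rep_det hrho g tD)) mulmxA rg la0 scale0r mul0mx //.
Qed.

Lemma stable_rowM r g h : stablemx r (M t g) -> stablemx r (M t h) -> stablemx r (M t (g * h)%g).
Proof. by move=> rg rh; rewrite (eval_repM hrho g h tD); exact: stablemxM rg rh. Qed.

Lemma stable_rowV r g : r != 0 -> stablemx r (M t g) -> stablemx r (M t g^-1%g).
Proof.
move=> r0 /sub_rVP[la rg]; have la0 := eigenrow_neq0 r0 rg.
apply/sub_rVP; exists la^-1; apply: (scalerI la0).
rewrite scalerA divff// scale1r scalemxAl -rg -mulmxA -(eval_repM hrho)// mulgV.
by rewrite (eval_rep1 hrho)// mulmx1.
Qed.

Lemma common_stable_row : (forall g h, detcomm (M t g) (M t h) = 0) ->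
  exists2 r : 'rV[C]_2, r != 0 & forall g, stablemx r (M t g).
Proof.
move=> comm0; have [scalar|] := pselect (forall g, is_scalar_mx (M t g)).
  exists (row ord0 1%:M); first by rewrite rV2_eq0 !mxE eqxx oner_eq0.
  by move=> g; have /is_scalar_mxP[a ->] := scalar g; exact: stablemxC.
move=> /existsNP[g0 /negP/detcomm_eq0_stable[r [s [r0 sn0 rs]]]].
have [all_r|all_s] := @group_union2 G (fun g => stablemx r (M t g)) (fun g => stablemx s (M t g))
  (@stable_rowM r) (fun g => @stable_rowV r g r0) (@stable_rowM s) (fun g => @stable_rowV s g sn0)
  (fun g => rs _ (comm0 g0 g)); by [exists r|exists s].
Qed.

Lemma stable_row_character r : r != 0 -> (forall g, stablemx r (M t g)) ->
  exists phi, norm_character (lognorm t) (defect t) phi.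
Proof.
move=> r0 stable; have eigen g : exists a, r *m M t g = a *: r by exact/sub_rVP/stable.
have [la rla] := choice eigen.
have la0 g : la g != 0 := eigenrow_neq0 r0 (rla g).
have laM g h : la (g * h)%g = la g * la h.
  have := rla (g * h)%g; rewrite (eval_repM hrho)// mulmxA rla -scalemxAl rla scalerA.
  move=> /eqP; rewrite -subr_eq0 -scalerBl scaler_eq0 (negbTE r0) orbF subr_eq0.
  by move=> /eqP.
pose phi g := ln (cabs (la g)) / scale t.
have expR_phi g : expR (scale t * phi g) = cabs (la g).
  by rewrite /phi mulrC divfK ?gt_eqF// lnK// posrE cabs_gt0.
have phiM g h : phi (g * h)%g = phi g + phi h.
  by rewrite /phi laM cabsM lnM ?posrE ?cabs_gt0// mulrDl.
have phi1 : phi 1%g = 0 by have := phiM 1%g 1%g; rewrite mulg1; lra.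
have phiV g : phi g^-1%g = - phi g by have := phiM g g^-1%g; rewrite mulgV phi1; lra.
have la_le g : cabs (la g) <= 8 * opnorm (M t g) by exact: cabs_eigenrow_le r0 (rla g).
exists phi; split=> // [g|g h].
  rewrite ler_norml lerNl -phiV; apply/andP; split.
    apply: (le_defect (c := 16)) => //; first by lra.
    rewrite expR_phi (expR_lognorm hrho)//; apply: le_trans (la_le _) _.
    by rewrite (eval_repV hrho)//; have := opnorm_adj (M t g); lra.
  apply: (le_defect (c := 8)) => //; first by lra.
  by rewrite expR_phi (expR_lognorm hrho).
set m := Num.max _ _.
have max_ge x : x <= m -> expR (scale t * x) <= expR (scale t * m).
  by move=> xm; rewrite ler_expR ler_pM2l.
apply: (le_defect (c := 128)) => //; rewrite (expR_lognorm hrho)// (eval_repM hrho)//.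
apply: le_trans (opnorm_mul_common_row r0 (eval_rep_det hrho g tD) (rla g) (rla h)) _.
rewrite -!expR_phi -!(expR_lognorm hrho)// -expRN -!expRD -[- (scale t * phi g)]mulrN -!mulrDr.
have := max_ge (lognorm t g + phi h); rewrite le_max lexx => /(_ isT).
have := max_ge (lognorm t h - phi g); rewrite le_max lexx orbT => /(_ isT).
by move: (expR (scale t * m)) => ?; lra.
Qed.

Implicit Types v : nonzero_vector R.

Lemma vnorm_rep_ge v g : vnorm (val v) <= opnorm (M t g^-1%g) * vnorm (M t g *m val v).
Proof.
apply: le_trans (vnorm_mulmx _ _).
by rewrite mulmxA -(eval_repM hrho)// mulVg (eval_rep1 hrho)// mul1mx.
Qed.

Lemma rep_vector_neq0 g v : M t g *m val v != 0.
Proof.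
have := vnorm_gt0 (valP v); apply: contraTneq => Mv0.
by have := vnorm_rep_ge v g; rewrite Mv0 vnorm0 mulr0 leNgt.
Qed.

Definition rep_act g v : nonzero_vector R := exist _ (M t g *m val v) (rep_vector_neq0 g v).

Lemma stretch_gt0 v g : 0 < vnorm (M t g *m val v) / vnorm (val v).
Proof. by rewrite divr_gt0 ?vnorm_gt0 ?rep_vector_neq0// (valP v). Qed.

Lemma expR_log_stretch v g :
  expR (scale t * log_stretch t v g) = vnorm (M t g *m val v) / vnorm (val v).
Proof.
by rewrite log_stretch.unlock mulrC divfK ?gt_eqF// lnK// posrE stretch_gt0.
Qed.

Lemma log_stretch_pair v g h x : x <= lognorm t g - log_stretch t v g ->
  x <= lognorm t h - log_stretch t v h -> x <= gromov (lognorm t) g h + defect t.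
Proof.
move=> xg xh; rewrite /gromov.
suff : lognorm t (g * h^-1)%g <= lognorm t g + lognorm t h - x + defect t by lra.
apply: (le_defect (c := 4)) => //; first by lra.
rewrite (expR_lognorm hrho)// (eval_repM hrho)// (eval_repV hrho)//.
have stretch u : vnorm (M t u *m val v) = vnorm (val v) * expR (scale t * log_stretch t v u).
  by rewrite expR_log_stretch mulrC divfK// gt_eqF// vnorm_gt0 ?(valP v).
apply: (opnorm_mul_adj_stretch (valP v) (stretch g) (stretch h));
  by rewrite -(expR_lognorm hrho)// -expRD -mulrDr ler_expR ler_pM2l//; lra.
Qed.

Lemma log_stretch_cocycle : norm_cocycle (lognorm t) (defect t) rep_act (log_stretch t).
Proof.
have v0 v : 0 < vnorm (val v) := vnorm_gt0 (valP v).
split=> [v|v g h|v g|v g|]; last exact: log_stretch_pair.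
- by rewrite log_stretch.unlock (eval_rep1 hrho)// mul1mx divff ?gt_eqF// ln1 mul0r.
- rewrite log_stretch.unlock /= -mulrDl -lnM ?posrE ?stretch_gt0//;
    last exact: (stretch_gt0 (rep_act h v)).
  by rewrite (eval_repM hrho)// -mulmxA mulrA divfK// gt_eqF// vnorm_gt0// rep_vector_neq0.
- rewrite -(ler_pM2l s0) -ler_expR expR_log_stretch (expR_lognorm hrho)//.
  by rewrite ler_pdivrMr// vnorm_mulmx.
- apply: le_trans (_ : - lognorm t g^-1%g <= _).
    by rewrite lerN2; exact: (almost_lenV (lognorm_almost_tree_length hrho tD)).
  rewrite -(ler_pM2l s0) -ler_expR expR_log_stretch mulrN expRN (expR_lognorm hrho)//.
  by rewrite ler_pdivlMr// ler_pdivrMl ?(opnorm_rep_gt0 hrho)// vnorm_rep_ge.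
Qed.

End FixedParameter.

Section Commutators.
Variables (R : realType) (G : groupType) (rho : G -> 'I_2 -> 'I_2 -> R[i] -> R[i]).
Local Notation C := R[i].
Local Notation M := (eval_rep rho).
Local Notation lognorm := (lognorm rho).
Local Notation N := (nalog rho).
Hypothesis hrho : is_SL2M_hom rho.
Implicit Types (f g h : G) (t : C).

Lemma detcomm_holo (E F : C -> 'M[C]_2) : (forall i j, holo_on (@cdisk R) (fun t => E t i j)) ->
  (forall i j, holo_on (@cdisk R) (fun t => F t i j)) ->
  holo_on (@cdisk R) (fun t => detcomm (E t) (F t)).
Proof.
move=> hE hF; have mulmx_holo (A B : C -> 'M[C]_2) :
    (forall i j, holo_on (@cdisk R) (fun t => A t i j)) ->
    (forall i j, holo_on (@cdisk R) (fun t => B t i j)) ->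
    forall i j, holo_on (@cdisk R) (fun t => (A t *m B t) i j).
  move=> hA hB i j; under eq_fun do rewrite mulmx2E.
  by apply: holo_onD; apply: holo_onM.
apply: det_holo => i j; under eq_fun do rewrite mxE [X in _ + X]mxE.
by apply: holo_onB; apply: mulmx_holo.
Qed.

Lemma commutator_dichotomy :
  (exists2 r : R, 0 < r & forall g h t, cpdisk t -> cabs t < r -> detcomm (M t g) (M t h) = 0) \/
  exists g h (c : R) (n : nat), 0 < c /\ \forall t \near (0 : C)^',
     c * cabs t ^+ n <= cabs (detcomm (M t g) (M t h)).
Proof.
have [r r0 order] := holo_order R.
have [comm0|] := pselect (forall g h t, cpdisk t -> cabs t < r -> detcomm (M t g) (M t h) = 0).
  by left; exists r.
move=> /existsNP[g /existsNP[h noncomm]]; right; exists g, h.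
have [kg [E [hE ME _]]] := exists_pole_order hrho g.
have [kh [F [hF MF _]]] := exists_pole_order hrho h.
have commE t : cpdisk t ->
    detcomm (M t g) (M t h) = ((t ^+ kg)^-1 * (t ^+ kh)^-1) ^+ 2 * detcomm (E t) (F t).
  by move=> tD; rewrite ME// MF// detcommZ.
have [comm0|[n [u [hu u0 uE]]]] := order _ (detcomm_holo hE hF).
  by exfalso; apply: noncomm => t tD tr; rewrite commE// comm0// mulr0.
exists (cabs (u 0) / 2), n; split; first by rewrite divr_gt0// cabs_gt0.
near=> t.
have tD : cpdisk t by near: t; exact: near0_cpdisk.
have ut : cabs (u 0) / 2 <= cabs (u t) by near: t; exact: near0_holo_ge.
have [t0 t1] : 0 < cabs t /\ cabs t < 1 by rewrite cabs_gt0; case: tD.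
have pow_le1 k : 1 <= (cabs t ^+ k)^-1.
  by rewrite invf_ge1 ?exprn_gt0// exprn_ile1// ltW.
have factor_ge1 : 1 <= cabs (((t ^+ kg)^-1 * (t ^+ kh)^-1) ^+ 2).
  rewrite cabsX exprn_ege1// cabsM !cabsV !cabsX -[1]mulr1.
  by apply: ler_pM.
rewrite commE// cabsM; apply: le_trans (_ : cabs (detcomm (E t) (F t)) <= _).
  by rewrite uE cabsM cabsX mulrC ler_wpM2l// exprn_ge0// ltW.
by rewrite ler_peMl// cabs_ge0.
Unshelve. all: by end_near. Qed.

Lemma exprn_scale t (n : nat) : cpdisk t -> cabs t ^+ n = expR (scale t * - n%:R).
Proof.
move=> [_ t0]; have tp : 0 < cabs t by rewrite cabs_gt0.
by rewrite /scale lnV ?posrE// mulrN mulNr opprK mulrC expRM_natl lnK// posrE.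
Qed.

Lemma lognorm_commutator t f g h (c : R) (n : nat) : cpdisk t -> 0 < c ->
  c * cabs t ^+ n <= cabs (detcomm (M t g) (M t h)) ->
  2 * lognorm t f - n%:R <= lognorm t g + lognorm t h +
    Num.max (lognorm t h + lognorm t (f * g * f^-1)%g) (lognorm t g + lognorm t (f * h * f^-1)%g)
    + ln (80 * 8 ^+ 3 / c) / scale t.
Proof.
move=> tD c0 comm_ge; set m := Num.max _ _.
have prod_le u v : lognorm t u + lognorm t v <= m ->
    opnorm (M t u) * opnorm (M t v) <= expR (scale t * m).
  by move=> uv; rewrite -!(expR_lognorm hrho)// -expRD -mulrDr ler_expR ler_pM2l ?scale_gt0.
have hg_le := prod_le h (f * g * f^-1)%g ltac:(by rewrite le_max lexx).
have gh_le := prod_le g (f * h * f^-1)%g ltac:(by rewrite le_max lexx orbT).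
apply: le_expR_scale => //; first by rewrite divr_gt0// mulr_gt0// exprn_gt0.
have -> : scale t * (2 * lognorm t f - n%:R) = 2 * (scale t * lognorm t f) + scale t * - n%:R.
  by ring.
rewrite expRD expRM_natl -exprn_scale// (expR_lognorm hrho)//.
have := opnorm_conj_detcomm (M t g) (M t h) (opnorm_rep_gt0 hrho f tD).
rewrite -(eval_repV hrho f tD) -!(eval_repM hrho)// => conj_le.
have := le_trans (ler_wpM2l (exprn_ge0 2 (opnorm_ge0 (M t f))) comm_ge) conj_le.
have -> : expR (scale t * (lognorm t g + lognorm t h + m)) =
    opnorm (M t g) * opnorm (M t h) * expR (scale t * m).
  by rewrite -!(expR_lognorm hrho)// -!expRD -!mulrDr.
have conclude (x p u v a b e : R) : 0 <= u -> 0 <= v -> a <= e -> b <= e ->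
    x * (c * p) <= 40 * 8 ^+ 3 * (u * v) * (a + b) -> x * p <= 80 * 8 ^+ 3 / c * (u * v * e).
  move=> u0 v0 ae be; rewrite [80 * _ / c * _]mulrAC ler_pdivlMr//.
  have -> : x * p * c = x * (c * p) by ring.
  move=> xcp.
  have uv0 : 0 <= 40 * 8 ^+ 3 * (u * v) by rewrite !mulr_ge0 ?exprn_ge0.
  by apply: le_trans xcp _; have := ler_wpM2l uv0 (lerD ae be); lra.
by apply: conclude; rewrite ?opnorm_ge0.
Qed.

Lemma commutator_gromov_le f g h (c D : R) (n : nat) : 0 < c ->
  (\forall t \near (0 : C)^', c * cabs t ^+ n <= cabs (detcomm (M t g) (M t h))) ->
  D <= gromov N (f * g)%g f -> D <= gromov N (f * h)%g f -> D <= n%:R + 2 * (N g + N h).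
Proof.
move=> c0 comm_ge Dg Dh; have Ncvg u := @lognorm_cvg _ _ _ hrho u.
have treeN : is_tree_length N := nalog_is_tree_length hrho.
have : 2 * N f - n%:R <= N g + N h +
    Num.max (N h + N (f * g * f^-1)%g) (N g + N (f * h * f^-1)%g).
  apply: (@cvg_almost_le _ _ _ _ (fun t => ln (80 * 8 ^+ 3 / c) / scale t)
    (@div_scale_cvg0 R _)
    (fun t => 2 * lognorm t f - n%:R) (fun t => lognorm t g + lognorm t h +
    Num.max (lognorm t h + lognorm t (f * g * f^-1)%g)
            (lognorm t g + lognorm t (f * h * f^-1)%g))).
  - by apply: cvgB; [apply: cvgMr; exact: Ncvg|exact: cvg_cst].
  - by apply: cvgD; [|apply: cvg_max]; apply: cvgD; exact: Ncvg.
  by apply: filterS2 (near0_cpdisk R) comm_ge => t tD; exact: lognorm_commutator.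
have := lenM f g (tree_len treeN); have := lenM f h (tree_len treeN).
move: Dg Dh; rewrite /gromov => Dg Dh fh fg.
have : Num.max (N h + N (f * g * f^-1)%g) (N g + N (f * h * f^-1)%g) <=
  2 * N f + N g + N h - D by rewrite ge_max; apply/andP; split; lra.
by move: (Num.max _ _) => x; lra.
Qed.

End Commutators.

(** * Word length and the Lyapunov exponents *)

Section WordLength.
Variables (R : realType) (G : groupType) (S : seq G).
Hypothesis hS : sym_gen_set S.
Implicit Types (g h : G) (L : G -> R) (m : G -> R).

Lemma word_lengthP g : word_of_len S g (word_length S g) /\
  forall k, word_of_len S g k -> (word_length S g <= k)%N.
Proof.
rewrite /word_length; set A := [set n | _]; suff : exists n, A n by move=> /(xgetPex 0%N).
have [_ /(_ g)[s [sS gs]]] := hS.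
have ex : exists n, `[< word_of_len S g n >] by exists (size s); apply/asboolP; exists s.
case: (ex_minnP ex) => n /asboolP nP nmin; exists n; split=> // k kP.
by apply: nmin; apply/asboolP.
Qed.

Lemma gprod_cat (s u : seq G) : gprod (s ++ u) = (gprod s * gprod u)%g.
Proof. by elim: s => [|a s IH] /=; [rewrite mul1g|rewrite /gprod /= -mulgA -IH]. Qed.

Lemma word_lengthM g h : (word_length S (g * h)%g <= word_length S g + word_length S h)%N.
Proof.
have [[s [sS <- gE]] _] := word_lengthP g; have [[u [uS <- hE]] _] := word_lengthP h.
have [_ minimal] := word_lengthP (g * h)%g; apply: minimal; exists (s ++ u); split.
- by rewrite all_cat sS.
- by rewrite size_cat.
- by rewrite gprod_cat -gE -hE.
Qed.

Lemma len_le_word_length L (K : R) g : is_length L -> {in S, forall s, L s <= K} ->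
  L g <= K * (word_length S g)%:R.
Proof.
move=> lenL LK; have [[s [sS <- ->]] _] := word_lengthP g.
elim: s sS => [|a s IH] /=; first by rewrite mulr0 /gprod /= (len1 lenL).
move=> /andP[/LK La /IH Ls]; rewrite /gprod /= -/(gprod s).
by apply: le_trans (lenM _ _ lenL) _; rewrite -natr1 mulrDr mulr1 addrC lerD.
Qed.

Definition word_weight g : R := 1 + (word_length S g)%:R.

Lemma word_weight_ge1 g : 1 <= word_weight g. Proof. by rewrite lerDl. Qed.

Lemma word_weightM g h : word_weight (g * h)%g <= word_weight g * word_weight h.
Proof.
have := word_lengthM g h; rewrite -(ler_nat R) natrD /word_weight.
by have := ler0n R (word_length S g); have := ler0n R (word_length S h); nra.
Qed.

Lemma word_weight_summable m : prob_on m ->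
  (exists2 delta : R, 0 < delta &
     (\esum_(g in [set: G]) (m g * powR ((word_length S g)%:R) (1 + delta))%:E < +oo)%E) ->
  rsummable (fun g => m g * word_weight g).
Proof.
move=> [m0 msum] [d d0 moment]; under eq_fun do rewrite /word_weight mulrDr mulr1.
apply: rsummableD; first by apply/rsummable_ge0 => //; rewrite msum ltry.
apply/rsummable_ge0 => [g|]; first by rewrite mulr_ge0.
apply: le_lt_trans moment; apply: le_esum => g _; rewrite lee_fin ler_wpM2l//.
have [->|n0] := posnP (word_length S g); first exact: powR_ge0.
by rewrite -[leLHS]powRr1//; apply: ler_powR; rewrite ?ler1n// lerDl ltW.
Qed.

End WordLength.

Section Lyapunov.
Variables (R : realType) (G : groupType) (S : seq G) (m : G -> R).
Variable rho : G -> 'I_2 -> 'I_2 -> R[i] -> R[i].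
Local Notation C := R[i].
Local Notation M := (eval_rep rho).
Local Notation lognorm := (lognorm rho).
Local Notation N := (nalog rho).
Hypothesis hS : sym_gen_set S.
Hypothesis hrho : is_SL2M_hom rho.
Variable W : walk R G.
Hypothesis stepW : step W = m.
Hypothesis wtW : wt W = word_weight R S.
Implicit Types t : C.

Let almost := near0_almost_tree_length hrho.
Let Ncvg := @lognorm_cvg _ _ _ hrho.
Let treeN := nalog_is_tree_length hrho.

Lemma near0_dominated_lognorm : exists K, \forall t \near (0 : C)^', dominated W K (lognorm t).
Proof.
exists (\sum_(s <- S) N s + 1).
have sum_cvg : \sum_(s <- S) lognorm t s @[t --> (0 : C)^'] --> \sum_(s <- S) N s.
  elim: (S) => [|s u IH]; first by under eq_fun do rewrite big_nil; rewrite big_nil; exact: cvg_cst.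
  by under eq_fun do rewrite big_cons; rewrite big_cons; apply: cvgD.
near=> t => g.
have tD : cpdisk t by near: t; exact: near0_cpdisk.
have lenL := lognorm_is_length hrho tD; have L0 := len_ge0 lenL.
have sum_le : \sum_(s <- S) lognorm t s <= \sum_(s <- S) N s + 1.
  by near: t; apply: (cvgr_le _ sum_cvg); rewrite ltrDl.
have le_K : {in S, forall s, lognorm t s <= \sum_(s <- S) N s + 1}.
  by move=> s sS; apply: le_trans sum_le; rewrite (big_rem s)//= lerDl sumr_ge0.
rewrite ger0_norm// wtW /word_weight; apply: le_trans (len_le_word_length hS g lenL le_K) _.
rewrite ler_wpM2l ?lerDr// addr_ge0// sumr_ge0// => s _; exact: len_ge0 (tree_len treeN) s.
Unshelve. all: by end_near. Qed.

Lemma chi_drift t : cpdisk t -> wbounded W (lognorm t) ->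
  chi m rho t / ln (cabs t)^-1 = drift W (lognorm t).
Proof.
move=> tD bL; have s0 := scale_gt0 tD; have lenL := lognorm_is_length hrho tD.
have chiE : (fun n : nat => n%:R^-1 * fine (int_conv m n (fun g => ln (opnorm (M t g))))) =
    (fun n : nat => scale t * (n%:R^-1 * mean W n (lognorm t))).
  apply/funext => n; have -> : (fun g => ln (opnorm (M t g))) = (fun g => scale t * lognorm t g).
    by apply/funext => g; rewrite lognorm.unlock mulrC divfK// gt_eqF.
  rewrite -stepW int_conv_mean /=; [|exact: wboundedZ|].
    by rewrite meanZ// mulrCA.
  by move=> g; rewrite mulr_ge0 ?(len_ge0 lenL)// ltW.
rewrite /chi chiE -/(scale t) (cvg_lim _ (cvgMr (drift_cvg lenL bL)))//.
by rewrite mulrC mulKf// gt_eqF.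
Qed.

Lemma chi_na_drift : wbounded W N -> chi_na m rho = drift W N.
Proof.
move=> bN; rewrite /chi_na.
have -> // : (fun n : nat => n%:R^-1 * fine (int_conv m n N)) =
  (fun n : nat => n%:R^-1 * mean W n N).
by apply/funext => n; rewrite -stepW int_conv_mean//; exact: len_ge0 (tree_len treeN).
Qed.

Lemma near0_drift_ge K e : (\forall t \near (0 : C)^', dominated W K (lognorm t)) ->
  supp_generates m -> 0 < e ->
  \forall t \near (0 : C)^', drift W N - e <= drift W (lognorm t).
Proof.
move=> LK gen e0; have bN : wbounded W N by exact: dominated_wbounded (dominated_lim Ncvg LK).
have lenN := tree_len treeN; have := drift_ge0 lenN bN; rewrite le_eqVlt => /orP[/eqP <-|l0].
  near=> t; rewrite sub0r; apply: (@le_trans _ _ 0); first by rewrite oppr_le0 ltW.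
  have tD : cpdisk t by near: t; exact: near0_cpdisk.
  have LtK : dominated W K (lognorm t) by near: t.
  exact: drift_ge0 (lognorm_is_length hrho tD) (dominated_wbounded LtK).
have [[r r0 comm0]|[g [h [c [n [c0 comm_ge]]]]]] := commutator_dichotomy hrho.
  apply: (near_drift_ge_character almost Ncvg (@defect_cvg R) LK e0); near=> t.
  have tD : cpdisk t by near: t; exact: near0_cpdisk.
  have tr : cabs t < r by near: t; apply/near0P; exists r.
  have [v v0 stable] := common_stable_row hrho tD (fun g h => comm0 g h t tD tr).
  exact: (stable_row_character hrho tD v0 stable).
have [sp|al] := spread_or_aligned treeN bN l0.
  have v0 : const_mx 1 != 0 :> 'cV[C]_2 by rewrite cV2_eq0 !mxE oner_eq0.
  pose v : nonzero_vector R := exist (fun u : 'cV[C]_2 => is_true (u != 0)) _ v0.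
  apply: (near_drift_ge_cocycle almost Ncvg (@defect_cvg R) LK v e0 l0 sp).
  apply: filterS (near0_cpdisk R) => t tD; exists (rep_act hrho tD), (log_stretch rho t).
  exact: log_stretch_cocycle.
have genW : supp_generates (step W) by rewrite stepW.
have [f fixed] := aligned_almost_fixed treeN l0 [:: g; h] (n%:R + 2 * (N g + N h) + 1) genW al.
have := commutator_gromov_le hrho c0 comm_ge (fixed g _) (fixed h _).
by rewrite !inE !eqxx orbT => /(_ isT isT); lra.
Unshelve. all: by end_near. Qed.

Lemma chi_cvg : supp_generates m ->
  (fun t : C => chi m rho t / ln (cabs t)^-1) @ dnbhs (0 : C) --> chi_na m rho.
Proof.
move=> gen; have [K LK] := near0_dominated_lognorm.
have bN : wbounded W N by exact: dominated_wbounded (dominated_lim Ncvg LK).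
rewrite (chi_na_drift bN).
apply/cvgrPdist_le => /= e e0.
have lower := near0_drift_ge LK gen e0.
have upper := near_drift_le almost Ncvg (@defect_cvg R) LK e0.
near=> t.
have tD : cpdisk t by near: t; exact: near0_cpdisk.
have LtK : dominated W K (lognorm t) by near: t.
rewrite (chi_drift tD (dominated_wbounded LtK)) ler_distlC.
by apply/andP; split; near: t; [exact: lower|exact: upper].
Unshelve. all: by end_near. Qed.

End Lyapunov.

Theorem theoremA (R : realType) (G : groupType) (S : seq G) (m : G -> R)
    (rho : G -> 'I_2 -> 'I_2 -> R[i] -> R[i]) :
  sym_gen_set S ->
  prob_on m ->
  supp_generates m ->
  (exists2 delta : R, 0 < delta &
     (\esum_(g in [set: G]) (m g * powR ((word_length S g)%:R) (1 + delta))%:E < +oo)%E) ->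
  is_SL2M_hom rho ->
  (fun t : R[i] => chi m rho t / ln (cabs t)^-1) @ dnbhs (0 : R[i])
    --> chi_na m rho.
Proof.
move=> hS hm gen moment hrho.
pose W := Walk hm.1 hm.2 (word_weight_ge1 R S) (word_weightM R hS) (word_weight_summable hm moment).
exact: (@chi_cvg R G S m rho hS hrho W).
Qed.
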